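(* For $m<n$ and the space of $n$ qubits $\mathcal{Q}_n=\mathcal{Q}_{n-m}\otimes\mathcal{Q}_m$, relativized to $m$ and $n$, for semi-density matrices $\sigma,\rho$ on $\mathcal{Q}_n$, $\mathbf{I}(\mathrm{Tr}_{\mathcal{Q}_m}\sigma:\mathrm{Tr}_{\mathcal{Q}_m}\rho)<^{+}\mathbf{I}(\sigma:\rho)$.
   Context: $\mathcal{Q}_k$ is the Hilbert space of $k$ qubits and $\mathrm{Tr}_{\mathcal{Q}_m}$ the partial trace over the $\mathcal{Q}_m$ factor. $U$ is a fixed universal prefix Turing machine and $\mathbf{m}(x/y)=\sum_p 2^{-\|p\|}[U_y(p)=x]$ the universal probability. A program $q$ lower computes a positive semidefinite matrix $\nu$ if $U(q)$ outputs an increasing sequence of rational-entry semi-density matrices converging to $\nu$; $\underline{\mathbf{m}}(\nu/x)=\sum\{\mathbf{m}(q/x): q\text{ lower computes }\nu\}$. The universal semi-density matrix on $k$ qubits is $\boldsymbol{\mu}_k=\sum_{\text{elementary }|\phi\rangle\in\mathcal{Q}_k}\mathbf{m}(|\phi\rangle/k)|\phi\rangle\langle\phi|$ (sum over pure states with rational coefficients). Let $\mathcal{C}_{C\otimes D}$ be the set of lower computable matrices $A\otimes B$ with $\mathrm{Tr}(A\otimes B)(C\otimes D)\le1$, $\mathfrak{C}_{C\otimes D}=\sum_{A\otimes B\in\mathcal{C}_{C\otimes D}}\underline{\mathbf{m}}(A\otimes B)A\otimes B$, and the quantum mutual information of $k$-qubit states is $\mathbf{I}(\sigma:\rho)=\log\mathrm{Tr}\,\mathfrak{C}_{\boldsymbol{\mu}_k\otimes\boldsymbol{\mu}_k}(\sigma\otimes\rho)$.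 $f<^{+}g$ means $f<g+O(1)$.
   Formalization: In ''lower computes'', the approximating rational matrices are only required to be positive semidefinite, not semi-density (trace at most 1); with the trace bound the inequality fails, e.g. n=m+1, σ=|0><0|⊗ψ, ρ=|0><0|⊗ψ'. *)

(* Defs.v *)
From HB Require Import structures.
From mathcomp Require Import all_boot all_order all_algebra.
From mathcomp Require Import finmap spectral.
From mathcomp Require Import complex mxtens.
From mathcomp Require Import boolp classical_sets reals ereal topology.
From mathcomp Require Import normedtype esum exp summability.

Set Implicit Arguments.
Unset Strict Implicit.
Unset Printing Implicit Defensive.

Import Order.TTheory GRing.Theory Num.Theory.
Import numFieldNormedType.Exports.

Local Open Scope classical_set_scope.
Local Open Scope ring_scope.
Local Open Scope complex_scope.
Local Open Scope sesquilinear_scope.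

(** * Prefix Turing machines

    A machine has a one-way read-only input tape carrying the program, a
    two-way read-only auxiliary tape carrying the conditional string, finitely
    many read/write work tapes (infinite to the right, initially blank), and a
    one-way write-only output tape.  The transition function maps finite sets
    to finite sets. *)

Variant move := MoveLeft | Stay | MoveRight.

(* [Read q0 q1] consumes the next program bit and goes to [q0] or [q1] according
   to whether it is [false] or [true]; [Work q a o w] goes to [q], moves the
   auxiliary head by [a], appends [o] to the output, and on every work tape
   writes a symbol and then moves. *)
Variant instr (Q G : Type) (k : nat) :=
| Halt
| Read of Q & Q
| Work of Q & move & option bool & ('I_k -> G * move).

Record machine := Machine {
  state : finType;
  start : state;
  symbol : finType;
  blank : symbol;
  tapes : nat;
  (* The auxiliary symbol is [None] beyond the end of the auxiliary string. *)
  delta : state -> option bool -> {ffun 'I_tapes -> symbol} ->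
          instr state symbol tapes
}.

Record config (M : machine) := Config {
  cstate : state M;
  cinput : seq bool; (* the part of the program that has not been read yet *)
  caux : nat;
  chead : 'I_(tapes M) -> nat;
  ctape : 'I_(tapes M) -> nat -> symbol M;
  coutput : seq bool
}.

Definition do_move (d : move) (a : nat) : nat :=
  match d with MoveLeft => a.-1 | Stay => a | MoveRight => a.+1 end.

Definition cinstr (M : machine) (y : seq bool) (c : config M) :=
  delta (cstate c) (onth y (caux c)) [ffun i => ctape c i (chead c i)].

(* A machine asking for a bit after the whole program has been read is stuck
   forever; it does not halt. *)
Definition step (M : machine) (y : seq bool) (c : config M) : config M :=
  match cinstr y c with
  | Halt => c
  | Read q0 q1 =>
      if cinput c is b :: p then
        Config (if b then q1 else q0) p (caux c) (chead c) (ctape c) (coutput c)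
      else c
  | Work q a o w =>
      Config q (cinput c) (do_move a (caux c))
        (fun i => do_move (w i).2 (chead c i))
        (fun i x => if x == chead c i then (w i).1 else ctape c i x)
        (coutput c ++ seq_of_opt o)
  end.

Definition init (M : machine) (p : seq bool) : config M :=
  Config (start M) p 0 (fun=> 0%N) (fun _ _ => blank M) [::].

Definition run (M : machine) (y p : seq bool) (t : nat) : config M :=
  iter t (@step M y) (init M p).

Definition halted (M : machine) (y : seq bool) (c : config M) : Prop :=
  cinstr y c = @Halt _ _ _.

(** [computes M y p x] is M_y(p) = x: the machine halts with output [x] having
    read exactly the bits of [p].  For fixed [y] the domain is prefix-free. *)
Definition computes (M : machine) (y p x : seq bool) : Prop :=
  exists t, [/\ halted y (run M y p t), cinput (run M y p t) = [::]
              & coutput (run M y p t) = x].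

(** [s] is an initial segment of what is ever written on the output tape, with
    or without halting. *)
Definition emits (M : machine) (y p s : seq bool) : Prop :=
  exists t, prefix s (coutput (run M y p t)).

Definition universal (U : machine) : Prop :=
  forall V : machine, exists i : seq bool, forall y p : seq bool,
    (forall x, computes U y (i ++ p) x <-> computes V y p x) /\
    (forall s, emits U y (i ++ p) s <-> emits V y p s).

(** * Encodings as bit strings (injective and self-delimiting) *)

Definition enc_nat (a : nat) : seq bool := rcons (nseq a true) false.

Definition enc_int (a : int) : seq bool := (a < 0) :: enc_nat `|a|%N.

Definition enc_rat (a : rat) : seq bool := enc_int (numq a) ++ enc_int (denq a).

Definition enc_crat (a : rat[i]) : seq bool :=
  enc_rat (complex.Re a) ++ enc_rat (complex.Im a).

Definition enc_mx (r c : nat) (M : 'M[rat[i]]_(r, c)) : seq bool :=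
  enc_nat r ++ enc_nat c ++
  flatten [seq enc_crat (M i j) | i <- enum 'I_r, j <- enum 'I_c].

Definition enc_pair (y z : seq bool) : seq bool := enc_nat (size y) ++ y ++ z.

(** * Matrices *)

(* The usual topology on R[i], from its structure of numFieldType; matrices over
   R[i] inherit it. *)
HB.instance Definition _ (R : realType) := NormedModule.copy R[i] R[i]^o.

Section Matrices.
Variable R : realType.

Definition crat_mx (r c : nat) (M : 'M[rat[i]]_(r, c)) : 'M[R[i]]_(r, c) :=
  map_mx (fun a => ratr (complex.Re a) +i* ratr (complex.Im a)) M.

(* Over the complex numbers this forces [M] to be Hermitian, because
   [0 <= a] in [R[i]] says that [a] is real and nonnegative. *)
Definition psd (d : nat) (M : 'M[R[i]]_d) : Prop :=
  forall v : 'cV[R[i]]_d, 0 <= (v^t* *m M *m v) 0 0.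

Definition semi_density (d : nat) (M : 'M[R[i]]_d) : Prop :=
  psd M /\ \tr M <= 1.

Lemma qubits_split (m n : nat) :
  (m < n)%N -> (2 ^ n = 2 ^ (n - m) * 2 ^ m)%N.
Proof. by move=> mn; rewrite -expnD subnK // ltnW. Qed.

(** The partial trace over Q_m, where Q_n = Q_{n-m} (x) Q_m through the index
    convention of [tensmx]. *)
Definition ptrace (m n : nat) (mn : (m < n)%N) (M : 'M[R[i]]_(2 ^ n)) :
    'M[R[i]]_(2 ^ (n - m)) :=
  \matrix_(i, j) \sum_(l < 2 ^ m)
    castmx (qubits_split mn, qubits_split mn) M
      (mxtens_index (i, l)) (mxtens_index (j, l)).

(** * Universal probability and lower computable matrices

    Everything is relativized to a string [z]: each U_y is replaced by
    U_<y,z>.  An absent condition is the empty string. *)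

Variables (U : machine) (z : seq bool).

Definition univ_prob (x y : seq bool) : \bar R :=
  \esum_(p in [set p | computes U (enc_pair y z) p x]) ((2 ^- size p)%:E).

(* The approximations are positive semidefinite, of arbitrary trace. *)
Definition lower_computes (d : nat) (q : seq bool) (nu : 'M[R[i]]_d) : Prop :=
  exists u : nat -> 'M[rat[i]]_d,
    [/\ forall s, emits U (enc_pair [::] z) q s <->
          exists N, prefix s (flatten [seq enc_mx (u j) | j <- iota 0 N]),
        forall j, psd (crat_mx (u j)),
        forall j, psd (crat_mx (u j.+1) - crat_mx (u j))
      & (fun j => crat_mx (u j)) @ \oo --> nu].

Definition mx_prob (d : nat) (nu : 'M[R[i]]_d) (x : seq bool) : \bar R :=
  \esum_(q in [set q | lower_computes q nu]) univ_prob q x.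

(* [sum] is unconditional summation, the limit along finite sets of indices.
   The [\bar R]-valued weights below are at most 1 by the Kraft inequality, so
   [fine] only changes their type. *)

Definition elementary_state (k : nat) (phi : 'cV[rat[i]]_(2 ^ k)) : Prop :=
  (crat_mx phi)^t* *m crat_mx phi = 1%:M.

Definition univ_semi_density (k : nat) : 'M[R[i]]_(2 ^ k) :=
  sum (fun phi : 'cV[rat[i]]_(2 ^ k) =>
    (if `[< elementary_state phi >]
     then fine (univ_prob (enc_mx phi) (enc_nat k)) else 0)%:C
    *: (crat_mx phi *m (crat_mx phi)^t*)).

Definition tensor_tests (a b : nat) (C : 'M[R[i]]_a) (D : 'M[R[i]]_b) :
    set 'M[R[i]]_(a * b) :=
  [set nu | [/\ exists q, lower_computes q nu,
                exists A B, nu = A *t B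
              & \tr (nu *m (C *t D)) <= 1]].

Definition tensor_test_sum (a b : nat) (C : 'M[R[i]]_a) (D : 'M[R[i]]_b) :
    'M[R[i]]_(a * b) :=
  sum (fun nu : 'M[R[i]]_(a * b) =>
    (if `[< tensor_tests C D nu >] then fine (mx_prob nu [::]) else 0)%:C *: nu).

(* Base 2, with log 0 = -oo. *)
Definition log2 (x : R) : \bar R := (lne x%:E * (ln 2)^-1%:E)%E.

Definition mutual_info (k : nat) (sigma rho : 'M[R[i]]_(2 ^ k)) : \bar R :=
  let mu := univ_semi_density k in
  log2 (complex.Re (\tr (tensor_test_sum mu mu *m (sigma *t rho)))).

End Matrices.

(* Main.v *)
(* Partial trace can only lose information because it can be undone on the side of the tests and
   simulated on the side of the universal state.  Write k = n - m.

   A test nu = A (x) B for k qubits is lifted to nu' = 2^-2S sum_{l,l'} (K_l (x) K_l') nu (K_l (x) K_l')^T,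
   where K_l = id (x) |l>.  Then Tr nu'(sigma (x) rho) = 2^-2S Tr nu (Tr_m sigma (x) Tr_m rho), a program
   for nu is turned into a program for nu' by a fixed prefix, and nu |-> nu' is injective; so the sum
   of tests for k qubits is bounded by a constant times the one for n qubits, provided that nu' is a test.

   This holds as soon as Tr_m mu_n <= 2^S mu_k.  For an elementary state phi on n qubits with slices
   phi_l = K_l^T phi, clear the denominators by an integer D; the D^2 |phi_l|^2 are natural numbers
   with sum D^2, so that log(D^2) random bits sample l with probability about |phi_l|^2.
   Since phi_l / |phi_l| need not be rational, the machine outputs instead one of two elementary states,
   the basis vector b and a vector e obtained by rational reflection, which dominate it:
   |phi_l><phi_l| <= 25 |phi_l|^2 (|e><e| + |b><b|).  A program for phi of length p thus yields
   programs of length p + log(D^2) + O(1) whose total contribution to mu_k dominates sum_l |phi_l><phi_l|.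

   The machines are obtained from a small imperative language over natural number registers,
   with an instruction running the universal machine one step, compiled to Turing machines. *)
From HB Require Import structures.
Require Import Defs.
From mathcomp Require Import all_boot all_order all_algebra.
From mathcomp Require Import finmap spectral.
From mathcomp Require Import complex mxtens.
From mathcomp Require Import boolp classical_sets reals ereal topology.
From mathcomp Require Import cardinality fsbigop normedtype esum exp summability.
From mathcomp Require Import zify ring lra.

Set Implicit Arguments.
Unset Strict Implicit.
Unset Printing Implicit Defensive.

Import Order.TTheory GRing.Theory Num.Theory.
Import numFieldNormedType.Exports.

(** * Machines and compilation *)

(** No maximality property of universal semimeasures is invoked. Each comparison of probabilities is
    an explicit injection between sets of programs that lengthens them by a bounded amount, so the
    constants are lengths of prefixes; these prefixes do not depend on [m] and [n], which the
    machines read from the auxiliary string. The sampler needs no delimiters: the simulated machine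
    reads the same program tape and halts exactly at the end of its own program, so the bits behind
    it are free to serve as random bits, and their number is computed from the state just printed.
    The scaling by twice [S] comes from using the domination in both tensor factors. A separate
    obstacle is that [sum] is defined as a limit. Before a trace can be taken through it,
    convergence has to be shown. For the sum of tests this needs a bound on the traces of all tests,
    which comes from the fact that some multiple of the universal matrix dominates the identity;
    that multiple may depend on the dimension, since it only ensures convergence. *)

Definition stuck (M : machine) (y : seq bool) (c : config M) : bool :=
  if cinstr y c is Read _ _ then cinput c == [::] else false.

Definition add_input (M : machine) (r : seq bool) (c : config M) : config M :=
  Config (cstate c) (cinput c ++ r) (caux c) (chead c) (ctape c) (coutput c).

Section MachineFacts.
Variables (M : machine) (y : seq bool).
Implicit Types c : config M.

Lemma step_stuck c : stuck y c -> step y c = c.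
Proof. by rewrite /stuck /step; case: cinstr => // q0 q1 /eqP->. Qed.

Lemma step_halted c : halted y c -> step y c = c.
Proof. by rewrite /halted /step => ->. Qed.

Lemma iter_fix (T : Type) (f : T -> T) x t : f x = x -> iter t f x = x.
Proof. by move=> fx; elim: t => //= t ->. Qed.

Lemma iter_output t c : prefix (coutput c) (coutput (iter t (@step M y) c)).
Proof.
elim: t => [|t IH]; first exact: prefix_refl.
rewrite iterS; apply: prefix_trans IH _.
rewrite /step; case: cinstr => [|q0 q1|q a o w]; first exact: prefix_refl.
  by case: cinput => [|b p]; exact: prefix_refl.
by apply/prefixP; eexists.
Qed.

Lemma iter_output_le c t t' : (t <= t')%N ->
  prefix (coutput (iter t (@step M y) c)) (coutput (iter t' (@step M y) c)).
Proof. by move=> /subnK<-; rewrite iterD iter_output. Qed.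

Lemma cinstr_add_input r c : cinstr y (add_input r c) = cinstr y c.
Proof. by []. Qed.

Lemma step_add_input r c : ~~ stuck y c ->
  step y (add_input r c) = add_input r (step y c).
Proof.
rewrite /stuck /step cinstr_add_input; case: cinstr => //= q0 q1.
by case: cinput.
Qed.

(** A stuck configuration is a fixed point of [step] whose instruction is [Read], so a run that
    halts cannot have been stuck before. *)
Lemma halted_not_stuck c t t' : halted y (iter t (@step M y) c) -> (t' <= t)%N ->
  ~~ stuck y (iter t' (@step M y) c).
Proof.
move=> h tt'; apply/negP => st; move: h.
rewrite -(subnK tt') iterD (iter_fix _ (step_stuck st)) /halted => e.
by rewrite /stuck e in st.
Qed.

Lemma iter_add_input r c t : (forall t', (t' < t)%N -> ~~ stuck y (iter t' (@step M y) c)) ->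
  iter t (@step M y) (add_input r c) = add_input r (iter t (@step M y) c).
Proof.
elim: t => [//|t IH] h; rewrite !iterS IH; last by move=> t' /ltnW/h.
by rewrite step_add_input // h.
Qed.

Lemma run_add_input p r t : halted y (run M y p t) ->
  run M y (p ++ r) t = add_input r (run M y p t).
Proof.
move=> h; apply: (@iter_add_input r (init M p)) => t' /ltnW.
exact: halted_not_stuck.
Qed.

Lemma halted_later c t t' : halted y (iter t (@step M y) c) -> (t <= t')%N ->
  iter t' (@step M y) c = iter t (@step M y) c.
Proof. by move=> h /subnK<-; rewrite iterD iter_fix //; apply: step_halted. Qed.

(** A halting run on [p] never waits for input, so the run on [p ++ r] repeats it and leaves [r] on
    the tape. The halting configuration is unique, hence the longer program is read entirely only if
    [r] is empty. *)
Lemma computes_prefix_free p r x x' :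
  computes M y p x -> computes M y (p ++ r) x' -> r = [::] /\ x = x'.
Proof.
move=> [t [h i o]] [t' [h' i' o']].
have h2 : halted y (run M y (p ++ r) t) by rewrite run_add_input.
have e : run M y (p ++ r) t = run M y (p ++ r) t'.
  have [le|/ltnW le] := leqP t t'; first by apply/esym/(halted_later h2 le).
  exact: (halted_later h' le).
by move: i' o'; rewrite -e run_add_input //= i o => /= -> ->.
Qed.

Lemma computes_fun p x x' : computes M y p x -> computes M y p x' -> x = x'.
Proof. by move=> h; rewrite -{1}[p]cats0 => /(computes_prefix_free h)[]. Qed.

End MachineFacts.

(** * Register commands and their compilation to Turing machines *)

Inductive cmd :=
| CSkip | CInc of nat | CDec of nat | COut of bool | CPut of bool | CPutL
| CRead of nat | CAux of nat | CU of nat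
| CSeq of cmd & cmd | CIf of nat & cmd & cmd | CWhile of nat & cmd.

Inductive op :=
| OMark of nat | OJmp of nat | OInc of nat & nat | ODec of nat & nat
| OTest of nat & nat & nat | ORead of nat & nat | OOut of bool & nat
| OAux of nat & nat & nat | OPut of bool & nat | OPutL of nat
| OU of nat & nat & nat & nat | OHalt.

Fixpoint len (c : cmd) : nat :=
  match c with
  | CSkip => 0
  | CInc _ | CDec _ | COut _ | CPut _ | CPutL => 1
  | CRead _ => 2 | CAux _ => 3 | CU _ => 4
  | CSeq c1 c2 => len c1 + len c2
  | CIf _ c1 c2 => len c1 + len c2 + 2
  | CWhile _ c => len c + 2
  end%N.

(** A value obtained by branching is added to a register by jumping into a run of [OInc], as many
    instructions before its end as the value says. Jump targets are absolute; [a] is the address of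
    the first instruction. *)
Fixpoint code (a : nat) (c : cmd) : seq op :=
  match c with
  | CSkip => [::]
  | CInc r => [:: OInc r a.+1]
  | CDec r => [:: ODec r a.+1]
  | COut b => [:: OOut b a.+1]
  | CPut b => [:: OPut b a.+1]
  | CPutL => [:: OPutL a.+1]
  | CRead r => [:: ORead a.+2 a.+1; OInc r a.+2]
  | CAux r => [:: OAux a.+3 a.+2 a.+1; OInc r a.+2; OInc r a.+3]
  | CU r => [:: OU a.+4 a.+3 a.+2 a.+1; OInc r a.+2; OInc r a.+3; OInc r a.+4]
  | CSeq c1 c2 => code a c1 ++ code (a + len c1) c2
  | CIf r c1 c2 => OTest r (a + len c1 + 2) a.+1 ::
      code a.+1 c1 ++ OJmp (a + len c1 + len c2 + 2) :: code (a + len c1 + 2) c2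
  | CWhile r c => OTest r (a + len c + 2) a.+1 :: code a.+1 c ++ [:: OJmp a]
  end%N.

Lemma size_code a c : size (code a c) = len c.
Proof.
elim: c a => //= [c1 IH1 c2 IH2|r c1 IH1 c2 IH2|r c IH] a;
  by rewrite size_cat /= ?IH1 ?IH2 ?IH ?addn2 ?addn1 //= addnS.
Qed.

Fixpoint maxreg (c : cmd) : nat :=
  match c with
  | CInc r | CDec r | CRead r | CAux r | CU r => r.+1
  | CSeq c1 c2 => maxn (maxreg c1) (maxreg c2)
  | CIf r c1 c2 => maxn r.+1 (maxn (maxreg c1) (maxreg c2))
  | CWhile r c => maxn r.+1 (maxreg c)
  | _ => 0
  end%N.

Section Compile.
Variable U : machine.

(** The state keeps a whole configuration of [U]. Its [cinput] is also the unread program of the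
    simulating machine, since both share the program tape. [waux] is the head on the real auxiliary
    string, whereas [wtape] is an extra tape that [U] takes for its auxiliary tape, filled by [CPut]
    and rewound by [CPutL]. *)
Record world := World {
  wreg : nat -> nat;
  waux : nat;
  wout : seq bool;
  wtape : nat -> option bool;
  wU : config U
}.

Definition setU_input (p : seq bool) (c : config U) : config U :=
  Config (cstate c) p (caux c) (chead c) (ctape c) (coutput c).
Definition setU_aux (a : nat) (c : config U) : config U :=
  Config (cstate c) (cinput c) a (chead c) (ctape c) (coutput c).

Definition upd (f : nat -> nat) (r v : nat) : nat -> nat :=
  fun x => if x == r then v else f x.

Definition setregs (w : world) (f : nat -> nat) : world :=
  World f (waux w) (wout w) (wtape w) (wU w).
Definition setreg (w : world) (r v : nat) : world :=
  setregs w (upd (wreg w) r v).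

Definition bitval (o : option bool) : nat := if o is Some b then b.+1 else 0.

Definition outcome (yU : seq bool) (c : config U) : nat :=
  match cinstr yU c with Halt => 3 | Read _ _ => 0 | Work _ _ o _ => bitval o end.

Section Exec.
Variable y : seq bool.

(** There is no rule for reading beyond the program or for stepping a stuck [U]: a derivation
    describes a run that gets through. The string [yU] in [XU] is only required to agree with the
    tape at that moment. *)
Inductive exec : cmd -> world -> world -> Prop :=
| XSkip w : exec CSkip w w
| XInc w r : exec (CInc r) w (setreg w r (wreg w r).+1)
| XDec w r : exec (CDec r) w (setreg w r (wreg w r).-1)
| XOut w b : exec (COut b) w
    (World (wreg w) (waux w) (rcons (wout w) b) (wtape w) (wU w))
| XPut w b : exec (CPut b) w
    (World (wreg w) (waux w) (wout w)
       (fun x => if x == caux (wU w) then Some b else wtape w x)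
       (setU_aux (caux (wU w)).+1 (wU w)))
| XPutL w : exec CPutL w
    (World (wreg w) (waux w) (wout w) (wtape w) (setU_aux (caux (wU w)).-1 (wU w)))
| XRead w r b p : cinput (wU w) = b :: p ->
    exec (CRead r) w
      (World (upd (wreg w) r (wreg w r + b)) (waux w) (wout w) (wtape w)
         (setU_input p (wU w)))
| XAux w r : exec (CAux r) w
    (World (upd (wreg w) r (wreg w r + bitval (onth y (waux w)))) (waux w).+1
       (wout w) (wtape w) (wU w))
| XU w r yU : (forall x, wtape w x = onth yU x) -> ~~ stuck yU (wU w) ->
    exec (CU r) w
    (World (upd (wreg w) r (wreg w r + outcome yU (wU w))) (waux w)
       (wout w) (wtape w) (step yU (wU w)))
| XSeq c1 c2 w w1 w2 : exec c1 w w1 -> exec c2 w1 w2 -> exec (CSeq c1 c2) w w2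
| XIf1 r c1 c2 w w1 : wreg w r != 0 -> exec c1 w w1 -> exec (CIf r c1 c2) w w1
| XIf0 r c1 c2 w w1 : wreg w r = 0 -> exec c2 w w1 -> exec (CIf r c1 c2) w w1
| XWhile1 r c w w1 w2 : wreg w r != 0 -> exec c w w1 ->
    exec (CWhile r c) w1 w2 -> exec (CWhile r c) w w2
| XWhile0 r c w : wreg w r = 0 -> exec (CWhile r c) w w.

End Exec.

Variables (N : nat) (P : seq op).

(** Each cell carries a mark, a symbol of the simulated auxiliary string and a work symbol of [U]. A
    register is the head position on a tape of its own: increment and decrement are moves, a move to
    the left in cell 0 gives the truncated predecessor, and the mark of cell 0 is the zero test.
    Tape [N] is the simulated auxiliary tape. *)
Definition csymbol : finType := (bool * option bool * symbol U)%type.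
Definition cstates : finType := ('I_(size P).+1 * state U)%type.
Definition ctapes : nat := N.+1 + tapes U.

Definition regtape (r : nat) : 'I_ctapes := lshift (tapes U) (inord r : 'I_N.+1).
Definition ut (j : 'I_(tapes U)) : 'I_ctapes := rshift N.+1 j.

Definition goto (a : nat) (s : state U) : cstates := (inord a, s).

Definition bit_case (A : Type) (o : option bool) (aN a0 a1 : A) : A :=
  if o is Some b then (if b then a1 else a0) else aN.

Definition op_delta (o : op) (s : state U) (x : option bool)
    (f : {ffun 'I_ctapes -> csymbol}) : instr cstates csymbol ctapes :=
  let keep := fun i => (f i, Stay) in
  match o with
  | OMark a => Work (goto a s) Stay None (fun i => ((true, (f i).1.2, (f i).2), Stay))
  | OJmp a => Work (goto a s) Stay None keep
  | OInc r a => Work (goto a s) Stay None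
      (fun i => (f i, if i == regtape r then MoveRight else Stay))
  | ODec r a => Work (goto a s) Stay None
      (fun i => (f i, if i == regtape r then MoveLeft else Stay))
  | OTest r az anz => Work (goto (if (f (regtape r)).1.1 then az else anz) s) Stay None keep
  | ORead a0 a1 => Read _ _ (goto a0 s) (goto a1 s)
  | OOut b a => Work (goto a s) Stay (Some b) keep
  | OAux aN a0 a1 => Work (goto (bit_case x aN a0 a1) s) MoveRight None keep
  | OPut b a => Work (goto a s) Stay None
      (fun i => if i == regtape N then (((f i).1.1, Some b, (f i).2), MoveRight) else keep i)
  | OPutL a => Work (goto a s) Stay None
      (fun i => (f i, if i == regtape N then MoveLeft else Stay))
  | OU aN a0 a1 aH =>
      match delta s (f (regtape N)).1.2 [ffun j => (f (ut j)).2] with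
      | Halt => Work (goto aH s) Stay None keep
      | Read s0 s1 => Read _ _ (goto aN s0) (goto aN s1)
      | Work s' mv o w => Work (goto (bit_case o aN a0 a1) s') Stay None
          (fun i => match split i with
                    | inl l => (f i, if i == regtape N then mv else Stay)
                    | inr j => (((f i).1, (w j).1), (w j).2) end)
      end
  | OHalt => @Halt _ _ _
  end.

Definition comp_delta (qs : cstates) := op_delta (nth OHalt P qs.1) qs.2.

Definition cmachine : machine :=
  @Machine cstates (goto 0 (start U)) csymbol (false, None, blank U) ctapes comp_delta.

Record rel (a : nat) (w : world) (c : config cmachine) : Prop := Rel {
  rel_state : cstate c = goto a (cstate (wU w));
  rel_input : cinput c = cinput (wU w);
  rel_aux : caux c = waux w;
  rel_out : coutput c = wout w;
  rel_reg : forall r, (r < N)%N -> chead c (regtape r) = wreg w r;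
  rel_uaux : chead c (regtape N) = caux (wU w);
  rel_uhead : forall j, chead c (ut j) = chead (wU w) j;
  rel_mark : forall i x, (ctape c i x).1.1 = (x == 0)%N;
  rel_tape : forall x, (ctape c (regtape N) x).1.2 = wtape w x;
  rel_utape : forall j x, (ctape c (ut j) x).2 = ctape (wU w) j x
}.

Lemma rt_eq r r' : (r < N.+1)%N -> (r' < N.+1)%N -> (regtape r == regtape r') = (r == r').
Proof.
move=> h h'; rewrite /regtape (inj_eq (@lshift_inj _ _)).
by rewrite -val_eqE /= !inordK.
Qed.

Lemma ut_rt r j : (ut j == regtape r) = false.
Proof. by rewrite /ut /regtape eq_rlshift. Qed.

Lemma split_rt r : split (regtape r) = inl (inord r).
Proof. exact: (unsplitK (inl _)). Qed.

Lemma split_ut j : split (ut j) = inr j.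
Proof. exact: (unsplitK (inr _)). Qed.

Variable y : seq bool.

Definition reach a (w : world) a' (w' : world) : Prop :=
  forall c, rel a w c -> exists t, rel a' w' (iter t (@step cmachine y) c).

(** At least one step is demanded so that the rounds of an endless loop exhaust the whole run, as
    [compile_emits] requires. *)
Definition reachS a (w : world) a' (w' : world) : Prop :=
  forall c, rel a w c -> exists t, rel a' w' (iter t.+1 (@step cmachine y) c).

Lemma reachSW a w a' w' : reachS a w a' w' -> reach a w a' w'.
Proof. by move=> h c /h[t]; exists t.+1. Qed.

Lemma reach_refl a w : reach a w a w.
Proof. by move=> c r; exists 0. Qed.

Lemma reach_trans a w a1 w1 a2 w2 :
  reach a w a1 w1 -> reach a1 w1 a2 w2 -> reach a w a2 w2.
Proof. by move=> h1 h2 c /h1[t /h2[t' r]]; exists (t' + t); rewrite iterD. Qed.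

Lemma reachS_trans a w a1 w1 a2 w2 :
  reachS a w a1 w1 -> reach a1 w1 a2 w2 -> reachS a w a2 w2.
Proof. by move=> h1 h2 c /h1[t /h2[t' r]]; exists (t' + t); rewrite -addnS iterD. Qed.

Lemma cinstr_rel a w c o : rel a w c -> (a < size P)%N -> nth OHalt P a = o ->
  cinstr y c = op_delta o (cstate (wU w)) (onth y (waux w))
    [ffun i => ctape c i (chead c i)].
Proof.
move=> r h <-; rewrite /cinstr (rel_state r) (rel_aux r) /= /comp_delta /=.
by rewrite inordK ?ltnS 1?ltnW.
Qed.

Lemma tape_id (c : config cmachine) i x :
  (if x == chead c i then ctape c i (chead c i) else ctape c i x) = ctape c i x.
Proof. by case: eqP => [->|]. Qed.

(** All heads start in cell 0, so a single operation marks that cell on every tape; [rel] cannot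
    hold before it. *)
Lemma reach_mark a a' w (c : config cmachine) : (a < size P)%N -> nth OHalt P a = OMark a' ->
  cstate c = goto a (cstate (wU w)) -> cinput c = cinput (wU w) -> caux c = waux w ->
  coutput c = wout w -> (forall r, (r < N)%N -> wreg w r = 0) -> caux (wU w) = 0 ->
  (forall i, chead c i = 0) -> (forall j, chead (wU w) j = 0) ->
  (forall i x, ctape c i x = (false, None, blank U)) ->
  (forall x, wtape w x = None) -> (forall j x, ctape (wU w) j x = blank U) ->
  rel a' w (step y c).
Proof.
move=> h oP cs ci ca co wr wa hc hw tc tw tu.
rewrite /step /cinstr cs /= /comp_delta /goto /= inordK ?ltnS 1?ltnW // oP /=.
split=> //=; first by rewrite co cats0.
- by move=> r rN; rewrite hc wr.
- by rewrite hc wa.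
- by move=> j; rewrite hc hw.
- by move=> i x; rewrite hc; case: eqP => _ //=; rewrite tc.
- by move=> x; rewrite hc; case: eqP => _; rewrite ?ffunE tc ?tw.
by move=> j x; rewrite hc; case: eqP => _; rewrite ?ffunE tc ?tu.
Qed.

Lemma reach_jmp a a' w : (a < size P)%N -> nth OHalt P a = OJmp a' -> reachS a w a' w.
Proof.
move=> h oP c r; exists 0; rewrite /= /step (cinstr_rel r h oP) /=.
case: r => rs ri ra ro rr ru ruh rm rta rut.
by split=> //= *; rewrite ?ffunE ?tape_id ?cats0.
Qed.

Lemma reach_inc a a' r w : (a < size P)%N -> nth OHalt P a = OInc r a' -> (r < N)%N ->
  reachS a w a' (setreg w r (wreg w r).+1).
Proof.
move=> h oP rN c R; exists 0; rewrite /= /step (cinstr_rel R h oP) /=.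
case: R => rs ri ra ro rr ru ruh rm rta rut.
split=> //= *; rewrite ?ffunE ?tape_id ?cats0 ?ut_rt ?rt_eq ?ltnS // ?(ltnW rN) 1?ltnW //.
- by rewrite /upd; case: eqP => [->|]; rewrite /= rr.
- by rewrite eq_sym (ltn_eqF rN).
by rewrite /= ruh.
Qed.

Lemma reach_dec a a' r w : (a < size P)%N -> nth OHalt P a = ODec r a' -> (r < N)%N ->
  reachS a w a' (setreg w r (wreg w r).-1).
Proof.
move=> h oP rN c R; exists 0; rewrite /= /step (cinstr_rel R h oP) /=.
case: R => rs ri ra ro rr ru ruh rm rta rut.
split=> //= *; rewrite ?ffunE ?tape_id ?cats0 ?ut_rt ?rt_eq ?ltnS // ?(ltnW rN) 1?ltnW //.
- by rewrite /upd; case: eqP => [->|]; rewrite /= rr.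
- by rewrite eq_sym (ltn_eqF rN).
by rewrite /= ruh.
Qed.

Lemma reach_test a az anz r w : (a < size P)%N -> nth OHalt P a = OTest r az anz ->
  (r < N)%N -> reachS a w (if wreg w r == 0 then az else anz) w.
Proof.
move=> h oP rN c R; exists 0; rewrite /= /step (cinstr_rel R h oP) /=.
case: R => rs ri ra ro rr ru ruh rm rta rut.
by split=> //= *; rewrite ?ffunE ?tape_id ?cats0 // rm rr.
Qed.

Lemma reach_read a a0 a1 w b p : (a < size P)%N -> nth OHalt P a = ORead a0 a1 ->
  cinput (wU w) = b :: p ->
  reachS a w (if b then a1 else a0)
    (World (wreg w) (waux w) (wout w) (wtape w) (setU_input p (wU w))).
Proof.
move=> h oP wi c R; exists 0; rewrite /= /step (cinstr_rel R h oP) /=.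
case: R => rs ri ra ro rr ru ruh rm rta rut; rewrite ri wi.
by split=> //=; case: (b).
Qed.

Lemma reach_out a a' b w : (a < size P)%N -> nth OHalt P a = OOut b a' ->
  reachS a w a' (World (wreg w) (waux w) (rcons (wout w) b) (wtape w) (wU w)).
Proof.
move=> h oP c R; exists 0; rewrite /= /step (cinstr_rel R h oP) /=.
case: R => rs ri ra ro rr ru ruh rm rta rut.
by split=> //= *; rewrite ?ffunE ?tape_id // ro cats1.
Qed.

Lemma reach_aux a aN a0 a1 w : (a < size P)%N -> nth OHalt P a = OAux aN a0 a1 ->
  reachS a w (bit_case (onth y (waux w)) aN a0 a1)
    (World (wreg w) (waux w).+1 (wout w) (wtape w) (wU w)).
Proof.
move=> h oP c R; exists 0; rewrite /= /step (cinstr_rel R h oP) /=.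
case: R => rs ri ra ro rr ru ruh rm rta rut.
by split=> //= *; rewrite ?ffunE ?tape_id ?cats0 // ra.
Qed.

Lemma reach_put a a' b w : (a < size P)%N -> nth OHalt P a = OPut b a' ->
  reachS a w a' (World (wreg w) (waux w) (wout w)
       (fun x => if x == caux (wU w) then Some b else wtape w x)
       (setU_aux (caux (wU w)).+1 (wU w))).
Proof.
move=> h oP c R; exists 0; rewrite /= /step (cinstr_rel R h oP) /=.
case: R => rs ri ra ro rr ru ruh rm rta rut.
split=> //=; rewrite ?cats0 //.
- by move=> r rN; rewrite rt_eq ?(leqW rN) ?ltnS // (ltn_eqF rN) /= rr.
- by rewrite eqxx /= ru.
- by move=> j; rewrite ut_rt /= ruh.
- move=> i x; case: (i == _) => /=; rewrite ?ffunE ?tape_id //.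
  by case: eqP => //= ->; rewrite !rm.
- by move=> x; rewrite eqxx ru; case: eqP.
by move=> j x; rewrite ut_rt /= !ffunE tape_id.
Qed.

Lemma reach_putl a a' w : (a < size P)%N -> nth OHalt P a = OPutL a' ->
  reachS a w a' (World (wreg w) (waux w) (wout w) (wtape w)
    (setU_aux (caux (wU w)).-1 (wU w))).
Proof.
move=> h oP c R; exists 0; rewrite /= /step (cinstr_rel R h oP) /=.
case: R => rs ri ra ro rr ru ruh rm rta rut.
split=> //=; rewrite ?cats0 //.
- by move=> r rN; rewrite rt_eq ?(leqW rN) ?ltnS // (ltn_eqF rN) /= rr.
- by rewrite eqxx /= ru.
- by move=> j; rewrite ut_rt /= ruh.
- by move=> i x; rewrite ?ffunE ?tape_id.
- by move=> x; rewrite ?ffunE ?tape_id.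
by move=> j x; rewrite !ffunE tape_id.
Qed.

Lemma reach_U a aN a0 a1 aH yU w : (a < size P)%N -> nth OHalt P a = OU aN a0 a1 aH ->
  (forall x, wtape w x = onth yU x) -> ~~ stuck yU (wU w) ->
  reachS a w (nth 0 [:: aN; a0; a1; aH] (outcome yU (wU w)))
    (World (wreg w) (waux w) (wout w) (wtape w) (step yU (wU w))).
Proof.
move=> h oP tp ns c R; exists 0; rewrite /= /step (cinstr_rel R h oP) /=.
case: R => rs ri ra ro rr ru ruh rm rta rut.
(* What is read from the tracks is what [U] itself would read with auxiliary string [yU]. *)
have -> : delta (cstate (wU w)) ([ffun i => ctape c i (chead c i)] (regtape N)).1.2
    [ffun j => ([ffun i => ctape c i (chead c i)] (ut j)).2] = cinstr yU (wU w).
  rewrite /cinstr ffunE rta ru tp; congr delta.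
  by apply/ffunP => j; rewrite !ffunE rut ruh.
move: ns; rewrite /stuck /outcome; case E: cinstr => [|q0 q1|q mv o wr] /=.
- by move=> _; split=> //= *; rewrite ?ffunE ?tape_id ?cats0.
- by rewrite ri; case: cinput => // b p _; split=> //=; case: b.
move=> _; split=> //=; rewrite ?cats0 //.
- by case: o E => [[]|].
- move=> r rN; rewrite split_rt rt_eq ?(leqW rN) ?ltnS // (ltn_eqF rN).
  by rewrite rr.
- by rewrite split_rt eqxx ru.
- by move=> j; rewrite split_ut ruh.
- move=> i x; case: splitP => /= j _; rewrite ?ffunE ?tape_id //.
  by case: eqP => //= ->; rewrite !rm.
- by move=> x; rewrite split_rt /= ffunE tape_id.
by move=> j x; rewrite split_ut /= ffunE ruh; case: eqP.
Qed.

End Compile.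

Lemma nth_mid (pre s post : seq op) i : (i < size s)%N ->
  nth OHalt (pre ++ s ++ post) (size pre + i) = nth OHalt s i.
Proof. by move=> h; rewrite nth_cat ltnNge leq_addr /= addKn nth_cat h. Qed.

Lemma size_mid (pre s post : seq op) i : (i < size s)%N ->
  (size pre + i < size (pre ++ s ++ post))%N.
Proof. by move=> h; rewrite !size_cat ltn_add2l ltn_addr. Qed.

Lemma size_at (pre post : seq op) o : (size pre < size (pre ++ o :: post))%N.
Proof. by rewrite size_cat /= addnS ltnS leq_addr. Qed.

Lemma nth_at (pre post : seq op) o : nth OHalt (pre ++ o :: post) (size pre) = o.
Proof. by rewrite nth_cat ltnn subnn. Qed.

Section CompileCorrect.
Variables (U : machine) (N : nat) (y : seq bool).
Implicit Types w : world U.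

Lemma upd_same f r v : upd f r v r = v. Proof. by rewrite /upd eqxx. Qed.

Lemma upd_upd f r v v' : upd (upd f r v) r v' = upd f r v'.
Proof. by apply/funext => x; rewrite /upd; case: eqP. Qed.

Lemma upd_id f r : upd f r (f r) = f.
Proof. by apply/funext => x; rewrite /upd; case: eqP => [->|]. Qed.

(** Arbitrary [pre] and [post] are allowed because the jumps are absolute. The induction is on the
    execution and not on the command, so that every round of a loop has its own hypothesis. *)
Lemma exec_reach c w w' : exec y c w w' -> forall P pre post,
  P = pre ++ code (size pre) c ++ post -> (maxreg c <= N)%N ->
  reach N P y (size pre) w (size pre + len c) w'.
Proof.
elim=> {c w w'} /=.
- by move=> w P pre post _ _; rewrite addn0; apply: reach_refl.
- move=> w r P pre post -> rN; rewrite addn1; apply/reachSW/reach_inc => //;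
    [exact: size_at | exact: nth_at].
- move=> w r P pre post -> rN; rewrite addn1; apply/reachSW/reach_dec => //;
    [exact: size_at | exact: nth_at].
- move=> w b P pre post -> rN; rewrite addn1; apply/reachSW/reach_out => //;
    [exact: size_at | exact: nth_at].
- move=> w b P pre post -> rN; rewrite addn1; apply/reachSW/reach_put => //;
    [exact: size_at | exact: nth_at].
- move=> w P pre post -> rN; rewrite addn1; apply/reachSW/reach_putl => //;
    [exact: size_at | exact: nth_at].
- move=> w r b p wi P pre post -> rN.
  set a := size pre; pose s := code a (CRead r); rewrite -[_ :: _ :: post]/(s ++ post).
  have sz i : (i < 2)%N -> (a + i < size (pre ++ s ++ post))%N
    by exact: (@size_mid pre s post i).
  have nt i : (i < 2)%N -> nth OHalt (pre ++ s ++ post) (a + i) = nth OHalt s i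
    by exact: (@nth_mid pre s post i).
  apply: reach_trans (reachSW (@reach_read _ _ _ _ a a.+2 a.+1 _ b p _ _ wi)) _.
  + by have := sz 0 isT; rewrite addn0.
  + by have := nt 0 isT; rewrite addn0.
  case: b {wi} => /=.
    rewrite addn1 addn2; apply/reachSW; apply: (@reach_inc _ _ _ _ _ _ r) => //.
      by have := sz 1 isT; rewrite addn1.
    by have := nt 1 isT; rewrite addn1.
  by rewrite addn0 upd_id addn2; apply: reach_refl.
- move=> w r P pre post -> rN.
  set a := size pre; pose s := code a (CAux r); rewrite -[_ :: _ :: _ :: post]/(s ++ post).
  have sz i : (i < 3)%N -> (a + i < size (pre ++ s ++ post))%N
    by exact: (@size_mid pre s post i).
  have nt i : (i < 3)%N -> nth OHalt (pre ++ s ++ post) (a + i) = nth OHalt s i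
    by exact: (@nth_mid pre s post i).
  apply: reach_trans (reachSW (@reach_aux _ _ _ y a a.+3 a.+2 a.+1 w _ _)) _.
  + by have := sz 0 isT; rewrite addn0.
  + by have := nt 0 isT; rewrite addn0.
  set v := onth _ _.
  have inc i w0 : (0 < i < 3)%N ->
      reach N (pre ++ s ++ post) y (a + i) w0 (a + i).+1 (setreg w0 r (wreg w0 r).+1).
    move=> /andP[i0 i3]; apply/reachSW; apply: reach_inc => //; first exact: sz.
    by rewrite nt //; case: i i0 i3 => [|[|[|]]] //= _ _; rewrite ?addn1 ?addn2.
  case: v => [b|] /=; last by rewrite addn0 upd_id addn3; apply: reach_refl.
  have i2 := inc 2 _ isT; have i1 := inc 1 _ isT; rewrite addn2 in i2; rewrite addn1 in i1.
  rewrite addn3; case: b => /=.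
    apply: reach_trans (i1 _) _.
    have := i2 (setreg (World (wreg w) (waux w).+1 (wout w) (wtape w) (wU w)) r (wreg w r).+1).
    by rewrite /setreg /setregs /= upd_same upd_upd addn2.
  by rewrite addn1; apply: i2.
- move=> w r yU tp ns P pre post -> rN.
  set a := size pre; pose s := code a (CU r); rewrite -[_ :: _ :: _ :: _ :: post]/(s ++ post).
  have sz i : (i < 4)%N -> (a + i < size (pre ++ s ++ post))%N
    by exact: (@size_mid pre s post i).
  have nt i : (i < 4)%N -> nth OHalt (pre ++ s ++ post) (a + i) = nth OHalt s i
    by exact: (@nth_mid pre s post i).
  apply: reach_trans (reachSW (@reach_U _ _ _ y a a.+4 a.+3 a.+2 a.+1 yU w _ _ tp ns)) _.
  + by have := sz 0 isT; rewrite addn0.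
  + by have := nt 0 isT; rewrite addn0.
  set v := outcome _ _.
  have inc i w0 : (0 < i < 4)%N ->
      reach N (pre ++ s ++ post) y (a + i) w0 (a + i).+1 (setreg w0 r (wreg w0 r).+1).
    move=> /andP[i0 i3]; apply/reachSW; apply: reach_inc => //; first exact: sz.
    by rewrite nt //; case: i i0 i3 => [|[|[|[|]]]] //= _ _; rewrite ?addn1 ?addn2 ?addn3.
  have i3 := inc 3 _ isT; rewrite addn3 in i3.
  have i2 := inc 2 _ isT; have i1 := inc 1 _ isT; rewrite addn2 in i2; rewrite addn1 in i1.
  have : (v < 4)%N.
    by rewrite /v /outcome; case: cinstr => // _ _ [[]|].
  set w0 := World _ _ _ _ (step _ _).
  have -> : World (upd (wreg w) r (wreg w r + v)) (waux w) (wout w) (wtape w)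
      (step yU (wU w)) = setreg w0 r (wreg w r + v) by [].
  have ss w1 u u' : setreg (setreg w1 r u) r u' = setreg w1 r u'.
    by rewrite /setreg /setregs /= upd_upd.
  have sr w1 u : wreg (setreg w1 r u) r = u by rewrite /setreg /= upd_same.
  rewrite addn4; case: v => [|[|[|[|]]]] //= _.
  + by rewrite addn0 /setreg upd_id; apply: reach_refl.
  + by rewrite addn1; apply: i3.
  + apply: reach_trans (i2 _) _.
    by have := i3 (setreg w0 r (wreg w r).+1); rewrite ss sr addn2.
  apply: reach_trans (i1 _) _; apply: reach_trans (i2 _) _.
  by have := i3 (setreg w0 r (wreg w r).+2); rewrite !ss !sr addn3.
- move=> c1 c2 w w1 w2 _ IH1 _ IH2 P pre post e; rewrite geq_max => /andP[m1 m2].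
  apply: reach_trans (IH1 P pre (code (size pre + len c1) c2 ++ post) _ m1) _.
    by rewrite e -catA.
  have := IH2 P (pre ++ code (size pre) c1) post; rewrite size_cat size_code addnA.
  by apply=> //; rewrite e -!catA.
- move=> r c1 c2 w w1 wr _ IH P pre post e; rewrite !geq_max => /and3P[m0 m1 m2].
  set a := size pre in e *.
  have ta : (a < size P)%N by rewrite e; apply: size_at.
  have nt : nth OHalt P a = OTest r (a + len c1 + 2) a.+1 by rewrite e nth_at.
  apply: reach_trans (reachSW (reach_test y ta nt m0)) _; rewrite (negPf wr).
  have := IH P (rcons pre (OTest r (a + len c1 + 2) a.+1))
     (OJmp (a + len c1 + len c2 + 2) :: code (a + len c1 + 2) c2 ++ post).
  rewrite size_rcons cat_rcons => /(_ _ m1) h.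
  apply: reach_trans (h _) _; first by rewrite e /= -catA.
  have -> : (a + (len c1 + len c2 + 2) = a + len c1 + len c2 + 2)%N by rewrite !addnA.
  apply/reachSW/reach_jmp.
    by rewrite e; do 3!rewrite ?(size_cat, size_code) /=; rewrite /a; lia.
  rewrite e nth_cat -/a ltnNge (_ : (a <= _)%N); last by lia.
  rewrite (_ : (_ - a = (len c1).+1)%N) /=; last by lia.
  by rewrite -catA nth_cat size_code ltnn subnn.
- move=> r c1 c2 w w1 wr _ IH P pre post e; rewrite !geq_max => /and3P[m0 m1 m2].
  set a := size pre in e *.
  have ta : (a < size P)%N by rewrite e; apply: size_at.
  have nt : nth OHalt P a = OTest r (a + len c1 + 2) a.+1 by rewrite e nth_at.
  apply: reach_trans (reachSW (reach_test y ta nt m0)) _; rewrite wr /=.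
  have := IH P (pre ++ OTest r (a + len c1 + 2) a.+1 :: code a.+1 c1 ++
     [:: OJmp (a + len c1 + len c2 + 2)]) post.
  rewrite !size_cat /= size_cat size_code /= -/a.
  rewrite (_ : (a + (len c1 + 1).+1 = a + len c1 + 2)%N); last by lia.
  rewrite (_ : (a + len c1 + 2 + len c2 = a + (len c1 + len c2 + 2))%N); last by lia.
  by apply=> //; rewrite e -!catA /= -!catA.
- move=> r c w w1 w2 wr _ IH _ IH2 P pre post e m; move: (m); rewrite !geq_max => /andP[m0 m1].
  set a := size pre in e *.
  have ta : (a < size P)%N by rewrite e; apply: size_at.
  have nt : nth OHalt P a = OTest r (a + len c + 2) a.+1 by rewrite e nth_at.
  apply: reach_trans (reachSW (reach_test y ta nt m0)) _; rewrite (negPf wr).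
  have := IH P (rcons pre (OTest r (a + len c + 2) a.+1)) (OJmp a :: post).
  rewrite size_rcons cat_rcons => /(_ _ m1) h.
  apply: reach_trans (h _) _; first by rewrite e /= -catA.
  apply: reach_trans (IH2 P pre post e m).
  apply/reachSW/reach_jmp.
    by rewrite e; do 3!rewrite ?(size_cat, size_code) /=; rewrite /a; lia.
  rewrite e nth_cat -/a ltnNge (_ : (a <= _)%N); last by lia.
  rewrite (_ : (_ - a = (len c).+1)%N) /=; last by lia.
  by rewrite -catA nth_cat size_code ltnn subnn.
- move=> r c w wr P pre post e; rewrite !geq_max => /andP[m0 m1].
  set a := size pre in e *.
  have ta : (a < size P)%N by rewrite e; apply: size_at.
  have nt : nth OHalt P a = OTest r (a + len c + 2) a.+1 by rewrite e nth_at.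
  by have := reachSW (reach_test y (w:=w) ta nt m0); rewrite wr /= addnA.
Qed.

End CompileCorrect.

(** * Output of compiled programs, halting or endless *)

Section Programs.
Variables (U : machine) (y : seq bool).
Implicit Types (w : world U) (c : cmd).

Definition prog c : seq op := OMark 1 :: code 1 c ++ [:: OHalt].
Definition compile c : machine := cmachine U (maxreg c) (prog c).
Definition world0 (p : seq bool) : world U :=
  World (fun=> 0%N) 0 [::] (fun=> None) (init U p).

Lemma compile_start c p : rel (N := maxreg c) (P := prog c) 1 (world0 p) (run (compile c) y p 1).
Proof. exact: (@reach_mark U (maxreg c) (prog c) y 0 1 (world0 p)). Qed.

Lemma compile_run c p w : exec y c (world0 p) w ->
  exists t, rel (N := maxreg c) (P := prog c) (1 + len c) w (run (compile c) y p t).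
Proof.
move=> /exec_reach -/(_ (maxreg c) (prog c) [:: OMark 1] [:: OHalt] erefl (leqnn _)).
by move=> /(_ _ (compile_start c p))[t r]; exists (t + 1); rewrite /run iterD.
Qed.

Lemma compile_computes c p w : exec y c (world0 p) w -> cinput (wU w) = [::] ->
  computes (compile c) y p (wout w).
Proof.
move=> /compile_run[t r] wi; exists t; split; last by rewrite (rel_out r).
  rewrite /halted (cinstr_rel (o := OHalt) y r) //.
    by rewrite /= size_cat size_code addn1 ltnS.
  by rewrite add1n /= nth_cat size_code ltnn subnn.
by rewrite (rel_input r).
Qed.

(** An endless run has no final world, so it is described by the worlds [w i] at the visits of the
    loop test. Outputs only grow and the visits occur arbitrarily late, hence every emitted string
    is a prefix of some [wout (w i)]. *)
Lemma compile_emits c0 r c p (w : nat -> world U) :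
  exec y c0 (world0 p) (w 0) ->
  (forall i, wreg (w i) r != 0 /\ exec y c (w i) (w i.+1)) ->
  forall s, emits (compile (CSeq c0 (CWhile r c))) y p s <->
    exists i, prefix s (wout (w i)).
Proof.
move=> ex0 exi s; set c' := CSeq _ _; set N := maxreg c'; set P := prog c'.
set a := (1 + len c0)%N.
have start : exists t, rel (N := N) (P := P) a (w 0) (run (compile c') y p t).
  have e : P = [:: OMark 1] ++ code 1 c0 ++ (code a (CWhile r c) ++ [:: OHalt]).
    by rewrite /P /prog /= -!catA /= -!catA.
  have [t R] := exec_reach ex0 e (leq_maxl _ _) (compile_start c' p).
  by exists (t + 1); rewrite /run iterD.
have loop i : reachS N P y a (w i) a (w i.+1).
  have [wr ex] := exi i.
  have e : P = (OMark 1 :: code 1 c0) ++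
     OTest r (a + len c + 2) a.+1 :: code a.+1 c ++ [:: OJmp a; OHalt].
    by rewrite /P /prog /= -!catA /= -!catA.
  have sz : size (OMark 1 :: code 1 c0) = a by rewrite /= size_code.
  have ta : (a < size P)%N by rewrite e size_cat sz /= addnS ltnS leq_addr.
  have nt : nth OHalt P a = OTest r (a + len c + 2) a.+1.
    by rewrite e nth_cat sz ltnn subnn.
  have m0 : (r < N)%N by rewrite /N /= !leq_max leqnn orbT.
  have m1 : (maxreg c <= N)%N by rewrite /N /= !leq_max leqnn !orbT.
  apply: (reachS_trans (reach_test y ta nt m0)); rewrite (negPf wr).
  have := exec_reach ex (P := P) (N := N)
     (pre := rcons (OMark 1 :: code 1 c0) (OTest r (a + len c + 2) a.+1))
     (post := [:: OJmp a; OHalt]).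
  rewrite size_rcons cat_rcons sz => /(_ _ m1) h.
  apply: reach_trans (h e) _; apply/reachSW/reach_jmp.
    by rewrite e !size_cat /= size_cat !size_code /= /a; lia.
  rewrite e nth_cat sz ltnNge (_ : (a <= _)%N); last by lia.
  rewrite (_ : (_ - a = (len c).+1)%N) /=; last by lia.
  by rewrite nth_cat size_code ltnn subnn.
(* Each round costs at least one step, so visit number [i] is found at time [i] or later. *)
have all i : exists2 t, (i <= t)%N & rel (N := N) (P := P) a (w i) (run (compile c') y p t).
  elim: i => [|i [t it R]]; first by have [t R] := start; exists t.
  have [t' R'] := loop i _ R; exists (t'.+1 + t)%N; last by rewrite /run iterD.
  by rewrite addSn ltnS (leq_trans it) // leq_addl.
split=> [[t st]|[i si]].
  have [t' tt' R] := all t; exists t; rewrite -(rel_out R).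
  exact: prefix_trans st (iter_output_le _ _ tt').
by have [t _ R] := all i; exists t; rewrite (rel_out R).
Qed.

End Programs.

(** * Computable functions on registers *)

Section WP.
Variables (U : machine) (y : seq bool).
Implicit Types (w : world U) (c : cmd) (Q : world U -> Prop).

Definition wp c w Q : Prop := exists2 w', exec y c w w' & Q w'.

Lemma wp_mono c w Q Q' : wp c w Q -> (forall w', Q w' -> Q' w') -> wp c w Q'.
Proof. by move=> [w' ex q] h; exists w' => //; apply: h. Qed.

Lemma wp_seq c1 c2 w Q : wp c1 w (fun w' => wp c2 w' Q) -> wp (CSeq c1 c2) w Q.
Proof. by move=> [w1 ex1 [w2 ex2 q]]; exists w2 => //; apply: XSeq ex1 ex2. Qed.

Lemma wp_skip w Q : Q w -> wp CSkip w Q.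
Proof. by move=> q; exists w => //; apply: XSkip. Qed.

Lemma wp_inc r w Q : Q (setreg w r (wreg w r).+1) -> wp (CInc r) w Q.
Proof. by move=> q; eexists; first exact: XInc. Qed.

Lemma wp_dec r w Q : Q (setreg w r (wreg w r).-1) -> wp (CDec r) w Q.
Proof. by move=> q; eexists; first exact: XDec. Qed.

Lemma wp_if r c1 c2 w Q : wp (if wreg w r == 0 then c2 else c1) w Q -> wp (CIf r c1 c2) w Q.
Proof.
case: eqP => [r0|/eqP r0] [w' ex q]; exists w' => //; first exact: XIf0.
exact: XIf1.
Qed.

Lemma wp_loop (I : nat -> world U -> Prop) r c w Q :
  (forall k w, I k.+1 w -> wreg w r = k.+1 ->
     wp c w (fun w' => I k w' /\ wreg w' r = k)) ->
  I (wreg w r) w -> (forall w', I 0 w' -> wreg w' r = 0 -> Q w') ->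
  wp (CWhile r c) w Q.
Proof.
move=> h Iw hQ; move: {-2}(wreg w r) (erefl (wreg w r)) Iw => k; elim: k w => [|k IH] w /esym wr Iw.
  by exists w; [apply: XWhile0 | apply: hQ].
have [w1 ex [I1 r1]] := h _ _ Iw wr.
have [w2 ex2 q] := IH _ (esym r1) I1; exists w2 => //.
by apply: XWhile1 ex ex2; rewrite wr.
Qed.

End WP.

(** The command is chosen before [U], [y] and the world. Registers from [b] upwards are scratch
    space, so a composition can raise [b] to protect intermediate results; [o] may be one of the
    arguments [a]. *)
Definition computable (f : seq nat -> nat) : Prop :=
  forall b a o, all (fun r => r < b)%N a -> (o < b)%N ->
  exists c, forall U y (w : world U), wp y c w (fun w' => exists s,
    [/\ w' = setregs w s, s o = f (map (wreg w) a)
      & forall r, (r < b)%N -> r != o -> s r = wreg w r]).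

Definition clear r := CWhile r (CDec r).

Lemma upd_other f r v x : x != r -> upd f r v x = f x.
Proof. by rewrite /upd => /negPf ->. Qed.

Lemma wp_clear U y (w : world U) r Q :
  Q (setregs w (upd (wreg w) r 0)) -> wp y (clear r) w Q.
Proof.
move=> q; pose I (k : nat) w' := w' = setregs w (upd (wreg w) r k).
apply: (@wp_loop _ _ I).
- move=> k w1 -> _; apply: wp_dec; split=> /=; last by rewrite !upd_same.
  by rewrite /setreg /setregs /= !upd_same upd_upd.
- by rewrite /I /setregs upd_id; case: w {q I}.
by move=> _ ->.
Qed.

(** A register can only be read by emptying it, so a second copy in [t] is made to restore [x]. *)
Definition copy x o t :=
  CSeq (clear o) (CSeq (clear t) (CSeq
    (CWhile x (CSeq (CDec x) (CSeq (CInc o) (CInc t))))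
    (CWhile t (CSeq (CDec t) (CInc x))))).

Lemma wp_copy U y (w : world U) x o t (Q : world U -> Prop) :
  x != o -> x != t -> o != t ->
  (forall s, s o = wreg w x -> (forall r, r != o -> r != t -> s r = wreg w r) ->
     Q (setregs w s)) ->
  wp y (copy x o t) w Q.
Proof.
move=> xo xt ot hQ.
apply/wp_seq/wp_clear/wp_seq/wp_clear/wp_seq => /=.
pose I (k : nat) w' := exists s, [/\ w' = setregs w s, s x = k, s o + k = wreg w x,
  s o = s t & forall r, r != x -> r != o -> r != t -> s r = wreg w r]%N.
apply: (@wp_loop _ _ I).
- move=> k w1 [s [-> sx so st sr]] _; apply/wp_seq/wp_dec/wp_seq/wp_inc/wp_inc => /=.
  have e (f : nat -> nat) a v b : upd f a v b = if b == a then v else f b by [].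
  split; last by rewrite !e (negPf xt) (negPf xo) eqxx sx.
  eexists; split; first by [].
  + by rewrite /setreg /= !e (negPf xt) (negPf xo) eqxx sx.
  + by rewrite /setreg /= !e (negPf ot) eqxx eq_sym (negPf xo); lia.
  + rewrite /setreg /= !e (negPf ot) !eqxx ![t == _]eq_sym (negPf ot) (negPf xt).
    by rewrite ![o == _]eq_sym (negPf xo) st.
  by move=> r rx ro rt; rewrite /setreg /= !e (negPf rx) (negPf ro) (negPf rt) sr.
- have e (f : nat -> nat) a v b : upd f a v b = if b == a then v else f b by [].
  eexists; split; first by [].
  + by [].
  + by rewrite /= !e eqxx (negPf ot) (negPf xt) (negPf xo).
  + by rewrite /= !e !eqxx (negPf ot).
  by move=> r rx ro rt; rewrite /= !e (negPf ro) (negPf rt).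
move=> _ [s [-> sx so st sr]] _.
pose J (k : nat) w' := exists s, [/\ w' = setregs w s, s t = k, s x + k = wreg w x,
  s o = wreg w x & forall r, r != x -> r != o -> r != t -> s r = wreg w r]%N.
have e (f : nat -> nat) a v b : upd f a v b = if b == a then v else f b by [].
apply: (@wp_loop _ _ J).
- move=> k w1 [s' [-> sx' so' st' sr']] _; apply/wp_seq/wp_dec/wp_inc => /=.
  split; last by rewrite !e eqxx [t == _]eq_sym (negPf xt) sx'.
  eexists; split; first by [].
  + by rewrite /setreg /= !e eqxx [t == _]eq_sym (negPf xt) sx'.
  + by rewrite /setreg /= !e eqxx (negPf xt); lia.
  + by rewrite /setreg /= !e [o == x]eq_sym (negPf xo) (negPf ot).
  by move=> r rx ro rt; rewrite /setreg /= !e (negPf rx) (negPf rt) sr'.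
- by exists s; split=> //=; lia.
move=> _ [s' [-> sx' so' st' sr']] _; apply: hQ => // r ro rt.
by have [->|rx] := eqVneq r x; [lia | apply: sr'].
Qed.

Lemma computable_ext f g : computable g -> f =1 g -> computable f.
Proof. by move=> h /funext ->. Qed.

Lemma computable0 : computable (fun=> 0%N).
Proof.
move=> b a o _ ob; exists (clear o) => U y w; apply: wp_clear.
by eexists; split; [by [] | rewrite upd_same | move=> r _ ro; rewrite upd_other].
Qed.

Lemma computable_var i : computable (fun e => nth 0 e i)%N.
Proof.
move=> b a o ab ob; have [ia|ai] := ltnP i (size a); last first.
  have [c h] := computable0 ab ob; exists c => U y w; apply: (wp_mono (h U y w)).
  by move=> w' [s [-> so sr]]; exists s; split=> //; rewrite nth_default // size_map.
set x := nth 0%N a i; have xb : (x < b)%N by have /allP := ab; apply; apply: mem_nth.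
have [xo|xo] := eqVneq x o.
  exists CSkip => U y w; apply: wp_skip; exists (wreg w); split=> //.
    by case: w.
  by rewrite (nth_map 0%N) // -/x xo.
exists (copy x o b) => U y w; apply: wp_copy => //.
- by rewrite ltn_eqF.
- by rewrite ltn_eqF.
move=> s so sr; exists s; split=> //; first by rewrite so (nth_map 0%N).
by move=> r rb ro; apply: sr => //; rewrite ltn_eqF.
Qed.

Lemma computableS f : computable f -> computable (fun e => (f e).+1).
Proof.
move=> hf b a o ab ob; have [c h] := hf b a o ab ob.
exists (CSeq c (CInc o)) => U y w; apply/wp_seq; apply: wp_mono (h U y w) _.
move=> _ [s [-> so sr]]; apply: wp_inc; eexists; split; first by [].
  by rewrite upd_same /= so.
by move=> r rb ro; rewrite upd_other //= sr.
Qed.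

Lemma computable_skip j k f : computable f ->
  computable (fun e => f (take j e ++ drop (j + k) e)).
Proof.
move=> hf b a o ab ob.
have [|c h] := hf b (take j a ++ drop (j + k) a) o _ ob.
  by apply/allP => x; rewrite mem_cat => /orP[/mem_take|/mem_drop] /(allP ab).
exists c => U y w; apply: wp_mono (h U y w) _ => _ [s [-> so sr]].
by exists s; split=> //; rewrite -map_drop -map_take -map_cat.
Qed.

Lemma computable_drop k f : computable f -> computable (fun e => f (drop k e)).
Proof.
by move=> hf; apply: computable_ext (computable_skip 0 k hf) _ => e; rewrite take0.
Qed.

(** The value of [g] is stored in register [b], and [f] runs with bound [b.+1], so that its scratch
    space starts above that value. *)
Lemma computable_let g f : computable g -> computable f ->
  computable (fun e => f (g e :: e)).
Proof.
move=> hg hf b a o ab ob.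
have ab' : all (fun r => r < b.+1)%N a by apply: sub_all ab => x /ltnW.
have [c1 h1] := hg b.+1 a b ab' (ltnSn b).
have [|c2 h2] := hf b.+1 (b :: a) o _ (ltnW ob); first by rewrite /= ltnSn.
exists (CSeq c1 c2) => U y w; apply/wp_seq; apply: wp_mono (h1 U y w) _.
move=> _ [s [-> so sr]]; apply: wp_mono (h2 U y _) _ => _ [s' [-> so' sr']].
exists s'; split=> //.
  rewrite so' /= so; congr (f (_ :: _)); apply/eq_in_map => x /(allP ab) xb.
  by rewrite sr // ?ltn_eqF // ltnW.
by move=> r rb ro; rewrite sr' //= ?sr // ?ltn_eqF // ltnW.
Qed.

Lemma computable_rec n g (h : nat -> nat -> seq nat -> nat) : computable n -> computable g ->
  computable (fun e => h (nth 0 e 0) (nth 0 e 1) (drop 2 e))%N ->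
  computable (fun e => nat_rect (fun=> nat) (g e) (fun i acc => h i acc e) (n e)).
Proof.
move=> hn hg hh b a o ab ob.
have ab' : all (fun r => r < b.+4)%N a by apply: sub_all ab => x xb; rewrite !ltnS; lia.
have [c1 h1] := hn b.+4 a b ab' (ltac:(lia)).
have [c2 h2] := hg b.+4 a b.+2 ab' (ltac:(lia)).
have [|c3 h3] := hh b.+4 (b.+1 :: b.+2 :: a) b.+2 _ (ltac:(lia)).
  by rewrite /= ab' andbT; apply/andP; split; lia.
have [|c4 h4] := computable_var 0 (b := b.+4) (a := [:: b.+2]) (o := o) _ (ltac:(lia)).
  by rewrite /= andbT; lia.
(* [b] counts the remaining rounds, [b.+1] is the index and [b.+2] the accumulator. The result
   reaches [o] only at the end, since [o] may be an argument that is read in every round. *)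
exists (CSeq c1 (CSeq (clear b.+1) (CSeq c2 (CSeq (CWhile b
  (CSeq c3 (CSeq (CInc b.+1) (CDec b)))) c4)))) => U y w.
apply/wp_seq; apply: wp_mono (h1 U y w) _ => _ [s1 [-> s1o s1r]].
apply/wp_seq/wp_clear/wp_seq; apply: wp_mono (h2 U y _) _ => _ [s2 [-> s2o s2r]].
have am (s : nat -> nat) : (forall r, (r < b)%N -> s r = wreg w r) ->
    map s a = map (wreg w) a.
  by move=> sr; apply/eq_in_map => x /(allP ab) xb; rewrite sr.
set e := map (wreg w) a in s1o *.
pose F := nat_rect (fun=> nat) (g e) (fun i acc => h i acc e).
pose I (k : nat) w' := exists s, [/\ w' = setregs w s, s b.+1 + k = n e, s b = k,
  s b.+2 = F (s b.+1) & forall r, (r < b)%N -> s r = wreg w r]%N.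
rewrite /= in s2o s2r.
have s1a r : (r < b)%N -> upd s1 b.+1 0 r = wreg w r.
  by move=> rb; rewrite upd_other ?s1r //; lia.
apply/wp_seq; apply: (@wp_loop _ _ I).
- move=> k w' [s [-> sk sb sF sr]] _; apply: wp_seq.
  apply: wp_mono (h3 U y _) _ => _ [s3 [-> s3o s3r]] /=.
  apply/wp_seq/wp_inc/wp_dec => /=.
  have E1 : s3 b.+1 = s b.+1 by apply: s3r; lia.
  have E0 : s3 b = s b by apply: s3r; lia.
  split; last by rewrite upd_same upd_other ?E0 ?sb //; lia.
  rewrite /= drop0 in s3o.
  eexists; split; first by [].
  + by rewrite /= upd_other ?upd_same ?E1 //; lia.
  + by rewrite /= upd_same upd_other ?E0 ?sb //; lia.
  + rewrite /= upd_other 1?upd_other; try lia.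
    rewrite [in RHS]upd_other; last by lia.
    by rewrite upd_same s3o E1 /= sF am.
  by move=> r rb; rewrite /= !upd_other ?s3r /= ?sr //; lia.
- have E0 : s2 b.+1 = 0%N by rewrite s2r ?upd_same //; lia.
  exists s2; split=> //.
  + by rewrite E0 /= s2r ?upd_other ?s1o //; lia.
  + by rewrite s2o E0 /= am.
  by move=> r rb; rewrite s2r ?s1a //; lia.
move=> _ [s [-> sk sb sF sr]] _; apply: wp_mono (h4 U y _) _ => _ [s' [-> so' sr']].
exists s'; split=> //; first by rewrite so' /= sF -[in RHS]sk addn0.
by move=> r rb ro; rewrite sr' /= ?sr //; lia.
Qed.

Lemma computable_lets F fs : computable F -> (forall f, List.In f fs -> computable f) ->
  computable (fun e => F ([seq f e | f <- fs] ++ e)).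
Proof.
elim: fs F => [//|f fs IH] F hF hfs /=.
pose F1 e' := F (f (drop (size fs) e') :: e').
have hF1 : computable F1.
  by apply: computable_let => //; apply/computable_drop/hfs; left.
apply: computable_ext (IH F1 hF1 _) _ => [g gfs|e]; first by apply: hfs; right.
by rewrite /F1 drop_size_cat ?size_map.
Qed.

Lemma computable_var_drop k i : computable (fun e => nth 0%N (drop k e) i).
Proof. exact: (computable_drop k (computable_var i)). Qed.

Lemma computable_comp1 F f : computable (fun e => F (nth 0%N e 0)) ->
  computable f -> computable (fun e => F (f e)).
Proof. by move=> hF hf; apply: computable_let hf hF. Qed.

Lemma computable_comp2 F f g : computable (fun e => F (nth 0%N e 0) (nth 0%N e 1)) ->
  computable f -> computable g -> computable (fun e => F (f e) (g e)).
Proof.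
move=> hF hf hg; apply: computable_ext (computable_lets (fs := [:: f; g]) hF _) _ => //.
by move=> _ [<-|[<-|[]]].
Qed.

Lemma computable_cst n : computable (fun=> n).
Proof. by elim: n => [|n IH]; [apply: computable0 | apply: computableS]. Qed.

Lemma computable_big idx (o : Monoid.law idx) n (h : nat -> seq nat -> nat) :
  computable (fun e => o (nth 0%N e 0) (nth 0%N e 1)) ->
  computable n -> computable (fun e => h (nth 0%N e 0) (drop 1 e)) ->
  computable (fun e => \big[o/idx]_(0 <= i < n e) h i e).
Proof.
move=> ho hn hh.
have hh2 : computable (fun e => h (nth 0%N e 0) (drop 2 e)).
  apply: computable_ext (computable_let (computable_var 0) (computable_skip 1 2 hh)) _.
  by move=> e /=; rewrite take0 drop0.
have hs : computable (fun e => o (nth 0%N e 1) (h (nth 0%N e 0) (drop 2 e))).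
  exact: (computable_comp2 (F := o) ho (computable_var 1) hh2).
apply: computable_ext (computable_rec hn (computable_cst idx)
  (h := fun i acc e => o acc (h i e)) hs) _ => e.
elim: (n e) => [|k IH]; first by rewrite big_geq.
by rewrite big_nat_recr //= IH.
Qed.

Lemma computable_add f g : computable f -> computable g -> computable (fun e => f e + g e)%N.
Proof.
apply: computable_comp2; apply: computable_ext (computable_rec (computable_var 0)
  (computable_var 1) (h := fun i acc e => acc.+1) (computableS (computable_var 1))) _ => e.
by elim: (nth _ e 0) => //= n IH; rewrite addSn IH.
Qed.

Lemma computable_mul f g : computable f -> computable g -> computable (fun e => f e * g e)%N.
Proof.
apply: computable_comp2; apply: computable_ext (computable_big (o := addn)
  (computable_add (computable_var 0) (computable_var 1)) (computable_var 0)
  (h := fun _ e => nth 0%N e 1) (computable_drop 1 (computable_var 1))) _ => e.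
by rewrite sum_nat_const_nat subn0.
Qed.

Lemma computable_pred f : computable f -> computable (fun e => (f e).-1).
Proof.
apply: computable_comp1; apply: computable_ext (computable_rec (computable_var 0)
  (computable_cst 0) (h := fun i acc e => i) (computable_var 0)) _ => e.
by case: (nth _ e 0).
Qed.

Lemma computable_sub f g : computable f -> computable g -> computable (fun e => f e - g e)%N.
Proof.
apply: computable_comp2; apply: computable_ext (computable_rec (computable_var 1)
  (computable_var 0) (h := fun i acc e => acc.-1) (computable_pred (computable_var 1))) _ => e.
by elim: (nth _ e 1) => [|n /= <-]; rewrite ?subn0 // subnS.
Qed.

Lemma computable_sum n (h : nat -> seq nat -> nat) :
  computable n -> computable (fun e => h (nth 0%N e 0) (drop 1 e)) ->
  computable (fun e => \sum_(0 <= i < n e) h i e)%N.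
Proof.
by apply: (computable_big (o := addn)); apply: computable_add; apply: computable_var.
Qed.

Lemma computable_prod n (h : nat -> seq nat -> nat) :
  computable n -> computable (fun e => h (nth 0%N e 0) (drop 1 e)) ->
  computable (fun e => \prod_(0 <= i < n e) h i e)%N.
Proof.
by apply: (computable_big (o := muln)); apply: computable_mul; apply: computable_var.
Qed.

Lemma computable_exp f g : computable f -> computable g -> computable (fun e => f e ^ g e)%N.
Proof.
apply: computable_comp2; apply: computable_ext (computable_prod (computable_var 1)
  (h := fun _ e => nth 0%N e 0) (computable_drop 1 (computable_var 0))) _ => e.
by rewrite prod_nat_const_nat subn0.
Qed.

Lemma computable_leq f g : computable f -> computable g ->
  computable (fun e => (f e <= g e)%N : nat).
Proof.
move=> hf hg; apply: computable_ext (computable_sub (computable_cst 1)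
  (computable_sub hf hg)) _ => e /=.
by case: leqP => [/eqP->//|]; rewrite -subn_gt0; case: (_ - _)%N.
Qed.

Lemma computable_eqn f g : computable f -> computable g ->
  computable (fun e => (f e == g e) : nat).
Proof.
move=> hf hg; apply: computable_ext (computable_mul (computable_leq hf hg)
  (computable_leq hg hf)) _ => e /=.
by rewrite mulnb eqn_leq.
Qed.

Lemma computable_and (f g : seq nat -> bool) : computable f -> computable g ->
  computable (fun e => (f e && g e) : nat).
Proof.
by move=> hf hg; apply: computable_ext (computable_mul hf hg) _ => e; rewrite mulnb.
Qed.

Lemma computable_if (b : seq nat -> bool) f g : computable b -> computable f ->
  computable g -> computable (fun e => if b e then f e else g e).
Proof.
move=> hb hf hg; apply: computable_ext (computable_add (computable_mul hb hf)
  (computable_mul (computable_sub (computable_cst 1) hb) hg)) _ => e /=.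
by case: (b e); rewrite ?mul1n ?mul0n ?addn0.
Qed.

(** The quotient counts the positive multiples of the divisor up to the dividend; the factor
    [1 <= g] accounts for the convention that dividing by 0 gives 0. *)
Lemma computable_div f g : computable f -> computable g -> computable (fun e => f e %/ g e)%N.
Proof.
apply: computable_comp2; apply: computable_ext (computable_mul
  (computable_leq (computable_cst 1) (computable_var 1)) (computable_sum (computable_var 0)
  (h := fun i e => (nth 0%N e 1 * i.+1 <= nth 0%N e 0)%N)
  (computable_leq (computable_mul (computable_drop 1 (computable_var 1))
     (computableS (computable_var 0))) (computable_drop 1 (computable_var 0))))) _ => e.
move: (nth _ e 0) (nth _ e 1) => m [|d]; first by rewrite divn0.
rewrite mul1n; under eq_bigr => i _ do rewrite mulnC -leq_divRL //.
move: (m %/ d.+1)%N (leq_div m d.+1) => q.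
elim: m q => [|m IH] q; first by rewrite leqn0 => /eqP->; rewrite big_geq.
rewrite leq_eqVlt ltnS => /orP[/eqP->|qm].
  rewrite (eq_big_nat _ _ (F2 := fun=> 1%N)) => [|i /andP[_ ->] //].
  by rewrite sum_nat_const_nat subn0 muln1.
by rewrite big_nat_recr //= -IH // ltnNge qm addn0.
Qed.

Lemma computable_mod f g : computable f -> computable g -> computable (fun e => f e %% g e)%N.
Proof.
move=> hf hg; apply: computable_ext (computable_sub hf (computable_mul (computable_div hf hg) hg)) _.
by move=> e; rewrite /= {2}(divn_eq (f e) (g e)) addKn.
Qed.

Lemma computable_dvd f g : computable f -> computable g ->
  computable (fun e => (f e %| g e)%N : nat).
Proof.
by move=> hf hg; apply: computable_eqn; [apply: computable_mod | apply: computable_cst].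
Qed.

Lemma computable_max f g : computable f -> computable g -> computable (fun e => maxn (f e) (g e)).
Proof.
move=> hf hg; apply: computable_ext (computable_add hf (computable_sub hg hf)) _ => e.
by rewrite maxnE.
Qed.

(** A bounded maximum fits the combinators for iterated operations, whereas Euclid's algorithm would
    need a loop on a pair of numbers. *)
Lemma gcdn_bigmax a b : (0 < b)%N ->
  gcdn a b = \max_(0 <= d < b.+1) (if (d %| a) && (d %| b) then d else 0)%N.
Proof.
move=> b0; rewrite big_mkord; apply/eqP; rewrite eqn_leq; apply/andP; split.
  have gb : (gcdn a b < b.+1)%N by rewrite ltnS dvdn_leq // dvdn_gcdr.
  by rewrite (bigD1 (Ordinal gb)) //= dvdn_gcdl dvdn_gcdr leq_maxl.
apply/bigmax_leqP => d _; case: ifP => // /andP[da db].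
by rewrite dvdn_leq ?gcdn_gt0 ?b0 ?orbT // dvdn_gcd da db.
Qed.

Lemma computable_gcd f g : computable f -> computable g -> computable (fun e => gcdn (f e) (g e)).
Proof.
apply: computable_comp2.
have hm : computable (fun e => \max_(0 <= d < (nth 0%N e 1).+1)
   (if (d %| nth 0%N e 0) && (d %| nth 0%N e 1) then d else 0)%N).
  apply: (computable_big (o := maxn) (h := fun d e =>
   (if (d %| nth 0%N e 0) && (d %| nth 0%N e 1) then d else 0)%N)).
  - by apply: computable_max; apply: computable_var.
  - exact/computableS/computable_var.
  apply: computable_if; [|exact: computable_var|exact: computable_cst].
  by apply: computable_and; apply: computable_dvd; try exact: computable_var;
    apply: computable_var_drop.
apply: computable_ext (computable_if (computable_leq (computable_cst 1) (computable_var 1))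
   hm (computable_var 0)) _ => e /=.
case: ifP => h; first by rewrite gcdn_bigmax.
by move/negbT: h; rewrite -eqn0Ngt => /eqP->; rewrite gcdn0.
Qed.

(** * Lists of natural numbers coded as numbers *)

Definition lhead (L : nat) : nat := \sum_(0 <= i < L) (2 ^ i.+1 %| L)%N.
(** Lists are coded by the pairing of [x] and [L] into [2 ^ x * (2 L + 1)], with 0 for the empty
    list. The head is the 2-adic valuation, obtained by counting powers of 2; the tail is what
    remains after dropping that power and the last bit. *)
Definition ltail (L : nat) : nat := (L %/ 2 ^ lhead L) %/ 2.
Definition lcons (x L : nat) : nat := 2 ^ x * L.*2.+1.
Definition lget (L i : nat) : nat := lhead (iter i ltail L).

Lemma lhead_cons x L : lhead (lcons x L) = x.
Proof.
rewrite /lhead /lcons.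
have dv i : (2 ^ i.+1 %| 2 ^ x * L.*2.+1)%N = (i < x)%N.
  have [ix|xi] := ltnP i x; first by rewrite dvdn_mulr // dvdn_exp2l.
  apply/negP => /(dvdn_trans (dvdn_exp2l 2 (xi : (x.+1 <= i.+1)%N))).
  by rewrite expnSr dvdn_pmul2l ?expn_gt0 // dvdn2 /= odd_double.
under eq_bigr => i _ do rewrite dv.
have xl : (x <= 2 ^ x * L.*2.+1)%N.
  by rewrite (leq_trans (ltnW (ltn_expl x (ltnSn 1)))) // leq_pmulr.
rewrite (big_cat_nat (leq0n x) xl) //=.
rewrite (eq_big_nat _ _ (F2 := fun=> 1%N)); last by move=> i /andP[_ ->].
rewrite sum_nat_const_nat subn0 muln1 [X in (_ + X)%N]big_nat_cond big1 ?addn0 //.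
by move=> i /andP[/andP[+ _] _]; rewrite ltnNge => ->.
Qed.

Lemma ltail_cons x L : ltail (lcons x L) = L.
Proof.
by rewrite /ltail lhead_cons /lcons mulKn ?expn_gt0 // divn2 /= uphalf_double.
Qed.

Lemma computable_lhead f : computable f -> computable (fun e => lhead (f e)).
Proof.
apply: computable_comp1; apply: (computable_sum (h := fun i e => (2 ^ i.+1 %| nth 0%N e 0)%N)).
  exact: computable_var.
apply: computable_dvd; last exact: computable_var_drop.
by apply: computable_exp; [exact: computable_cst|exact/computableS/computable_var].
Qed.

Lemma computable_lcons f g : computable f -> computable g ->
  computable (fun e => lcons (f e) (g e)).
Proof.
move=> hf hg; apply: computable_mul.
  by apply: computable_exp => //; apply: computable_cst.
apply/computableS; apply: computable_ext (computable_add hg hg) _ => e.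
by rewrite addnn.
Qed.

Lemma computable_lget f g : computable f -> computable g ->
  computable (fun e => lget (f e) (g e)).
Proof.
apply: computable_comp2; apply: computable_lhead.
apply: computable_ext (computable_rec (computable_var 1) (computable_var 0)
  (h := fun _ acc _ => ltail acc) _) _; last by [].
apply: computable_div; last exact: computable_cst.
apply: computable_div; first exact: computable_var.
by apply: computable_exp; [exact: computable_cst|exact/computable_lhead/computable_var].
Qed.

Ltac computability := repeat first
  [ exact: computable_cst
  | exact: computable_var
  | simple apply computable_lget
  | simple apply computable_lcons
  | simple apply computable_gcd
  | simple apply computable_mod
  | simple apply computable_div
  | simple apply computable_exp
  | simple apply computable_mul
  | simple apply computable_sub
  | simple apply computable_add
  | simple apply computable_eqn
  | simple apply computable_leq
  | simple apply computable_and
  | simple apply computable_if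
  | simple apply computable_sum
  | simple apply computable_prod
  | simple apply computableS
  | exact: computable_var_drop
  | exact: (computable_drop _ (computable_var_drop _ _)) ].

(** * Program fragments *)

(* Named registers are below [scratch]; the rest is free for [computable]. *)
Definition scratch := 20%N.
Definition rk := 0%N. Definition rm := 1%N. Definition rn := 2%N.
Definition rL := 3%N. Definition rcnt := 4%N. Definition rt := 5%N.
Definition rf := 6%N. Definition rx := 7%N. Definition rsg := 8%N.
Definition rmag := 9%N. Definition ridx := 10%N. Definition ru := 11%N.
Definition rch := 12%N. Definition rc := 13%N. Definition rone := 14%N.

Definition keeps (U : machine) (D : seq nat) (w w' : world U) : Prop :=
  forall r, (r < scratch)%N -> r \notin D -> wreg w' r = wreg w r.

Definition same_io (U : machine) (w w' : world U) : Prop :=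
  [/\ waux w' = waux w, wout w' = wout w & wtape w' = wtape w].

Lemma assign f a o : computable f -> all (fun r => r < scratch)%N a -> (o < scratch)%N ->
  exists c, forall U y (w : world U) (Q : world U -> Prop),
    (forall s, s o = f (map (wreg w) a) ->
       (forall r, (r < scratch)%N -> r != o -> s r = wreg w r) -> Q (setregs w s)) -> wp y c w Q.
Proof.
move=> hf ha ho; have [c h] := hf _ _ _ ha ho; exists c => U y w Q hQ.
apply: wp_mono (h U y w) _ => _ [s [-> so sr]]; exact: hQ.
Qed.

(** [U] is stepped until [outcome] is not 0; it is then the bit plus one, which the final [CDec]
    corrects. Halting is not tested: [pend] guarantees that a bit is still to come. *)
Definition getbit :=
  CSeq (clear rf) (CSeq (CInc rf) (CSeq
    (CWhile rf (CSeq (clear rt) (CSeq (CU rt) (CIf rt (CDec rf) CSkip)))) (CDec rt))).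

Section Pend.
Variables (U : machine) (yU : seq bool).
Implicit Types uc : config U.
Notation stepU := (@step U yU).

Definition pend uc (s : seq bool) : Prop :=
  exists T, prefix (coutput uc ++ s) (coutput (iter T stepU uc)).

Lemma outcome_output uc : coutput (stepU uc) =
  coutput uc ++ (if outcome yU uc is v.+1 then (if (v < 2)%N then [:: v == 1%N] else [::]) else [::]).
Proof.
rewrite /step /outcome; case: cinstr => [|q0 q1|q a [[]|] wr] /=; rewrite ?cats0 //.
by case: cinput.
Qed.

Lemma outcome_halted uc : outcome yU uc = 3%N <-> halted yU uc.
Proof. by rewrite /halted /outcome; case: cinstr => [|q0 q1|q a [[]|] wr]; split. Qed.

Lemma outcome_lt uc : (outcome yU uc < 4)%N.
Proof. by rewrite /outcome; case: cinstr => [|q0 q1|q a [[]|] wr]. Qed.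

Lemma pend_not_stuck uc b s : pend uc (b :: s) -> ~~ stuck yU uc /\ outcome yU uc != 3%N.
Proof.
have no T : iter T stepU uc = uc -> ~~ prefix (coutput uc ++ b :: s) (coutput (iter T stepU uc)).
  move=> ->; apply/negP => /prefixP[r /(congr1 size)].
  by rewrite !size_cat /=; lia.
move=> [T h]; split.
  by apply/negP => /step_stuck/(iter_fix T)/no/negP; apply.
by apply/eqP => /outcome_halted/step_halted/(iter_fix T)/no/negP; apply.
Qed.

Lemma pend_step uc b s : pend uc (b :: s) ->
  if outcome yU uc == 0%N then coutput (stepU uc) = coutput uc /\ pend (stepU uc) (b :: s)
  else [/\ outcome yU uc = b.+1, coutput (stepU uc) = rcons (coutput uc) b & pend (stepU uc) s].
Proof.
move=> p; have [ns n3] := pend_not_stuck p; case: p => T h.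
have T0 : (0 < T)%N.
  case: T h => // /prefixP[r /(congr1 size)]; rewrite !size_cat /=; lia.
rewrite -(prednK T0) iterSr in h.
have o4 := outcome_lt uc; have eo := outcome_output uc.
case: eqP => [o0|o0].
  rewrite o0 cats0 in eo; split=> //; exists T.-1; by rewrite eo.
have eo' : coutput (stepU uc) = rcons (coutput uc) (outcome yU uc == 2%N).
  by rewrite eo -cats1; case: outcome o0 n3 o4 => [|[|[|[|]]]].
(* The announced bit and the bit just written stand at the same position of one and the same later
   output. *)
have bb : b = (outcome yU uc == 2%N).
  have := iter_output yU T.-1 (stepU uc); rewrite eo' -cats1.
  move: h => /prefixP[r ->] /prefixP[r'] /esym.
  by rewrite -!catA /= => /(congr1 (drop (size (coutput uc)))); rewrite !drop_size_cat // => -[].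
split; last by exists T.-1; rewrite eo' -bb cat_rcons.
  by rewrite bb; case: outcome o0 n3 o4 => [|[|[|[|]]]].
by rewrite eo' bb.
Qed.

Variable y : seq bool.
Implicit Types (w : world U) (Q : world U -> Prop).

(* [after s w w']: the simulated machine has produced exactly [s] in between. *)
Definition after (s : seq bool) w w' : Prop :=
  (exists T, wU w' = iter T stepU (wU w)) /\ coutput (wU w') = coutput (wU w) ++ s.

Lemma after_trans s s' w w1 w2 : after s w w1 -> after s' w1 w2 -> after (s ++ s') w w2.
Proof.
move=> [[T e] o] [[T' e'] o']; split; last by rewrite o' o catA.
by exists (T' + T)%N; rewrite e' e iterD.
Qed.

Lemma wp_while1 r c w Q : wreg w r != 0%N ->
  wp y c w (fun w' => wp y (CWhile r c) w' Q) -> wp y (CWhile r c) w Q.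
Proof. by move=> wr [w1 ex1 [w2 ex2 q]]; exists w2 => //; apply: XWhile1 ex1 ex2. Qed.

Lemma wp_while0 r c w Q : wreg w r = 0%N -> Q w -> wp y (CWhile r c) w Q.
Proof. by move=> wr q; exists w => //; apply: XWhile0. Qed.

Lemma wp_U r w Q : (forall x, wtape w x = onth yU x) -> ~~ stuck yU (wU w) ->
  Q (World (upd (wreg w) r (wreg w r + outcome yU (wU w))) (waux w)
       (wout w) (wtape w) (stepU (wU w))) -> wp y (CU r) w Q.
Proof. by move=> tp ns q; eexists; first exact: (XU y r tp ns). Qed.

Lemma keeps_trans D w w1 w2 : keeps D w w1 -> keeps D w1 w2 -> keeps D w w2.
Proof. by move=> h1 h2 r rs rD; rewrite h2 ?h1. Qed.

Lemma keepsW D D' w w' : {subset D <= D'} -> keeps D w w' -> keeps D' w w'.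
Proof. by move=> DD h r rs rD; apply: h => //; apply: contra rD => /DD. Qed.

Lemma same_io_trans w w1 w2 : same_io w w1 -> same_io w1 w2 -> same_io w w2.
Proof. by move=> [a b c] [a' b' c']; split; rewrite ?a' ?b' ?c'. Qed.

Lemma after_refl w : after [::] w w.
Proof. by split; [exists 0%N | rewrite cats0]. Qed.

Lemma getbit_loop T w b s Q : (forall x, wtape w x = onth yU x) ->
  prefix (coutput (wU w) ++ b :: s) (coutput (iter T stepU (wU w))) -> wreg w rf = 1%N ->
  (forall w', wreg w' rt = b.+1 -> keeps [:: rt; rf] w w' -> same_io w w' ->
     after [:: b] w w' -> pend (wU w') s -> Q w') ->
  wp y (CWhile rf (CSeq (clear rt) (CSeq (CU rt) (CIf rt (CDec rf) CSkip)))) w Q.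
Proof.
elim: T w => [|T IH] w tp h f1 hQ.
  by case/prefixP: h => r /(congr1 size); rewrite !size_cat /=; lia.
have p : pend (wU w) (b :: s) by exists T.+1.
have [ns n3] := pend_not_stuck p; have := pend_step p => ps.
apply: wp_while1; first by rewrite f1.
apply/wp_seq/wp_clear/wp_seq; apply: wp_U => //=; rewrite upd_same add0n upd_upd.
set w2 := World _ _ _ _ _.
have k2 : keeps [:: rt; rf] w w2.
  by move=> r rs; rewrite !inE negb_or => /andP[rr r6]; rewrite /= upd_other.
apply: wp_if; rewrite /= upd_same; move: ps.
case: eqP => [o0 [eo p2]|o0 [eo eo2 p2]].
  apply: wp_skip; apply: IH => //=.
    by rewrite eo; rewrite iterSr in h.
  move=> w' w't k' io' [[T' e'] o'] p'; apply: hQ => //.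
  + exact: keeps_trans k2 k'.
  + split; last by rewrite o' /= eo.
    by exists T'.+1; rewrite e' iterSr.
apply: wp_dec; apply: wp_while0; first by rewrite /= upd_same /= upd_other // f1.
apply: hQ => //.
- by move=> r rs; rewrite !inE negb_or => /andP[rr r6]; rewrite /= !upd_other.
by split; [exists 1%N | rewrite /= eo2 cats1].
Qed.

Lemma wp_getbit w b s Q : (forall x, wtape w x = onth yU x) -> pend (wU w) (b :: s) ->
  (forall w', wreg w' rt = b -> keeps [:: rt; rf] w w' -> same_io w w' ->
     after [:: b] w w' -> pend (wU w') s -> Q w') ->
  wp y getbit w Q.
Proof.
move=> tp [T h] hQ; apply/wp_seq/wp_clear/wp_seq/wp_inc; rewrite /= upd_same.
apply: wp_seq; apply: (@getbit_loop T _ b s) => //=.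
move=> w' w't k' io' a' p'; apply: wp_dec; apply: hQ => //.
  by rewrite /= upd_same w't.
move=> r rs rD; have := rD; rewrite !inE negb_or => /andP[rr r6].
by rewrite /= upd_other // k' //= !upd_other.
Qed.

Definition getnat :=
  CSeq (clear rx) (CSeq getbit (CWhile rt (CSeq (CInc rx) getbit))).

Lemma getnat_loop w v s Q : (forall x, wtape w x = onth yU x) -> pend (wU w) (enc_nat v ++ s) ->
  (forall w', wreg w' rx = (wreg w rx + v)%N -> keeps [:: rx; rt; rf] w w' -> same_io w w' ->
     after (enc_nat v) w w' -> pend (wU w') s -> Q w') ->
  wp y (CSeq getbit (CWhile rt (CSeq (CInc rx) getbit))) w Q.
Proof.
move=> tp p hQ; apply: wp_seq; elim: v w tp p hQ => [|v IH] w tp p hQ.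
  apply: (wp_getbit tp p) => w' w't k' io' a' p'.
  apply: wp_while0 => //; apply: hQ => //; first by rewrite k' ?addn0.
  by apply: keepsW k' => r; rewrite !inE => ->; rewrite orbT.
apply: (wp_getbit tp p) => w1 w1t k1 io1 a1 p1.
apply: wp_while1; first by rewrite w1t.
apply/wp_seq/wp_inc; apply: IH => //=; first by case: io1 => _ _ ->.
move=> w' e k' io' a' p'; apply: hQ => //.
- by rewrite e upd_same k1 // addnS addSn.
- move=> r rs rD; move: (rD); rewrite !inE => /norP[r1 /norP[r2 r3]].
  by rewrite k' // /= upd_other // k1 // !inE negb_or r2 r3.
- by apply: same_io_trans io1 _; exact: io'.
by apply: (after_trans a1); exact: a'.
Qed.

Lemma wp_getnat w v s Q : (forall x, wtape w x = onth yU x) -> pend (wU w) (enc_nat v ++ s) ->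
  (forall w', wreg w' rx = v -> keeps [:: rx; rt; rf] w w' -> same_io w w' ->
     after (enc_nat v) w w' -> pend (wU w') s -> Q w') ->
  wp y getnat w Q.
Proof.
move=> tp p hQ; apply/wp_seq/wp_clear; apply: (@getnat_loop _ v s) => // w' /= e k' io' a' p'.
apply: hQ => // r rs rD; rewrite k' //= upd_other //.
by move: rD; rewrite !inE => /norP[].
Qed.

End Pend.

(** This is [enc_int] on a sign and a magnitude. Registers hold natural numbers only, so integers
    are handled as such pairs. *)
Definition enc_sm (p : bool * nat) : seq bool := p.1 :: enc_nat p.2.
Definition push (L : nat) (p : bool * nat) : nat := lcons p.2 (lcons p.1 L).

Definition same_U (U : machine) (w w' : world U) : Prop :=
  [/\ waux w' = waux w, wtape w' = wtape w & wU w' = wU w].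

Lemma same_U_trans U (w w1 w2 : world U) : same_U w w1 -> same_U w1 w2 -> same_U w w2.
Proof. by move=> [a b c] [a' b' c']; split; rewrite ?a' ?b' ?c'. Qed.

Lemma getints_exists : exists c, forall U y yU (w : world U) ps s (Q : world U -> Prop),
  (forall x, wtape w x = onth yU x) ->
  pend yU (wU w) (flatten (map enc_sm ps) ++ s) -> wreg w rcnt = size ps ->
  (forall w', wreg w' rL = foldl push (wreg w rL) ps ->
     keeps [:: rL; rcnt; rx; rt; rf] w w' -> same_io w w' ->
     after yU (flatten (map enc_sm ps)) w w' -> pend yU (wU w') s -> Q w') ->
  wp y c w Q.
Proof.
have cc : computable (fun e => lcons (nth 0%N e 0) (nth 0%N e 1)) by computability.
have [c1 h1] := assign (a := [:: rt; rL]) (o := rL) cc isT isT.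
have [c2 h2] := assign (a := [:: rx; rL]) (o := rL) cc isT isT.
exists (CWhile rcnt (CSeq getbit (CSeq c1 (CSeq getnat (CSeq c2 (CDec rcnt)))))).
move=> U y yU w ps; elim: ps w => [|[b v] ps IH] w s Q tp p cs hQ.
  by apply: wp_while0 => //; apply: hQ => //; apply: after_refl.
apply: wp_while1; first by rewrite cs.
rewrite /= -catA in p; apply: wp_seq; apply: (wp_getbit _ tp p) => w1 e1 k1 io1 a1 p1.
apply: wp_seq; apply: h1 => s2 e2 k2; rewrite /= in e2.
have tp1 x : wtape w1 x = onth yU x by case: io1 => _ _ ->.
apply: wp_seq.
apply: (@wp_getnat _ yU _ _ v (flatten (map enc_sm ps) ++ s)) => // w3 e3 k3 io3 a3 p3.
apply: wp_seq; apply: h2 => s4 e4 k4; rewrite /= in e4.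
apply: wp_dec; apply: (IH _ s) => //=.
- by case: io3 => _ _ ->.
- rewrite upd_same (k4 rcnt) // (k3 rcnt) //= (k2 rcnt) //= (k1 rcnt) //.
  by rewrite cs.
move=> w' e' k' io' a' p'; apply: hQ => //=.
- rewrite e' /= upd_other // e4 e3 (k3 rL) //= e2 (k1 rL) // e1.
  by [].
- move=> r rs rD; rewrite k' //= upd_other; last first.
    by move: rD; rewrite !inE !negb_or => /and5P[].
  move: (rD); rewrite !inE !negb_or => /and5P[n1 n2 n3 n4 n5].
  rewrite (k4 r) ?inE // (k3 r) //=; last by rewrite !inE !negb_or n3 n4 n5.
  by rewrite (k2 r) ?inE // (k1 r) // !inE !negb_or n4 n5.
- by apply: same_io_trans io1 _; apply: same_io_trans io3 _.
exact: after_trans a1 (after_trans (a3 : after _ _ w1 w3) (a' : after _ _ w3 w')).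
Qed.

Definition outnat x := CSeq (CWhile x (CSeq (CDec x) (COut true))) (COut false).

Lemma wp_outnat U y (w : world U) x Q :
  (forall w', wout w' = wout w ++ enc_nat (wreg w x) -> keeps [:: x] w w' -> same_U w w' ->
     Q w') -> wp y (outnat x) w Q.
Proof.
move=> hQ; apply: wp_seq; move: {-2}(wreg w x) (erefl (wreg w x)) hQ => v.
elim: v w => [|v IH] w /esym e hQ.
  apply: wp_while0 => //; eexists; first exact: XOut.
  by apply: hQ => //=; rewrite cats1.
apply: wp_while1; first by rewrite e.
apply/wp_seq/wp_dec; eexists; first exact: XOut.
apply: IH => //=; first by rewrite upd_same e.
move=> w' o' k' U'; apply: hQ => //; first by rewrite o' /= cat_rcons.
move=> r rs; rewrite inE => rr; rewrite k' ?inE //= upd_other //.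
Qed.

Lemma outints_exists fs fm a :
  computable fs -> computable fm -> all (fun r => r < scratch)%N a ->
  all (fun r => r \notin [:: rcnt; ridx; rsg; rmag]) a ->
  exists c, forall U y (w : world U) (Q : world U -> Prop),
  (forall w', wout w' = wout w ++ flatten [seq enc_sm (fs (i :: map (wreg w) a) != 0%N,
       fm (i :: map (wreg w) a)) | i <- iota (wreg w ridx) (wreg w rcnt)] ->
     keeps [:: rcnt; ridx; rsg; rmag] w w' -> same_U w w' -> Q w') ->
  wp y c w Q.
Proof.
move=> hfs hfm ha hd.
have ha' : all (fun r => r < scratch)%N (ridx :: a) by rewrite /= ha.
have [c1 h1] := assign (a := ridx :: a) (o := rsg) hfs ha' isT.
have [c2 h2] := assign (a := ridx :: a) (o := rmag) hfm ha' isT.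
exists (CWhile rcnt (CSeq c1 (CSeq c2 (CSeq (CIf rsg (COut true) (COut false))
  (CSeq (outnat rmag) (CSeq (CInc ridx) (CDec rcnt))))))) => U y w Q.
move: {-2}(wreg w rcnt) (erefl (wreg w rcnt)) => v.
elim: v w => [|v IH] w /esym e hQ.
  by apply: wp_while0 => //; apply: hQ; rewrite ?cats0.
apply: wp_while1; first by rewrite e.
apply: wp_seq; apply: h1 => s1 e1 k1; apply: wp_seq; apply: h2 => s2 e2 k2.
apply: wp_seq; apply: wp_if => /=.
have -> : (if s2 rsg == 0%N then COut false else COut true) = COut (s2 rsg != 0%N) by case: eqP.
eexists; first exact: XOut.
have am (s : nat -> nat) : (forall r, r \notin [:: rcnt; ridx; rsg; rmag] ->
    (r < scratch)%N -> s r = wreg w r) -> map s a = map (wreg w) a.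
  move=> h; apply/eq_in_map => r ra; apply: h; first by move/allP: hd; apply.
  by move/allP: ha; apply.
have sub (r : nat) : r \notin [:: rcnt; ridx; rsg; rmag] -> [/\ r != rcnt, r != ridx, r != rsg & r != rmag].
  by rewrite !inE !negb_or => /and4P[].
apply: wp_seq; apply: wp_outnat => w3 o3 k3 U3.
apply/wp_seq/wp_inc/wp_dec; apply: IH => //=.
  by rewrite upd_same upd_other // (k3 rcnt) //= (k2 rcnt) //= (k1 rcnt) // e.
set ss := upd (upd _ _ _) rcnt _.
have -> : ss ridx = (wreg w ridx).+1.
  by rewrite /ss upd_other // upd_same (k3 ridx) //= (k2 ridx) //= (k1 ridx).
rewrite (am ss); last first.
  move=> r rD rs; have [n1 n2 n3 n4] := sub _ rD.
  by rewrite /ss !upd_other // (k3 r) ?inE //= (k2 r) ?inE //= (k1 r) ?inE.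
move=> w' o' k' U'; apply: hQ.
- rewrite o' o3 /= (k2 rsg) //= -!catA /= cat_rcons; congr (_ ++ _).
  rewrite e1 /= e2 /= (k1 ridx) // am // => r rD rs.
  by have [n1 n2 n3 n4] := sub _ rD; rewrite (k1 r) ?inE.
- move=> r rs rD; have [n1 n2 n3 n4] := sub _ rD.
  by rewrite k' //= !upd_other // (k3 r) ?inE //= (k2 r) ?inE //= (k1 r) ?inE.
by have := same_U_trans (U3 : same_U w w3) (U' : same_U w3 w').
Qed.

Definition getaux x := CSeq (clear x) (CSeq (clear rf) (CSeq (CInc rf)
  (CWhile rf (CSeq (clear rt) (CSeq (CAux rt) (CSeq (CDec rt)
     (CIf rt (CInc x) (CDec rf)))))))).

Definition keeps_rest (U : machine) (w w' : world U) : Prop :=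
  [/\ wout w' = wout w, wtape w' = wtape w & wU w' = wU w].

Lemma onth_drop (T : Type) (s : seq T) i : onth s i = ohead (drop i s).
Proof. by elim: s i => [|x s IH] [|i] //=; rewrite IH. Qed.

Lemma wp_getaux U y (w : world U) x v s Q : x != rt -> x != rf ->
  drop (waux w) y = enc_nat v ++ s ->
  (forall w', wreg w' x = v -> keeps [:: x; rt; rf] w w' -> keeps_rest w w' ->
     drop (waux w') y = s -> Q w') -> wp y (getaux x) w Q.
Proof.
move=> xt xf ds hQ; apply/wp_seq/wp_clear/wp_seq/wp_clear/wp_seq/wp_inc => /=; rewrite upd_same.
set w0 := setreg _ _ _.
have f0 : wreg w0 rf = 1%N by rewrite /= upd_same.
have x0 : wreg w0 x = 0%N by rewrite /w0 /setreg /= (upd_other _ _ xf) (upd_other _ _ xf) upd_same.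
have {}ds : drop (waux w0) y = enc_nat v ++ s by [].
have {hQ} : forall w', wreg w' x = (wreg w0 x + v)%N -> keeps [:: x; rt; rf] w0 w' ->
    keeps_rest w0 w' -> drop (waux w') y = s -> Q w'.
  rewrite x0 => w' e k' io' d'; apply: hQ => // r rs rD.
  by rewrite k' //; move: rD; rewrite !inE !negb_or => /and3P[n1 n2 n3]; rewrite /= !upd_other.
clearbody w0; clear x0 => hQ; elim: v w0 f0 ds hQ => [|v IH] w0 f0 ds hQ.
  apply: wp_while1; first by rewrite f0.
  apply/wp_seq/wp_clear/wp_seq; eexists; first exact: XAux.
  apply/wp_seq/wp_dec/wp_if => /=; rewrite !upd_same onth_drop ds /=.
  apply/wp_dec/wp_while0; first by rewrite /= upd_same !upd_other // f0.
  apply: hQ => //=.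
  - by rewrite !upd_other // addn0.
  - by move=> r rs; rewrite !inE !negb_or => /and3P[n1 n2 n3]; rewrite /= !upd_other.
  by rewrite -[_.+1]add1n -drop_drop ds /= drop0.
apply: wp_while1; first by rewrite f0.
apply/wp_seq/wp_clear/wp_seq; eexists; first exact: XAux.
apply/wp_seq/wp_dec/wp_if => /=; rewrite !upd_same onth_drop ds /=.
apply/wp_inc; apply: IH => /=.
- by rewrite !upd_other // eq_sym.
- by rewrite -[_.+1]add1n -drop_drop ds /= drop0.
rewrite upd_same !upd_other // => w' e k' io' d'; apply: hQ => //.
  by rewrite e addnS.
move=> r rs rD; rewrite k' //=; move: rD; rewrite !inE !negb_or => /and3P[n1 n2 n3].
by rewrite !upd_other.
Qed.

Definition putnat x := CSeq (CWhile x (CSeq (CDec x) (CPut true))) (CPut false).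

Lemma wp_putnat U y (w : world U) x o Q :
  (forall i, wtape w i = onth o i) -> caux (wU w) = size o ->
  (forall w', (forall i, wtape w' i = onth (o ++ enc_nat (wreg w x)) i) ->
     wU w' = setU_aux (size (o ++ enc_nat (wreg w x))) (wU w) ->
     keeps [:: x] w w' -> waux w' = waux w -> wout w' = wout w -> Q w') ->
  wp y (putnat x) w Q.
Proof.
have on (s : seq bool) b i : (if i == size s then Some b else onth s i) = onth (rcons s b) i.
  by elim: s i => [|c s IH] [|i] //=; [rewrite onth_drop | rewrite -IH].
move=> tp ca hQ; apply: wp_seq; move: {-2}(wreg w x) (erefl (wreg w x)) tp ca hQ => v.
elim: v w o => [|v IH] w o /esym e tp ca hQ.
  apply: wp_while0 => //; eexists; first exact: XPut.
  apply: hQ => //=; last by rewrite ca size_cat addn1.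
  by move=> i; rewrite ca tp on cats1.
apply: wp_while1; first by rewrite e.
apply/wp_seq/wp_dec; eexists; first exact: XPut.
apply: (IH _ (rcons o true)) => /=.
- by rewrite upd_same e.
- by move=> i; rewrite ca tp on.
- by rewrite ca size_rcons.
move=> w' tp' U' k' a' o'; apply: hQ => //.
- by move=> i; rewrite tp' cat_rcons.
- by rewrite U' cat_rcons.
by move=> r rs; rewrite inE => rr; rewrite k' ?inE //= upd_other.
Qed.

Lemma putlist_exists fs a : (forall f, List.In f fs -> computable f) ->
  all (fun r => r < scratch)%N a -> rc \notin a ->
  exists c, forall U y (w : world U) o (Q : world U -> Prop),
  (forall i, wtape w i = onth o i) -> caux (wU w) = size o ->
  (forall w', let o' := o ++ flatten [seq enc_nat (f (map (wreg w) a)) | f <- fs] in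
     (forall i, wtape w' i = onth o' i) ->
     wU w' = setU_aux (size o') (wU w) ->
     keeps [:: rc] w w' -> waux w' = waux w -> wout w' = wout w -> Q w') ->
  wp y c w Q.
Proof.
move=> + ha rca; elim: fs => [|f fs IH] hfs.
  exists CSkip => U y w o Q tp ca hQ; apply: wp_skip; apply: hQ => //.
    by move=> i; rewrite cats0.
  by rewrite cats0 -ca; case: (wU w).
have [|c h] := IH; first by move=> g gfs; apply: hfs; right.
have [|c1 h1] := assign (f := f) (a := a) (o := rc) _ ha isT; first by apply: hfs; left.
exists (CSeq c1 (CSeq (putnat rc) c)) => U y w o Q tp ca hQ.
apply: wp_seq; apply: h1 => s1 e1 k1.
apply: wp_seq; apply: (@wp_putnat _ _ _ _ o) => //= w2 tp2 U2 k2 a2 o2; rewrite e1 in tp2 U2.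
have am : map (wreg w2) a = map (wreg w) a.
  apply/eq_in_map => r ra; have rr : r \notin [:: rc].
    by rewrite inE; apply: contra rca => /eqP<-.
  have rs := allP ha _ ra; rewrite (k2 r) //= (k1 r) //.
  by move: rr; rewrite inE.
apply: (h _ _ _ _ _ tp2) => /=; first by rewrite U2.
rewrite am -catA => w' tp' U' k' a' o'; apply: hQ => //.
- by rewrite U' U2.
- by move=> r rs rD; rewrite k' // (k2 r) //= (k1 r) //; move: rD; rewrite inE.
- by rewrite a' a2.
by rewrite o' o2.
Qed.

(** [U] has to start with its auxiliary head in cell 0. After writing, the head is therefore taken
    back by the length [tot] of the string, recomputed from the registers; [(f e).+1] is the length
    of the unary code of [f e]. *)
Lemma setup_exists fs a : (forall f, List.In f fs -> computable f) ->
  all (fun r => r < scratch)%N a -> rc \notin a ->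
  exists c, forall U y (w : world U) (Q : world U -> Prop),
  (forall i, wtape w i = None) -> caux (wU w) = 0%N ->
  (forall w',
     (forall i, wtape w' i = onth (flatten [seq enc_nat (f (map (wreg w) a)) | f <- fs]) i) ->
     wU w' = wU w -> keeps [:: rc] w w' -> waux w' = waux w -> wout w' = wout w -> Q w') ->
  wp y c w Q.
Proof.
move=> hfs ha rca; have [c h] := putlist_exists hfs ha rca.
pose tot e := sumn [seq (f e).+1 | f <- fs].
have htot : computable tot.
  rewrite /tot; elim: fs hfs {h tot} => [|f fs IH] hfs /=; first exact: computable0.
  apply: computable_add; first by apply/computableS/hfs; left.
  by apply: IH => g gfs; apply: hfs; right.
have [c1 h1] := assign (a := a) (o := rc) htot ha isT.
exists (CSeq c (CSeq c1 (CWhile rc (CSeq (CDec rc) CPutL)))) => U y w Q tp ca hQ.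
apply: wp_seq; apply: (h _ _ _ [::]) => // [i|w' /= tp' U' k' a' o'].
  by rewrite tp onth_drop.
apply: wp_seq; apply: h1 => s1 e1 k1; set w1 := setregs w' s1.
have am : map (wreg w') a = map (wreg w) a.
  apply/eq_in_map => r ra; have rr : r \notin [:: rc].
    by rewrite inE; apply: contra rca => /eqP<-.
  by rewrite (k' r) // (allP ha).
have : caux (wU w1) = wreg w1 rc.
  rewrite /= U' /= e1 am size_flatten /shape -!map_comp; congr sumn.
  by apply: eq_map => f /=; rewrite size_rcons size_nseq.
have : keeps [:: rc] w w1 by move=> r rs rD; rewrite /= (k1 r) ?(k' r) //; move: rD; rewrite inE.
have : (waux w1 = waux w /\ wout w1 = wout w) by [].
have : forall a, setU_aux a (wU w1) = setU_aux a (wU w) by move=> i; rewrite /= U'.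
have : wtape w1 = wtape w' by [].
clearbody w1; move: {2}(wreg w1 rc) (erefl (wreg w1 rc)) => v.
elim: v w1 => [|v IH] w1 e tp1 U1 [a1 o1] k2 cc.
  apply: wp_while0 => //; apply: hQ => //; first by move=> i; rewrite tp1 tp'.
  have su (c0 : config U) : setU_aux (caux c0) c0 = c0 by case: c0.
  have E : caux (wU w) = caux (wU w1) by rewrite cc e ca.
  by have := U1 (caux (wU w)); rewrite su E su.
apply: wp_while1; first by rewrite e.
apply/wp_seq/wp_dec; eexists; first exact: XPutL.
apply: IH => //=; first by rewrite upd_same e.
  move=> r rs rD; rewrite /= upd_other ?k2 //.
  by move: rD; rewrite inE.
by rewrite upd_same cc.
Qed.

Definition bits_val (u : nat) (s : seq bool) : nat := foldl (fun (v : nat) (b : bool) => v * 2 + b)%N u s.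

Lemma readbits_exists : exists c, forall U y (w : world U) s p (Q : world U -> Prop),
  cinput (wU w) = s ++ p -> wreg w rcnt = size s ->
  (forall w', wreg w' ru = bits_val (wreg w ru) s -> keeps [:: ru; rcnt; rt] w w' ->
     wtape w' = wtape w -> waux w' = waux w -> wout w' = wout w ->
     wU w' = setU_input p (wU w) -> Q w') -> wp y c w Q.
Proof.
have cc : computable (fun e => nth 0%N e 0 * 2 + nth 0%N e 1)%N by computability.
have [c1 h1] := assign (a := [:: ru; rt]) (o := ru) cc isT isT.
exists (CWhile rcnt (CSeq (clear rt) (CSeq (CRead rt) (CSeq c1 (CDec rcnt))))).
move=> U y w s; elim: s w => [|b s IH] w p Q ci cs hQ.
  apply: wp_while0 => //; apply: hQ => //=.
  by rewrite -[p]/([::] ++ p) -ci; case: (wU w).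
apply: wp_while1; first by rewrite cs.
apply/wp_seq/wp_clear/wp_seq; eexists; first by apply: XRead; exact: ci.
apply: wp_seq; apply: h1 => s1 e1 k1; apply: wp_dec; apply: (IH _ p) => //=.
  by rewrite upd_same (k1 rcnt) //= !upd_other // cs.
rewrite /= upd_same (upd_other _ _ (isT : ru != rt)) (upd_other _ _ (isT : ru != rt)) in e1.
move=> w' e' k' tp' a' o' U'; apply: hQ => //.
  by rewrite e' upd_other // e1 upd_same.
move=> r rs; rewrite !inE !negb_or => /and3P[n1 n2 n3].
by rewrite k' ?inE ?negb_or ?n1 ?n2 //= upd_other // (k1 r) ?inE //= !upd_other.
Qed.

(** Besides copying the output, this drives [U] to its halting configuration. Only then has it read
    exactly its own program, so that the rest of the program tape is available for random bits. *)
Definition runout := CSeq (clear rf) (CSeq (CInc rf)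
  (CWhile rf (CSeq (clear rt) (CSeq (CU rt) (CIf rt (CSeq (CDec rt)
     (CIf rt (CSeq (CDec rt) (CIf rt (CDec rf) (COut true))) (COut false))) CSkip))))).

Lemma wp_runout U y yU (w : world U) T s Q : (forall x, wtape w x = onth yU x) ->
  halted yU (iter T (@step U yU) (wU w)) ->
  coutput (iter T (@step U yU) (wU w)) = coutput (wU w) ++ s ->
  (forall w', wout w' = wout w ++ s -> keeps [:: rt; rf] w w' -> wtape w' = wtape w ->
     waux w' = waux w -> wU w' = iter T (@step U yU) (wU w) -> Q w') ->
  wp y runout w Q.
Proof.
move=> tp hl co hQ; apply/wp_seq/wp_clear/wp_seq/wp_inc => /=; rewrite upd_same.
set w0 := setreg _ _ _.
have f0 : wreg w0 rf = 1%N by rewrite /= ?upd_same.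
have k0 : keeps [:: rt; rf] w w0.
  by move=> r rs; rewrite !inE !negb_or => /andP[n1 n2]; rewrite /= ?upd_other.
have {k0}hQ' : forall w', wout w' = wout w0 ++ s -> keeps [:: rt; rf] w0 w' -> wtape w' = wtape w0 ->
     waux w' = waux w0 -> wU w' = iter T (@step U yU) (wU w0) -> Q w'.
  by move=> w' o' k' tp' a' U'; apply: hQ => //; apply: keeps_trans k0 k'.
have tp0 x : wtape w0 x = onth yU x by apply: tp.
have {}hl : halted yU (iter T (@step U yU) (wU w0)) by [].
have {}co : coutput (iter T (@step U yU) (wU w0)) = coutput (wU w0) ++ s by [].
clearbody w0; move: {tp hQ w}hQ' => hQ.
elim: T w0 s tp0 f0 hl co hQ => [|T IH] w s tp f1 hl co hQ.
  have s0 : s = [::].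
    by move: co => /= /(congr1 size); rewrite size_cat; case: (s) => //= ? ?; lia.
  apply: wp_while1; first by rewrite f1.
  apply/wp_seq/wp_clear/wp_seq; apply: (@wp_U _ yU) => //=.
    exact: (@halted_not_stuck _ _ _ 0 0).
  rewrite ?upd_same upd_upd add0n (iffRL (outcome_halted _ _) hl).
  apply/wp_if => /=; rewrite ?upd_same /=; apply/wp_seq/wp_dec/wp_if => /=; rewrite ?upd_same /=.
  apply/wp_seq/wp_dec/wp_if => /=; rewrite ?upd_same /=; apply/wp_dec/wp_while0.
    by rewrite /= ?upd_same /= ?upd_other // f1.
  apply: hQ => //=; first by rewrite s0 cats0.
    by move=> r rs; rewrite !inE !negb_or => /andP[n1 n2]; rewrite /= ?upd_other.
  exact: step_halted.
have [h0|n0] := eqVneq (outcome yU (wU w)) 3%N.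
  have h0' := iffLR (outcome_halted _ _) h0.
  have e1 := step_halted h0'; rewrite iterSr e1 in hl co hQ.
  exact: (IH w s).
apply: wp_while1; first by rewrite f1.
apply/wp_seq/wp_clear/wp_seq; apply: (@wp_U _ yU) => //=.
  exact: (halted_not_stuck hl (leq0n _)).
have eo := outcome_output yU (wU w); have o4 := outcome_lt yU (wU w).
rewrite ?upd_same upd_upd add0n.
have [s' es eo'] : exists2 s', s = (if outcome yU (wU w) is v.+1 then [:: v == 1%N] else [::]) ++ s' &
   coutput (iter T (@step U yU) (step yU (wU w))) = coutput (step yU (wU w)) ++ s'.
  have := iter_output yU T (step yU (wU w)) => /prefixP[s' es']; exists s' => //.
  move: es'; rewrite -iterSr co eo -catA => /(congr1 (drop (size (coutput (wU w))))).
  rewrite !drop_size_cat // => ->.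
  by case: outcome n0 o4 => [|[|[|[|]]]].
rewrite iterSr in hl.
have nxt w2 : wU w2 = step yU (wU w) -> wtape w2 = wtape w -> waux w2 = waux w ->
    keeps [:: rt; rf] w w2 -> wreg w2 rf = 1%N ->
    wout w2 = wout w ++ (if outcome yU (wU w) is v.+1 then [:: v == 1%N] else [::]) ->
    wp y (CWhile rf (CSeq (clear rt) (CSeq (CU rt) (CIf rt (CSeq (CDec rt)
     (CIf rt (CSeq (CDec rt) (CIf rt (CDec rf) (COut true))) (COut false))) CSkip)))) w2 Q.
  move=> eU et ea k2 f2 o2; apply: (IH w2 s') => //.
  - by rewrite et.
  - by rewrite eU.
  - by rewrite eU.
  move=> w' o' k' tp' a' U'; apply: hQ.
  - by rewrite o' o2 es -catA.
  - exact: keeps_trans k2 k'.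
  - by rewrite tp'.
  - by rewrite a'.
  by rewrite U' eU iterSr.
apply: wp_if; rewrite /= ?upd_same.
have kk v f w2 : wreg w2 = upd f rt v -> (forall r, r != rt -> f r = wreg w r) ->
    keeps [:: rt; rf] w w2.
  by move=> e hf r rs; rewrite !inE !negb_or => /andP[n1 n2]; rewrite e upd_other ?hf.
case: outcome n0 o4 nxt es => [|[|[|[|v]]]] // _ _ nxt _ /=.
- by apply: wp_skip; apply: nxt => //=; rewrite ?cats0 //; apply: kk.
- apply/wp_seq/wp_dec/wp_if => /=; rewrite ?upd_same /=; eexists; first exact: XOut.
  apply: nxt => //=; rewrite ?cats1 //.
  by apply: kk => // r rr; rewrite ?upd_other.
apply/wp_seq/wp_dec/wp_if => /=; rewrite ?upd_same /=.
apply/wp_seq/wp_dec/wp_if => /=; rewrite ?upd_same /=; eexists; first exact: XOut.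
apply: nxt => //=; rewrite ?cats1 //.
by apply: kk => // r rr; rewrite ?upd_other.
Qed.

Lemma notin_subseq (s t : seq nat) r : subseq s t -> r \notin t -> r \notin s.
Proof. by move=> st; apply: contra => /(mem_subseq st). Qed.

Definition enc_block (r c : nat) (ps : seq (bool * nat)) : seq bool :=
  enc_nat r ++ enc_nat c ++ flatten (map enc_sm ps).

Lemma getmx_exists cin : computable cin ->
  exists c, forall U y yU (w : world U) r0 c0 ps s (Q : world U -> Prop),
  (forall x, wtape w x = onth yU x) ->
  pend yU (wU w) (enc_block r0 c0 ps ++ s) ->
  cin [:: wreg w rk; wreg w rm; wreg w rn] = size ps ->
  (forall w', wreg w' rL = foldl push 0%N ps ->
     keeps [:: rL; rcnt; rx; rt; rf] w w' -> same_io w w' ->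
     after yU (enc_block r0 c0 ps) w w' -> pend yU (wU w') s -> Q w') ->
  wp y c w Q.
Proof.
move=> hcin.
have [c1 h1] := assign (a := [:: rk; rm; rn]) (o := rcnt) hcin isT isT.
have [c2 h2] := getints_exists.
exists (CSeq getnat (CSeq getnat (CSeq c1 (CSeq (clear rL) c2)))).
move=> U y yU w r0 c0 ps s Q tp p cs hQ.
rewrite /enc_block -!catA in p.
apply: wp_seq; apply: (wp_getnat _ tp p) => w1 _ k1 io1 a1 p1.
have tp1 x : wtape w1 x = onth yU x by case: io1 => _ _ ->.
apply: wp_seq; apply: (wp_getnat _ tp1 p1) => w2 _ k2 io2 a2 p2.
have tp2 x : wtape w2 x = onth yU x by case: io2 => _ _ ->.
apply: wp_seq; apply: h1 => s1 /= e1 k3; apply/wp_seq/wp_clear.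
apply: (h2 _ _ _ _ ps s) => //=.
  by rewrite upd_other // e1 !(k2 rk, k2 rm, k2 rn) // !(k1 rk, k1 rm, k1 rn).
rewrite upd_same => w' e' k' io' a' p'; apply: hQ => //.
- move=> r rs rD; rewrite k' //=; move: (rD).
  rewrite !inE !negb_or => /and5P[n1 n2 n3 n4 n5].
  by rewrite upd_other // (k3 r) // (k2 r) ?(k1 r) // !inE !negb_or n3 n4 n5.
- by apply: same_io_trans io1 _; apply: same_io_trans io2 _.
rewrite /enc_block.
exact: after_trans a1 (after_trans a2 (a' : after _ _ w2 w')).
Qed.

Lemma outmx_exists ro co cout fs fm a :
  computable ro -> computable co -> computable cout ->
  computable fs -> computable fm -> all (fun r => r < scratch)%N a ->
  all (fun r => r \notin [:: rcnt; ridx; rsg; rmag; rc]) a ->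
  exists c, forall U y (w : world U) (Q : world U -> Prop),
  (forall w', let e := [:: wreg w rk; wreg w rm; wreg w rn] in
     wout w' = wout w ++ enc_block (ro e) (co e)
       [seq (fs (i :: map (wreg w) a) != 0%N, fm (i :: map (wreg w) a)) | i <- iota 0 (cout e)] ->
     keeps [:: rcnt; ridx; rsg; rmag; rc] w w' -> same_U w w' -> Q w') ->
  wp y c w Q.
Proof.
move=> hro hco hcout hfs hfm ha hd.
have [c1 h1] := assign (a := [:: rk; rm; rn]) (o := rc) hro isT isT.
have [c2 h2] := assign (a := [:: rk; rm; rn]) (o := rc) hco isT isT.
have [c3 h3] := assign (a := [:: rk; rm; rn]) (o := rcnt) hcout isT isT.
have [|c4 h4] := outints_exists hfs hfm ha.
  by apply: sub_all hd => r; apply: notin_subseq.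
exists (CSeq c1 (CSeq (outnat rc) (CSeq c2 (CSeq (outnat rc) (CSeq c3 (CSeq (clear ridx) c4)))))).
move=> U y w Q hQ.
apply: wp_seq; apply: h1 => s1 /= e1 k1.
apply: wp_seq; apply: wp_outnat => w2 /= o2 k2 U2.
apply: wp_seq; apply: h2 => s3 /= e3 k3.
apply: wp_seq; apply: wp_outnat => w4 /= o4 k4 U4.
apply: wp_seq; apply: h3 => s5 /= e5 k5; apply/wp_seq/wp_clear; apply: h4 => /= w'.
have K r : (r < scratch)%N -> r \notin [:: rcnt; ridx; rsg; rmag; rc] ->
   upd s5 ridx 0 r = wreg w r.
  move=> rs; rewrite !inE !negb_or => /and5P[n1 n2 n3 n4 n5].
  rewrite upd_other // (k5 r) // (k4 r) ?inE //= (k3 r) // (k2 r) ?inE //=.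
  by rewrite (k1 r).
have -> : map (upd s5 ridx 0) a = map (wreg w) a.
  by apply/eq_in_map => r ra; apply: K; [exact: (allP ha) | exact: (allP hd)].
rewrite upd_same (upd_other _ _ (isT : rcnt != ridx)) e5 => o' k' U'; apply: hQ.
- rewrite o' o4 o2 e1 e3 /enc_block -!catA.
  rewrite !(k4 rk, k4 rm, k4 rn) //= !(k3 rk, k3 rm, k3 rn) // !(k2 rk, k2 rm, k2 rn) //=.
  by rewrite !(k1 rk, k1 rm, k1 rn) // -map_comp.
- move=> r rs rD; rewrite k' //=; first exact: K.
  exact: notin_subseq rD.
apply: same_U_trans (U2 : same_U w w2) _; apply: same_U_trans (U4 : same_U w2 w4) _.
exact: U'.
Qed.

(** * Programs for the universal machine *)

Section UniversalPrograms.
Variable U : machine.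
Hypothesis hU : universal U.

Definition zz (m n : nat) : seq bool := enc_nat m ++ enc_nat n.

Lemma program_computes c : exists i, forall y p x,
  wp y c (world0 U p) (fun w => cinput (wU w) = [::] /\ wout w = x) ->
  computes U y (i ++ p) x.
Proof.
have [i h] := hU (compile U c); exists i => y p x [w ex [wi wo]].
by apply/(h y p).1; rewrite -wo; apply: compile_computes.
Qed.

Definition outs (x : seq bool) : cmd := foldr (fun b c => CSeq (COut b) c) CSkip x.

Lemma wp_outs y x (w : world U) Q :
  Q (World (wreg w) (waux w) (wout w ++ x) (wtape w) (wU w)) -> wp y (outs x) w Q.
Proof.
elim: x w => [|b x IH] w hQ; first by apply: wp_skip; rewrite cats0 in hQ; case: w hQ.
apply: wp_seq; eexists; first exact: XOut.
by apply: IH => /=; rewrite cat_rcons.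
Qed.

Lemma const_program y x : exists p, computes U y p x.
Proof.
have [i h] := program_computes (outs x).
by exists (i ++ [::]); apply: h; apply: wp_outs.
Qed.

(* Reads [k+1], [k], [m], [n] from the auxiliary string of a conditional on [enc_nat k]. *)
Lemma setup_cond_exists : exists c, forall m n k p (Q : world U -> Prop),
  (forall w', [/\ wreg w' rk = k, wreg w' rm = m, wreg w' rn = n & wreg w' ru = 0%N] ->
     (wreg w' rch = 0%N) ->
     (forall i, wtape w' i = onth (enc_pair (enc_nat n) (zz m n)) i) ->
     wU w' = init U p -> wout w' = [::] -> Q w') ->
  wp (enc_pair (enc_nat k) (zz m n)) c (world0 U p) Q.
Proof.
pose fs : seq (seq nat -> nat) := [:: (fun e => (nth 0 e 2).+1); (fun e => nth 0 e 2);
   (fun e => nth 0 e 1); (fun e => nth 0 e 2)]%N.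
have [|c h] := setup_exists (fs := fs) (a := [:: rk; rm; rn]) _ isT isT.
  by move=> f [<-|[<-|[<-|[<-|[]]]]]; computability.
exists (CSeq (getaux rk) (CSeq (getaux rk) (CSeq (getaux rm) (CSeq (getaux rn) c)))).
move=> m n k p Q hQ.
apply: wp_seq; apply: (@wp_getaux _ _ _ _ k.+1 (enc_nat k ++ zz m n)) => //.
  by rewrite drop0 /= /enc_pair size_rcons size_nseq.
move=> w1 e1 k1 [o1 t1 u1] d1.
apply: wp_seq; apply: (@wp_getaux _ _ _ _ _ _ _ _ _ d1) => // w2 e2 k2 [o2 t2 u2] d2.
apply: wp_seq; apply: (@wp_getaux _ _ _ _ _ _ _ _ _ d2) => // w3 e3 k3 [o3 t3 u3] d3.
have d3' : drop (waux w3) (enc_pair (enc_nat k) (zz m n)) = enc_nat n ++ [::] by rewrite cats0.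
apply: wp_seq; apply: (@wp_getaux _ _ _ _ _ _ _ _ _ d3') => // w4 e4 k4 [o4 t4 u4] d4.
apply: h => [i||w' tp' U' k' a' o'].
- by rewrite t4 t3 t2 t1.
- by rewrite u4 u3 u2 u1.
apply: hQ.
- split.
  + by rewrite k' // k4 // k3.
  + by rewrite k' // k4 // e3.
  + by rewrite k' // e4.
  by rewrite k' // k4 // k3 // k2 // k1.
- by rewrite k' // k4 // k3 // k2 // k1.
- move=> i; rewrite tp' /= e4 k4 // e3 /enc_pair size_rcons size_nseq /zz.
  by rewrite cats0.
- by rewrite U' u4 u3 u2 u1.
by rewrite o' o4 o3 o2 o1.
Qed.

(** An empty condition leaves the code of 0 in front of [m] and [n], and [k] is computed as [n - m].
    [rone] will be the guard of the endless loop in [stream_program]. *)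
Lemma setup_plain_exists : exists c, forall m n p (Q : world U -> Prop),
  (forall w', [/\ wreg w' rk = (n - m)%N, wreg w' rm = m, wreg w' rn = n & wreg w' rone = 1%N] ->
     (forall i, wtape w' i = onth (enc_pair [::] (zz m n)) i) ->
     wU w' = init U p -> wout w' = [::] -> Q w') ->
  wp (enc_pair [::] (zz m n)) c (world0 U p) Q.
Proof.
pose fs : seq (seq nat -> nat) := [:: (fun e => 0); (fun e => nth 0 e 1); (fun e => nth 0 e 2)]%N.
have [|c h] := setup_exists (fs := fs) (a := [:: rk; rm; rn]) _ isT isT.
  by move=> f [<-|[<-|[<-|[]]]]; computability.
have csub : computable (fun e => nth 0%N e 1 - nth 0%N e 0)%N by computability.
have [c1 h1] := assign (a := [:: rm; rn]) (o := rk) csub isT isT.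
exists (CSeq (getaux rk) (CSeq (getaux rm) (CSeq (getaux rn) (CSeq c1 (CSeq (CInc rone) c))))).
move=> m n p Q hQ.
apply: wp_seq; apply: (@wp_getaux _ _ _ _ 0 (zz m n)) => //.
move=> w1 e1 k1 [o1 t1 u1] d1.
apply: wp_seq; apply: (@wp_getaux _ _ _ _ _ _ _ _ _ d1) => // w3 e3 k3 [o3 t3 u3] d3.
have d3' : drop (waux w3) (enc_pair [::] (zz m n)) = enc_nat n ++ [::] by rewrite cats0.
apply: wp_seq; apply: (@wp_getaux _ _ _ _ _ _ _ _ _ d3') => // w4 e4 k4 [o4 t4 u4] d4.
apply: wp_seq; apply: h1 => s5 /= e5 k5; apply/wp_seq/wp_inc.
apply: h => /= [i||w' tp' U' k' a' o'].
- by rewrite t4 t3 t1.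
- by rewrite u4 u3 u1.
have R r : (r < scratch)%N -> r \notin [:: rc; rk; rone] -> wreg w' r = wreg w4 r.
  move=> rs; rewrite !inE !negb_or => /and3P[n1 n2 n3].
  by rewrite k' ?inE //= upd_other // k5.
apply: hQ.
- split.
  + by rewrite k' //= upd_other // e5 e4 k4 // e3.
  + by rewrite R // k4.
  + by rewrite R.
  by rewrite k' //= upd_same k5 // k4 // k3 // k1.
- move=> i; rewrite tp' /= !upd_other // !k5 // e4 k4 // e3.
  by rewrite /enc_pair cats0.
- by rewrite U' u4 u3 u1.
by rewrite o' o4 o3 o1.
Qed.

(** Prepending [i] to a program [x] is itself done by a program, so [i ++ x] is at most a constant
    factor less probable than [x]. *)
Lemma prefix_program i : exists j, forall m n p x,
  computes U (enc_pair [::] (zz m n)) p x -> computes U (enc_pair [::] (zz m n)) (j ++ p) (i ++ x).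
Proof.
have [c h] := setup_plain_exists.
have [j hj] := program_computes (CSeq c (CSeq (outs i) runout)).
exists j => m n p x [T [hl ci co]]; apply: hj; apply: wp_seq; apply: h => w1 _ tp U1 o1.
apply/wp_seq/wp_outs; apply: (@wp_runout _ _ (enc_pair [::] (zz m n)) _ T x) => //=.
- by rewrite U1.
- by rewrite U1.
by move=> w' o' _ _ _ e'; rewrite e' o' U1 o1.
Qed.

(** The tape carries a program of the input matrix, the sampling bits and the choice bit without
    separators: [p] ends where the simulated [U] halts, and [sfun] tells how many bits follow. [U]
    is simulated under condition [n], although the condition at hand is [k]. *)
Lemma sample_program cin sfun ro co cout fs fm :
  computable cin -> computable sfun ->
  computable ro -> computable co -> computable cout -> computable fs -> computable fm ->
  exists i, forall k m n p r0 c0 ps bits (b : bool),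
    let L := foldl push 0%N ps in let e := [:: L; k; m; n; bits_val 0 bits; nat_of_bool b] in
    computes U (enc_pair (enc_nat n) (zz m n)) p (enc_block r0 c0 ps) ->
    cin [:: k; m; n] = size ps -> sfun [:: L; k; m; n] = size bits ->
    computes U (enc_pair (enc_nat k) (zz m n)) (i ++ p ++ bits ++ [:: b])
      (enc_block (ro [:: k; m; n]) (co [:: k; m; n])
        [seq (fs (i :: e) != 0%N, fm (i :: e)) | i <- iota 0 (cout [:: k; m; n])]).
Proof.
move=> hcin hs hro hco hcout hfs hfm.
have [c0 h0] := setup_cond_exists.
have [c1 h1] := getmx_exists hcin.
have [c2 h2] := assign (a := [:: rL; rk; rm; rn]) (o := rcnt) hs isT isT.
have [c3 h3] := readbits_exists.
have [c4 h4] := outmx_exists hro hco hcout hfs hfm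
   (a := [:: rL; rk; rm; rn; ru; rch]) isT isT.
have [i hi] := program_computes (CSeq c0 (CSeq c1 (CSeq runout (CSeq c2 (CSeq c3
   (CSeq (CRead rch) c4)))))).
exists i => k m n p r0 c0' ps bits b L e [T [hl ci co']] ein es; apply: hi.
set yU := enc_pair (enc_nat n) (zz m n) in hl ci co'.
apply: wp_seq; apply: h0 => w1 [ek em en eu] ech tp U1 o1.
have runE := run_add_input (bits ++ [:: b]) hl; rewrite /run -U1 in runE.
have hl1 : halted yU (iter T (@step U yU) (wU w1)) by rewrite runE.
have co1 : coutput (iter T (@step U yU) (wU w1)) = coutput (wU w1) ++ enc_block r0 c0' ps.
  by rewrite runE /= co' U1.
have p1 : pend yU (wU w1) (enc_block r0 c0' ps ++ [::]).
  by exists T; rewrite cats0 -co1 prefix_refl.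
apply: wp_seq; apply: (h1 _ _ _ _ _ _ _ _ _ tp p1); first by rewrite ek em en.
move=> w2 eL k2 [a2 o2 t2] [[T' U2] co2] _.
have tp2 x : wtape w2 x = onth yU x by rewrite t2.
(* Some of these steps have been made already; making [T] more only idles in the halted
   configuration. *)
have eT : iter T (@step U yU) (wU w2) = iter T (@step U yU) (wU w1).
  rewrite U2 -iterD; apply: (halted_later hl1); exact: leq_addr.
apply: wp_seq; apply: (@wp_runout _ _ yU _ T [::] _ tp2).
- by rewrite eT.
- by rewrite eT co1 cats0 co2.
move=> w3 o3 k3 t3 a3 U3; rewrite cats0 o2 o1 in o3; rewrite eT runE in U3.
have ci3 : cinput (wU w3) = bits ++ [:: b] by rewrite U3 /= ci.
have R3 r : (r < scratch)%N -> r \notin [:: rL; rcnt; rx; rt; rf] -> wreg w3 r = wreg w1 r.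
  move=> rs rD; rewrite k3 // ?k2 //.
  exact: notin_subseq rD.
have eL3 : wreg w3 rL = L by rewrite k3.
apply: wp_seq; apply: h2 => s4 /= e4 k4.
rewrite eL3 !R3 // ek em en es in e4.
apply: wp_seq; apply: (h3 _ _ _ bits [:: b]) => //= w5 e5 k5 t5 a5 o5 U5.
rewrite k4 // R3 // eu in e5.
have ci5 : cinput (wU w5) = b :: [::] by rewrite U5.
apply: wp_seq; eexists; first by apply: XRead; exact: ci5.
apply: h4 => /= w6 o6 _ [_ _ U6]; rewrite U6; split=> //.
rewrite o6 o5 o3 /=.
by rewrite upd_same !upd_other // e5 !k5 //= !k4 // eL3 !R3 // ek em en ech add0n.
Qed.

(** Each matrix is translated as soon as it has been read, so an endless stream of approximations
    becomes another one. The number [cin] of integers is computed from the dimensions, since the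
    list inside a block does not delimit itself. *)
Lemma stream_program cin ro co cout fs fm :
  computable cin ->
  computable ro -> computable co -> computable cout -> computable fs -> computable fm ->
  exists i, forall m n q r0 c0 (ps : nat -> seq (bool * nat)),
    let k := (n - m)%N in let y := enc_pair [::] (zz m n) in
    let e j := [:: foldl push 0%N (ps j); k; m; n] in
    (forall j, cin [:: k; m; n] = size (ps j)) ->
    (forall s, emits U y q s <->
       exists N, prefix s (flatten [seq enc_block r0 c0 (ps j) | j <- iota 0 N])) ->
    forall s, emits U y (i ++ q) s <->
       exists N, prefix s (flatten [seq
         enc_block (ro [:: k; m; n]) (co [:: k; m; n])
           [seq (fs (i :: e j) != 0%N, fm (i :: e j)) | i <- iota 0 (cout [:: k; m; n])]
         | j <- iota 0 N]).
Proof.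
move=> hcin hro hco hcout hfs hfm.
have [c0 h0] := setup_plain_exists.
have [c1 h1] := getmx_exists hcin.
have [c4 h4] := outmx_exists hro hco hcout hfs hfm (a := [:: rL; rk; rm; rn]) isT isT.
have [i hi] := hU (compile U (CSeq c0 (CWhile rone (CSeq c1 c4)))).
exists i => m n q r0 c0' ps k y e sz hem s.
rewrite (hi y q).2 {i hi}.
set out := fun j => enc_block (ro [:: k; m; n]) _ _.
pose inp j := enc_block r0 c0' (ps j).
pose Inv j (w : world U) := [/\ [/\ wreg w rk = k, wreg w rm = m, wreg w rn = n & wreg w rone = 1%N],
  forall i, wtape w i = onth y i,
  exists T, wU w = run U y q T,
  coutput (wU w) = flatten (map inp (iota 0 j)) &
  wout w = flatten (map out (iota 0 j))].
have [w0 ex0 I0] : wp y c0 (world0 U q) (Inv 0).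
  by apply: h0 => w' rr tp' U' o'; split=> //; [exists 0%N | rewrite U'].
have stepI j w : Inv j w -> wp y (CSeq c1 c4) w (Inv j.+1).
  move=> [[ek em en eone] tp [T UT] co1 o1].
  have p1 : pend y (wU w) (enc_block r0 c0' (ps j) ++ [::]).
    have [_ /(_ _)[|T' h]] := hem (flatten (map inp (iota 0 j.+1))).
      by exists j.+1; apply: prefix_refl.
    rewrite -addn1 iotaD map_cat flatten_cat /= cats0 -co1 in h.
    (* A block is not empty, so block [j] cannot be complete before the time [T], at which only the
       earlier blocks are out. *)
    have TT' : (T <= T')%N.
      rewrite leqNgt; apply/negP => /ltnW TT'.
      have := prefix_trans h (iter_output_le y (init U q) TT').
      rewrite -[X in prefix _ (coutput X)]/(run U y q T) -UT => /prefixP[r /(congr1 size)].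
      by rewrite !size_cat size_rcons; lia.
    exists (T' - T)%N; rewrite UT /run -iterD subnK // cats0.
    by move: h; rewrite UT.
  apply: wp_seq; apply: (h1 _ _ _ _ _ _ _ _ _ tp p1); first by rewrite ek em en.
  move=> w2 eL k2 [a2 o2 t2] [[T' U2] co2] _.
  apply: h4 => /= w3 o3 k3 [a3 t3 U3].
  rewrite !(k2 rk, k2 rm, k2 rn) // ek em en eL in o3.
  split.
  - by split; rewrite k3 // k2.
  - by move=> x; rewrite t3 t2.
  - by exists (T' + T)%N; rewrite U3 U2 UT /run iterD.
  - by rewrite U3 co2 co1 -addn1 iotaD map_cat flatten_cat /= cats0.
  by rewrite o3 o2 o1 -addn1 iotaD map_cat flatten_cat /= cats0.
(* [wp] only asserts that a next world exists, so the sequence of worlds is obtained by choice. *)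
have nxt j (x : {w | Inv j w}) : {w' | Inv j.+1 w' /\ exec y (CSeq c1 c4) (sval x) w'}.
  by apply: cid; have [w' ex I] := stepI j _ (svalP x); exists w'.
pose sq := nat_rect (fun j => {w | Inv j w}) (exist _ w0 I0)
  (fun j x => exist _ (sval (nxt j x)) (svalP (nxt j x)).1).
rewrite (compile_emits (w := fun j => sval (sq j)) ex0); last first.
  move=> j; split; last exact: (svalP (nxt j (sq j))).2.
  by have [[_ _ _ ->] _ _ _ _] := svalP (sq j).
by split=> -[N h]; exists N; move: h; have [_ _ _ _ ->] := svalP (sq N).
Qed.

End UniversalPrograms.

(** * Encodings *)

Local Open Scope ring_scope.
Local Open Scope complex_scope.

Definition sm (z : int) : bool * nat := (z < 0, `|z|%N).
Definition crat_ints (a : rat[i]) : seq (bool * nat) :=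
  [:: sm (numq (complex.Re a)); sm (denq (complex.Re a));
      sm (numq (complex.Im a)); sm (denq (complex.Im a))].
Definition mxints (r c : nat) (M : 'M[rat[i]]_(r, c)) : seq (bool * nat) :=
  flatten [seq crat_ints (M i j) | i <- enum 'I_r, j <- enum 'I_c].

Lemma flatten_flatten_map (A B : Type) (f : A -> seq B) (ss : seq (seq A)) :
  flatten (map f (flatten ss)) = flatten (map (fun s => flatten (map f s)) ss).
Proof. by elim: ss => //= s ss IH; rewrite map_cat flatten_cat IH. Qed.

Lemma enc_mxE r c (M : 'M[rat[i]]_(r, c)) : enc_mx M = enc_block r c (mxints M).
Proof.
rewrite /enc_mx /enc_block /mxints flatten_flatten_map map_allpairs; congr (_ ++ (_ ++ flatten _)).
have e a : enc_crat a = flatten (map enc_sm (crat_ints a)).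
  by rewrite /enc_crat /enc_rat /= cats0 -!catA.
by congr flatten; apply: eq_map => i; apply: eq_map => j; rewrite e.
Qed.

Lemma nth_flatten_blocks (A B : Type) (f : A -> seq B) b s i t x y :
  (forall z, size (f z) = b) -> (t < b)%N -> (i < size s)%N ->
  nth x (flatten (map f s)) (i * b + t) = nth x (f (nth y s i)) t.
Proof.
move=> sf tb; elim: s i => [//|z s IH] [|i] /= si.
  by rewrite mul0n nth_cat sf tb.
rewrite nth_cat sf mulSn -addnA ltnNge leq_addr /= addKn.
exact: IH.
Qed.

Lemma size_flatten_blocks (A B : Type) (f : A -> seq B) b s :
  (forall z, size (f z) = b) -> size (flatten (map f s)) = (size s * b)%N.
Proof. by move=> sf; elim: s => //= z s IH; rewrite size_cat sf IH mulSn. Qed.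

Lemma flatten_allpairs (A B C : Type) (f : A -> B -> seq C) s t :
  flatten [seq f x y | x <- s, y <- t] = flatten [seq flatten [seq f x y | y <- t] | x <- s].
Proof. by elim: s => //= x s <-; rewrite flatten_cat. Qed.

Lemma nth_mxints r c (M : 'M[rat[i]]_(r, c)) (i : 'I_r) (j : 'I_c) t d : (t < 4)%N ->
  nth d (mxints M) ((i * c + j) * 4 + t) = nth d (crat_ints (M i j)) t.
Proof.
move=> t4; rewrite /mxints flatten_allpairs mulnDl -mulnA -addnA.
rewrite (nth_flatten_blocks _ (b := (c * 4)%N) i); first last.
- by rewrite size_enum_ord.
- by case: c M j => [_ []//|c] M j; have := ltn_ord j; lia.
- by move=> z; rewrite (size_flatten_blocks _ (b := 4)) ?size_enum_ord.
rewrite nth_ord_enum (nth_flatten_blocks _ (b := 4) j) ?size_enum_ord //.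
by rewrite nth_ord_enum.
Qed.

Lemma size_mxints r c (M : 'M[rat[i]]_(r, c)) : size (mxints M) = (r * c * 4)%N.
Proof.
rewrite /mxints flatten_allpairs (size_flatten_blocks _ (b := (c * 4)%N)).
  by rewrite size_enum_ord mulnA.
by move=> z; rewrite (size_flatten_blocks _ (b := 4)) ?size_enum_ord.
Qed.

Lemma eq_mxints r c (M : 'M[rat[i]]_(r, c)) (F : nat -> bool * nat) :
  (forall (i : 'I_r) (j : 'I_c) t, (t < 4)%N ->
     F ((i * c + j) * 4 + t)%N = nth (false, 0%N) (crat_ints (M i j)) t) ->
  mxints M = [seq F q | q <- iota 0 (r * c * 4)].
Proof.
move=> hF; apply: (@eq_from_nth _ (false, 0%N)).
  by rewrite size_mxints size_map size_iota.
move=> q; rewrite size_mxints => hq.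
have q4 : (q %/ 4 < r * c)%N by rewrite ltn_divLR.
have c0 : (0 < c)%N by case: c q4 {M hF hq} => //; rewrite muln0.
have hi : (q %/ 4 %/ c < r)%N by rewrite ltn_divLR.
have hj : (q %/ 4 %% c < c)%N by rewrite ltn_mod.
have ht : (q %% 4 < 4)%N by rewrite ltn_mod.
rewrite {1}(divn_eq q 4) {1}(divn_eq (q %/ 4) c).
rewrite (nth_mxints _ (Ordinal hi) (Ordinal hj)) //.
rewrite (nth_map 0%N) ?size_iota // nth_iota // add0n -hF //=.
by rewrite -divn_eq -divn_eq.
Qed.

Lemma enc_nat_cat a b s s' : enc_nat a ++ s = enc_nat b ++ s' -> a = b /\ s = s'.
Proof.
rewrite /enc_nat !cat_rcons; elim: a b => [|a IH] [|b] //= [].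
  by move=> ->.
by move=> /IH[-> ->].
Qed.

Lemma enc_sms_cat ps ps' s s' : size ps = size ps' ->
  flatten (map enc_sm ps) ++ s = flatten (map enc_sm ps') ++ s' -> ps = ps' /\ s = s'.
Proof.
elim: ps ps' => [|[b v] ps IH] [|[b' v'] ps'] //= [sz] [-> ].
by rewrite -!catA => /enc_nat_cat[-> /(IH _ sz)[-> ->]].
Qed.

Lemma sm_inj : injective sm.
Proof. by move=> a b [sg ab]; case: (ltP a 0) sg; case: (ltP b 0); lia. Qed.

Lemma crat_ints_inj : injective crat_ints.
Proof.
move=> [a b] [a' b'] /= [] n1 m1 n2 m2 n3 m3 n4 m4.
have e1 : numq a = numq a' by apply: sm_inj; rewrite /sm n1 m1.
have e2 : denq a = denq a' by apply: sm_inj; rewrite /sm n2 m2.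
have e3 : numq b = numq b' by apply: sm_inj; rewrite /sm n3 m3.
have e4 : denq b = denq b' by apply: sm_inj; rewrite /sm n4 m4.
by rewrite -[a]divq_num_den -[b]divq_num_den e1 e2 e3 e4 !divq_num_den.
Qed.

Lemma mxints_inj r c : injective (@mxints r c).
Proof.
move=> M M' e; apply/matrixP => i j; apply: crat_ints_inj.
apply: (@eq_from_nth _ (false, 0%N)) => // t t4.
by rewrite -!nth_mxints // e.
Qed.

Lemma enc_mx_cat r c (M M' : 'M[rat[i]]_(r, c)) s s' :
  enc_mx M ++ s = enc_mx M' ++ s' -> M = M' /\ s = s'.
Proof.
rewrite !enc_mxE /enc_block -!catA => /enc_nat_cat[_ /enc_nat_cat[_]].
by move=> /enc_sms_cat[|/mxints_inj-> ->]; rewrite ?size_mxints.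
Qed.

Lemma enc_mx_inj r c : injective (@enc_mx r c).
Proof.
by move=> M M' e; have [] := @enc_mx_cat r c M M' [::] [::]; rewrite ?cats0.
Qed.

Lemma enc_mx_neq0 r c (M : 'M[rat[i]]_(r, c)) : (0 < size (enc_mx M))%N.
Proof. by rewrite /enc_mx size_cat size_rcons. Qed.

(* The code of a list of integers stores its last element first. *)
Definition lmag (L s i : nat) : nat := lget L ((s - i.+1) * 2).
Definition lsgn (L s i : nat) : nat := lget L ((s - i.+1) * 2).+1.

Lemma lget_push L p i : lget (push L p) i =
  if i is 0 then p.2 else if i is 1 then nat_of_bool p.1 else lget L i.-2.
Proof.
rewrite /lget /push; case: i => [|[|i]]; rewrite ?iterSr /= ?lhead_cons ?ltail_cons ?lhead_cons //.
Qed.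

Lemma lget_foldl ps i : (i < size ps)%N ->
  lmag (foldl push 0%N ps) (size ps) i = (nth (false, 0%N) ps i).2 /\
  lsgn (foldl push 0%N ps) (size ps) i = (nth (false, 0%N) ps i).1.
Proof.
rewrite /lmag /lsgn; elim/last_ind: ps => [//|ps p IH]; rewrite size_rcons ltnS leq_eqVlt.
rewrite foldl_rcons nth_rcons; case/orP=> [/eqP->|ip].
  by rewrite subnn ltnn eqxx !lget_push.
rewrite ip !subSS.
have [e1 e2] := IH ip; rewrite -e1 -e2.
have -> : (size ps - i = (size ps - i.+1).+1)%N by rewrite subnSK.
by rewrite !mulSn !lget_push.
Qed.

Definition sfrac (sg num den : nat) : rat := (-1) ^+ sg * (num%:Q / den%:Q).

(** [enc_rat] writes the reduced fraction, so a machine has to divide by the gcd. The second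
    hypothesis excludes a negative zero, whose sign would not be that of [numq]. *)
Lemma sm_frac (sg num den : nat) : (0 < den)%N -> (num = 0%N -> sg = 0%N) ->
  (sg <= 1)%N ->
  sm (numq (sfrac sg num den)) = (sg != 0%N, (num %/ gcdn num den)%N) /\
  sm (denq (sfrac sg num den)) = (false, (den %/ gcdn num den)%N).
Proof.
move=> d0 ns s1; set g := gcdn num den.
have g0 : (0 < g)%N by rewrite gcdn_gt0 d0 orbT.
have dg0 : (0 < den %/ g)%N by rewrite divn_gt0 // dvdn_leq // dvdn_gcdr.
have -> : sfrac sg num den = ((-1) ^+ sg * (num %/ g)%N%:Z)%:~R / (den %/ g)%N%:Z%:~R :> rat.
  have -> : sfrac sg num den = sfrac sg (num %/ g * g) (den %/ g * g).
    by rewrite !divnK ?dvdn_gcdl ?dvdn_gcdr.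
  rewrite /sfrac !rmorphM /= !rmorphXn /= rmorphN1 -mulf_div divff ?mulr1 ?mulrA //.
  by rewrite intr_eq0 -lt0n.
have cop : coprime `|((-1) ^+ sg * (num %/ g)%N%:Z)%R|%N `|(den %/ g)%N%:Z|%N.
  rewrite abszM abszX exp1n mul1n !absz_nat /coprime.
  have := muln_gcdl (num %/ g)%N (den %/ g)%N g.
  rewrite !divnK ?dvdn_gcdl ?dvdn_gcdr // -/g => /eqP.
  by rewrite -[X in _ == X -> _]mul1n eqn_pmul2r.
rewrite coprimeq_num // coprimeq_den // /sm.
have -> : Num.sg (den %/ g)%N%:Z = 1 :> int by apply: gtr0_sg; rewrite ltz_nat.
have -> : ((den %/ g)%N%:Z == 0) = false by rewrite eqz_nat; apply/negbTE; rewrite -lt0n.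
rewrite mul1r abszM abszX exp1n mul1n absz_nat; split=> //=; congr (_, _).
case: sg ns s1 cop => [|[|]] // ns _ _.
rewrite expr1 mulN1r oppr_lt0 ltz_nat divn_gt0 //.
have n0 : (0 < num)%N by case: (num) ns => // /(_ erefl).
by rewrite dvdn_leq // dvdn_gcdl.
Qed.

(** * Extension of tests and reduction of states *)

Section Extension.
Variables (F : comNzRingType) (m n : nat).
Hypothesis mn : (m < n)%N.
Local Notation k := (n - m)%N.

(** The matrix of [K_l] in the index convention of [tensmx], where the discarded factor is the
    low-order part of the index. *)
Definition emb (l : nat) : 'M[F]_(2 ^ n, 2 ^ k) :=
  \matrix_(a, i) ((a : nat) == i * 2 ^ m + l)%N%:R.

Definition emb2 (l l' : nat) : 'M[F]_(2 ^ n * 2 ^ n, 2 ^ k * 2 ^ k) := emb l *t emb l'.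

Definition ext (nu : 'M[F]_(2 ^ k * 2 ^ k)) : 'M[F]_(2 ^ n * 2 ^ n) :=
  \sum_(l < 2 ^ m) \sum_(l' < 2 ^ m) emb2 l l' *m nu *m (emb2 l l')^T.

Definition reduce (M : 'M[F]_(2 ^ n)) : 'M[F]_(2 ^ k) :=
  \sum_(l < 2 ^ m) (emb l)^T *m M *m emb l.

Lemma pow_split : (2 ^ n = 2 ^ k * 2 ^ m)%N.
Proof. by rewrite -expnD subnK // ltnW. Qed.

Lemma hi_proof (a : 'I_(2 ^ n)) : (a %/ 2 ^ m < 2 ^ k)%N.
Proof. by rewrite ltn_divLR ?expn_gt0 // -pow_split. Qed.

Definition hi (a : 'I_(2 ^ n)) : 'I_(2 ^ k) := Ordinal (hi_proof a).

Lemma emb_entry (l : 'I_(2 ^ m)) a i :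
  emb l a i = ((l == a %% 2 ^ m :> nat)%N && (i == hi a))%:R.
Proof.
rewrite mxE; congr (nat_of_bool _)%:R; apply/eqP/andP => [e|[/eqP-> /eqP->]].
  rewrite e modnMDl modn_small // eqxx; split=> //; apply/eqP/val_inj => /=.
  by rewrite e divnMDl ?expn_gt0 // divn_small ?addn0.
exact: divn_eq.
Qed.

Definition src (a : 'I_(2 ^ n * 2 ^ n)) : 'I_(2 ^ k * 2 ^ k) :=
  mxtens_index (hi (mxtens_unindex a).1, hi (mxtens_unindex a).2).

Definition lo1 (a : 'I_(2 ^ n * 2 ^ n)) : nat := ((mxtens_unindex a).1 %% 2 ^ m)%N.
Definition lo2 (a : 'I_(2 ^ n * 2 ^ n)) : nat := ((mxtens_unindex a).2 %% 2 ^ m)%N.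

Lemma emb2_entry (l l' : 'I_(2 ^ m)) a p :
  emb2 l l' a p = ((l == lo1 a :> nat)%N && (l' == lo2 a :> nat)%N && (p == src a))%:R.
Proof.
rewrite /emb2 mxE !emb_entry -natrM mulnb; congr (nat_of_bool _)%:R.
rewrite /lo1 /lo2; case: (l == _ :> nat) => //=; rewrite ?andbF //.
rewrite andbCA; congr (_ && _).
rewrite -[p == _](inj_eq (can_inj (@mxtens_unindexK _ _))) mxtens_indexK.
by rewrite xpair_eqE.
Qed.

Lemma sum_delta (T : finType) (G : T -> F) (b : bool) x :
  \sum_(p : T) (b && (p == x))%:R * G p = b%:R * G x.
Proof.
rewrite (bigD1 x) //= eqxx andbT big1 ?addr0 // => p /negPf->.
by rewrite andbF mul0r.
Qed.

(** Entrywise the extension copies an entry or writes 0. A machine can follow this form, and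
    additivity, continuity and injectivity are read off from it. *)
Lemma ext_entry nu a b :
  ext nu a b = ((lo1 a == lo1 b) && (lo2 a == lo2 b))%:R * nu (src a) (src b).
Proof.
have lt1 x : (lo1 x < 2 ^ m)%N by rewrite ltn_mod expn_gt0.
have lt2 x : (lo2 x < 2 ^ m)%N by rewrite ltn_mod expn_gt0.
have E (l l' : 'I_(2 ^ m)) : (emb2 l l' *m nu *m (emb2 l l')^T) a b =
   ((lo1 a == lo1 b) && (lo2 a == lo2 b) && (l' == Ordinal (lt2 a)) && (l == Ordinal (lt1 a)))%:R
     * nu (src a) (src b).
  rewrite mxE; under eq_bigr => q _.
    rewrite mxE; under eq_bigr => p _ do rewrite emb2_entry.
    rewrite sum_delta mxE emb2_entry mulrC; over.
  rewrite sum_delta mulrA -natrM mulnb; congr ((nat_of_bool _)%:R * _).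
  rewrite -!val_eqE /=; case: (l =P lo1 a :> nat) => [->|_]; last by rewrite !andbF.
  case: (l' =P lo2 a :> nat) => [->|_]; last by rewrite !andbF.
  by rewrite !andbT.
rewrite /ext summxE; under eq_bigr => l _.
  rewrite summxE; under eq_bigr => l' _ do rewrite E.
  rewrite -mulr_suml.
  under eq_bigr => l' _.
    rewrite -andbA [(l' == _) && _]andbC andbA -[(_ && (l' == _))%:R]mulr1; over.
  rewrite sum_delta mulr1; over.
rewrite -mulr_suml; congr (_ * _).
under eq_bigr => l _ do rewrite -[(_ && (l == _))%:R]mulr1.
by rewrite sum_delta mulr1.
Qed.

Lemma reduce_entry M i j : reduce M i j = \sum_(l < 2 ^ m)
  M (cast_ord (esym pow_split) (mxtens_index (i, l))) (cast_ord (esym pow_split) (mxtens_index (j, l))).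
Proof.
rewrite /reduce summxE; apply: eq_bigr => l _.
have E (i0 : 'I_(2 ^ k)) (x : 'I_(2 ^ n)) :
   emb l x i0 = (true && (x == cast_ord (esym pow_split) (mxtens_index (i0, l))))%:R.
  by rewrite mxE -val_eqE.
rewrite mxE; under eq_bigr => y _.
  rewrite mxE; under eq_bigr => x _ do rewrite mxE E.
  rewrite sum_delta E mulrC mul1r; over.
by rewrite sum_delta mul1r.
Qed.

Lemma emb_tens (l l' : nat) (X Y : 'M[F]_(2 ^ n)) :
  (emb2 l l')^T *m (X *t Y) *m emb2 l l' = ((emb l)^T *m X *m emb l) *t ((emb l')^T *m Y *m emb l').
Proof. by rewrite /emb2 trmx_tens !tensmx_mul. Qed.

Lemma emb_tens_ext (l l' : nat) (A B : 'M[F]_(2 ^ k)) :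
  emb2 l l' *m (A *t B) *m (emb2 l l')^T = (emb l *m A *m (emb l)^T) *t (emb l' *m B *m (emb l')^T).
Proof. by rewrite /emb2 trmx_tens !tensmx_mul. Qed.

Lemma tensmx_suml (I : finType) p q r s (A : I -> 'M[F]_(p, q)) (B : 'M[F]_(r, s)) :
  (\sum_i A i) *t B = \sum_i A i *t B.
Proof.
apply/matrixP => i j; rewrite !mxE !summxE mulr_suml; apply: eq_bigr => x _.
by rewrite mxE.
Qed.

Lemma tensmx_sumr (I : finType) p q r s (A : 'M[F]_(p, q)) (B : I -> 'M[F]_(r, s)) :
  A *t (\sum_i B i) = \sum_i A *t B i.
Proof.
apply/matrixP => i j; rewrite !mxE !summxE mulr_sumr; apply: eq_bigr => x _.
by rewrite mxE.
Qed.

(** Only product matrices are tests, so the extension has to act on each factor separately. *)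
Lemma ext_tens (A B : 'M[F]_(2 ^ k)) : exists A' B', ext (A *t B) = A' *t B'.
Proof.
exists (\sum_(l < 2 ^ m) emb l *m A *m (emb l)^T), (\sum_(l < 2 ^ m) emb l *m B *m (emb l)^T).
rewrite tensmx_suml; apply: eq_bigr => l _; rewrite tensmx_sumr.
by apply: eq_bigr => l' _; rewrite emb_tens_ext.
Qed.

(** Extension and reduction are adjoint for the trace pairing: cyclicity of the trace carries each
    [emb2 l l'] to the other matrix. *)
Lemma tr_ext nu (X Y : 'M[F]_(2 ^ n)) :
  \tr (ext nu *m (X *t Y)) = \tr (nu *m (reduce X *t reduce Y)).
Proof.
rewrite /ext /reduce tensmx_suml mulmx_suml mulmx_sumr !raddf_sum; apply: eq_bigr => l _.
rewrite tensmx_sumr mulmx_suml mulmx_sumr !raddf_sum; apply: eq_bigr => l' _ /=.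
rewrite -emb_tens -!mulmxA mxtrace_mulC -!mulmxA.
by rewrite mxtrace_mulC -!mulmxA.
Qed.

(** The block in which all low-order parts are 0 is a copy of the original matrix. *)
Lemma ext_inj : injective ext.
Proof.
move=> nu nu' /matrixP e; apply/matrixP => p q.
have h0 (i : 'I_(2 ^ k)) : (i * 2 ^ m < 2 ^ n)%N.
  by rewrite pow_split ltn_pmul2r ?expn_gt0.
pose up (p : 'I_(2 ^ k * 2 ^ k)) :=
  mxtens_index (Ordinal (h0 (mxtens_unindex p).1), Ordinal (h0 (mxtens_unindex p).2)).
have hi0 i : hi (Ordinal (h0 i)) = i by apply: val_inj; rewrite /= mulnK ?expn_gt0.
have su x : src (up x) = x.
  rewrite /src /up mxtens_indexK !hi0 -[RHS]mxtens_unindexK.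
  by case: mxtens_unindex.
have l1 x : lo1 (up x) = 0%N by rewrite /lo1 /up mxtens_indexK /= modnMl.
have l2 x : lo2 (up x) = 0%N by rewrite /lo2 /up mxtens_indexK /= modnMl.
by have := e (up p) (up q); rewrite !ext_entry !su !l1 !l2 !mul1r.
Qed.

End Extension.

Lemma ptraceE (R : realType) m n (mn : (m < n)%N) (M : 'M[R[i]]_(2 ^ n)) :
  ptrace mn M = reduce m M.
Proof.
apply/matrixP => i j; rewrite (reduce_entry mn) mxE; apply: eq_bigr => l _.
rewrite castmxE /=; congr (M _ _); apply: val_inj; by rewrite /= ?cast_ord_id.
Qed.

(** * Lifting of rational approximations by a program *)

Section LiftRat.
Variables (m n S : nat).
Hypothesis mn : (m < n)%N.
Local Notation k := (n - m)%N.

Definition lift_rat (M : 'M[rat[i]]_(2 ^ k * 2 ^ k)) : 'M[rat[i]]_(2 ^ n * 2 ^ n) :=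
  \matrix_(a, b)
    let x := M (src mn a) (src mn b) in
    if (lo1 m a == lo1 m b) && (lo2 m a == lo2 m b)
    then (complex.Re x / (2 ^ S)%N%:R) +i* (complex.Im x / (2 ^ S)%N%:R)
    else 0 +i* 0.

Lemma crat_lift_rat (R : realType) M :
  crat_mx R (lift_rat M) = ((2 ^+ S)^-1)%:C *: ext (crat_mx R M).
Proof.
apply/matrixP => a b; rewrite mxE mxE [RHS]mxE (ext_entry mn) /=.
case: ifP => _; last by rewrite /= mul0r mulr0 !rmorph0.
have rq (x : rat) : ratr (x / (2 ^ S)%N%:R) = ratr x / 2 ^+ S :> R.
  by rewrite rmorphM /= fmorphV /= ratr_nat natrX.
rewrite mul1r mxE /= !rq.
by apply/eqP; rewrite eq_complex /= !mul0r subr0 addr0 ![_ * _^-1]mulrC !eqxx.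
Qed.

End LiftRat.

Section LiftFunctions.
Variable S : nat.
Local Open Scope nat_scope.

Definition lift_src (k m n a : nat) : nat := (a %/ 2 ^ n) %/ 2 ^ m * 2 ^ k + (a %% 2 ^ n) %/ 2 ^ m.
Definition lift_match (m n a b : nat) : bool :=
  ((a %/ 2 ^ n) %% 2 ^ m == (b %/ 2 ^ n) %% 2 ^ m) &&
  ((a %% 2 ^ n) %% 2 ^ m == (b %% 2 ^ n) %% 2 ^ m).
(** Write [q = 4 * (a * N + b) + t] with [N] the dimension [2 ^ n * 2 ^ n]. The values 0, 1, 2, 3 of
    [t] stand for numerator and denominator of the real part, then of the imaginary part, of entry
    [(a, b)]. The result points at the numerator of the same part of the source entry; its
    denominator comes next. *)
Definition lift_pos (k m n q : nat) : nat :=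
  (lift_src k m n (q %/ 4 %/ (2 ^ n * 2 ^ n)) * (2 ^ k * 2 ^ k) +
   lift_src k m n (q %/ 4 %% (2 ^ n * 2 ^ n))) * 4 + (q %% 4) %/ 2 * 2.
Definition lift_on (m n q : nat) : bool :=
  lift_match m n (q %/ 4 %/ (2 ^ n * 2 ^ n)) (q %/ 4 %% (2 ^ n * 2 ^ n)).
Definition lift_size (k : nat) : nat := 2 ^ k * 2 ^ k * (2 ^ k * 2 ^ k) * 4.
Definition lift_num (L k m n q : nat) : nat :=
  lift_on m n q * lmag L (lift_size k) (lift_pos k m n q).
Definition lift_den (L k m n q : nat) : nat :=
  lmag L (lift_size k) (lift_pos k m n q).+1 * 2 ^ S.
Definition lift_sgn (e : seq nat) : nat :=
  let q := nth 0 e 0 in let L := nth 0 e 1 in let k := nth 0 e 2 in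
  let m := nth 0 e 3 in let n := nth 0 e 4 in
  if q %% 2 == 0 then lift_on m n q * lsgn L (lift_size k) (lift_pos k m n q) else 0.
Definition lift_mag (e : seq nat) : nat :=
  let q := nth 0 e 0 in let L := nth 0 e 1 in let k := nth 0 e 2 in
  let m := nth 0 e 3 in let n := nth 0 e 4 in
  (if q %% 2 == 0 then lift_num L k m n q else lift_den L k m n q)
    %/ gcdn (lift_num L k m n q) (lift_den L k m n q).

Lemma computable_lift_sgn : computable lift_sgn.
Proof.
rewrite /lift_sgn /lift_on /lift_match /lift_size /lift_pos /lift_src /lsgn /=.
by computability.
Qed.

Lemma computable_lift_mag : computable lift_mag.
Proof.
rewrite /lift_mag /lift_num /lift_den /lift_on /lift_match /lift_size /lift_pos /lift_src /lmag /=.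
by computability.
Qed.

End LiftFunctions.

Lemma sm_numq_frac (x : rat) (d : nat) (b : bool) : (0 < d)%N ->
  (if b then x / d%:R else 0) =
    sfrac (b * (numq x < 0)%R) (b * `|numq x|) (`|denq x| * d).
Proof.
move=> d0; rewrite /sfrac; case: b; rewrite ?mul1n ?mul0n ?expr0 ?mul0r ?mulr0 //.
rewrite PoszM intrM invfM mulrA [in RHS]mulrA; congr (_ / _).
rewrite -{1}[x]divq_num_den; congr (_ / _%:~R); last by rewrite absz_denq.
by rewrite {1}[numq x]intEsign rmorphM rmorphXn rmorphN1.
Qed.

Section LiftCorrect.
Variables (S m n : nat).
Hypothesis mn : (m < n)%N.
Local Notation k := (n - m)%N.

Lemma lift_srcE (a : 'I_(2 ^ n * 2 ^ n)) : lift_src k m n a = src mn a.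
Proof. by []. Qed.

Lemma lift_matchE (a b : 'I_(2 ^ n * 2 ^ n)) :
  lift_match m n a b = (lo1 m a == lo1 m b) && (lo2 m a == lo2 m b).
Proof. by []. Qed.

Lemma lift_correct (M : 'M[rat[i]]_(2 ^ k * 2 ^ k)) :
  let e := [:: foldl push 0%N (mxints M); k; m; n] in
  mxints (lift_rat S mn M) =
    [seq (lift_sgn (q :: e) != 0%N, lift_mag S (q :: e))
       | q <- iota 0 (2 ^ n * 2 ^ n * (2 ^ n * 2 ^ n) * 4)].
Proof.
move=> e; apply: eq_mxints => a b t t4.
set N := (2 ^ n * 2 ^ n)%N; set q := (_ + t)%N; pose L := foldl push 0%N (mxints M).
have N0 : (0 < N)%N by rewrite muln_gt0 expn_gt0.
have q4 : (q %/ 4)%N = (a * N + b)%N by rewrite /q divnMDl // divn_small ?addn0.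
have qt : (q %% 4)%N = t by rewrite /q modnMDl modn_small.
have qa : (q %/ 4 %/ N)%N = a by rewrite q4 divnMDl // divn_small ?addn0.
have qb : (q %/ 4 %% N)%N = b by rewrite q4 modnMDl modn_small.
have q2 : (q %% 2)%N = (t %% 2)%N by rewrite -qt modn_dvdm.
have eon : lift_on m n q = (lo1 m a == lo1 m b) && (lo2 m a == lo2 m b).
  by rewrite /lift_on qa qb lift_matchE.
have epos : lift_pos k m n q = ((src mn a * (2 ^ k * 2 ^ k) + src mn b) * 4 + t %/ 2 * 2)%N.
  by rewrite /lift_pos qa qb !lift_srcE qt.
have vsz : lift_size k = size (mxints M) by rewrite size_mxints.
have lt x : (x < 4)%N -> ((src mn a * (2 ^ k * 2 ^ k) + src mn b) * 4 + x < size (mxints M))%N.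
  move=> x4; rewrite size_mxints.
  have h1 : (src mn a < 2 ^ k * 2 ^ k)%N by exact: ltn_ord.
  have h2 : (src mn b < 2 ^ k * 2 ^ k)%N by exact: ltn_ord.
  move: h1 h2; move: (2 ^ k * 2 ^ k)%N (nat_of_ord (src mn a)) (nat_of_ord (src mn b)) => d i j h1 h2.
  nia.
have rd x : (x < 4)%N ->
    lmag L (lift_size k) ((src mn a * (2 ^ k * 2 ^ k) + src mn b) * 4 + x) =
      (nth (false, 0%N) (crat_ints (M (src mn a) (src mn b))) x).2 /\
    lsgn L (lift_size k) ((src mn a * (2 ^ k * 2 ^ k) + src mn b) * 4 + x) =
      (nth (false, 0%N) (crat_ints (M (src mn a) (src mn b))) x).1.
  by move=> x4; rewrite vsz; have := lget_foldl (lt x x4); rewrite nth_mxints.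
set on := (lo1 m a == lo1 m b) && _ in eon.
have S0 : (0 < 2 ^ S)%N by rewrite expn_gt0.
have key (x : rat) p :
    lmag L (lift_size k) p = `|numq x|%N -> lsgn L (lift_size k) p = (numq x < 0)%R ->
    lmag L (lift_size k) p.+1 = `|denq x|%N -> lift_pos k m n q = p ->
    (lift_sgn (q :: e) != 0%N, lift_mag S (q :: e)) =
      if (t %% 2 == 0)%N then sm (numq (if on then x / (2 ^ S)%:R else 0))
      else sm (denq (if on then x / (2 ^ S)%:R else 0)).
  move=> h1 h2 h3 hp.
  have hn : lift_num L k m n q = (on * `|numq x|)%N by rewrite /lift_num eon hp h1.
  have hd : lift_den S L k m n q = (`|denq x| * 2 ^ S)%N by rewrite /lift_den hp h3.
  have [|||s1 s2] := @sm_frac (on * (numq x < 0)%R) (on * `|numq x|) (`|denq x| * 2 ^ S).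
  - by rewrite muln_gt0 S0 absz_gt0 denq_eq0.
  - by case: (on) => //; rewrite !mul1n => /eqP; rewrite absz_eq0 => /eqP->.
  - by case: (on); case: (_ < _)%R.
  rewrite (sm_numq_frac _ _ S0) s1 s2 /lift_sgn /lift_mag [nth 0%N _ 0]/= q2 /=.
  by case: ifP => _; rewrite hn hd // eon hp h2.
rewrite mxE /= -/on.
have -> : (if on then (complex.Re (M (src mn a) (src mn b)) / (2 ^ S)%:R) +i*
     (complex.Im (M (src mn a) (src mn b)) / (2 ^ S)%:R) else 0 +i* 0) =
   (if on then complex.Re (M (src mn a) (src mn b)) / (2 ^ S)%:R else 0) +i*
   (if on then complex.Im (M (src mn a) (src mn b)) / (2 ^ S)%:R else 0).
  by case: (on).
have [r0 r0'] := rd 0%N isT; have [r1 _] := rd 1%N isT.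
have [r2 r2'] := rd 2%N isT; have [r3 _] := rd 3%N isT.
rewrite addn1 in r1; rewrite addn2 in r2 r2'; rewrite addn3 in r3; rewrite addn0 in r0 r0'.
case: t t4 {q4 lt rd} q qt qa qb q2 eon epos key => [|[|[|[|]]]] //= _ q qt qa qb q2 eon epos key.
- by rewrite (key _ _ r0 r0' r1) // epos addn0.
- by rewrite (key _ _ r0 r0' r1) // epos addn0.
- by rewrite (key _ _ r2 r2' r3) // epos addn2.
by rewrite (key _ _ r2 r2' r3) // epos addn2.
Qed.

End LiftCorrect.

(** The prefix [i] serves all [m] and [n], as the machine reads them from the auxiliary string; the
    constant of the theorem can therefore be independent of both. *)
Lemma lift_program (U : machine) (S : nat) : universal U -> exists i, forall m n (mn : (m < n)%N) q
  (u : nat -> 'M[rat[i]]_(2 ^ (n - m) * 2 ^ (n - m))),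
  let y := enc_pair [::] (zz m n) in
  (forall s, emits U y q s <-> exists N, prefix s (flatten [seq enc_mx (u j) | j <- iota 0 N])) ->
  (forall s, emits U y (i ++ q) s <->
     exists N, prefix s (flatten [seq enc_mx (lift_rat S mn (u j)) | j <- iota 0 N])).
Proof.
move=> hU.
have c1 : computable (fun e => lift_size (nth 0%N e 0)) by rewrite /lift_size; computability.
have c2 : computable (fun e => 2 ^ nth 0%N e 2 * 2 ^ nth 0%N e 2)%N by computability.
have c3 : computable (fun e => 2 ^ nth 0%N e 2 * 2 ^ nth 0%N e 2 *
   (2 ^ nth 0%N e 2 * 2 ^ nth 0%N e 2) * 4)%N by computability.
have [i h] := stream_program hU c1 c2 c2 c3 computable_lift_sgn (computable_lift_mag S).
exists i => m n mn q u y hem s.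
have := h m n q (2 ^ (n - m) * 2 ^ (n - m))%N (2 ^ (n - m) * 2 ^ (n - m))%N (fun j => mxints (u j)).
move=> -> /=.
- by split=> -[N st]; exists N; congr (prefix s (flatten _)) : st; apply: eq_map => j;
    rewrite enc_mxE lift_correct.
- by move=> j; rewrite size_mxints.
move=> s'; rewrite hem; split=> -[N st]; exists N; congr (prefix s' (flatten _)) : st;
  by apply: eq_map => j; rewrite enc_mxE.
Qed.

(** * Sampling a slice of a state *)

(* [smp_mg j], [smp_ps j], [smp_ng j]: absolute value, positive and negative part of the [j]-th
   real coordinate of the input vector, multiplied by the common denominator [smp_D].
   [smp_R l] is the squared norm of the rescaled slice [N] number [l], and [x = smp_root r] is a
   power of 2 with [r < x ^ 2 <= 4 * r].  With [a] the real part of the first entry of [N],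
   [smp_Y] is [x - a] and [smp_den] is [r + x ^ 2 - 2 * x * a]: both are positive, and [a] is split
   into its positive and negative parts so that the truncated subtractions are exact. *)
Section SampleFunctions.
Local Open Scope nat_scope.

Definition smp_dn (L n j : nat) : nat := lmag L (2 ^ n * 1 * 4) (j * 2).+1.
Definition smp_D (L n : nat) : nat := \prod_(0 <= j < 2 ^ n * 2) smp_dn L n j.
Definition smp_mg (L n j : nat) : nat :=
  lmag L (2 ^ n * 1 * 4) (j * 2) * (smp_D L n %/ smp_dn L n j).
Definition smp_ps (L n j : nat) : nat := (1 - lsgn L (2 ^ n * 1 * 4) (j * 2)) * smp_mg L n j.
Definition smp_ng (L n j : nat) : nat := lsgn L (2 ^ n * 1 * 4) (j * 2) * smp_mg L n j.
Definition smp_R (L k m n l : nat) : nat := \sum_(0 <= i < 2 ^ k)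
  (smp_mg L n ((i * 2 ^ m + l) * 2) ^ 2 + smp_mg L n ((i * 2 ^ m + l) * 2).+1 ^ 2).
Definition smp_T (L k m n : nat) : nat := \sum_(0 <= l < 2 ^ m) smp_R L k m n l.
Definition smp_bits (L k m n : nat) : nat :=
  \sum_(0 <= j < smp_T L k m n) (2 ^ j < smp_T L k m n).
(** Inverse of the cumulative sums of [smp_R]: among the [u] below the total, the index [l] is
    returned for exactly [smp_R L k m n l] values. *)
Definition smp_sel (L k m n u : nat) : nat :=
  \sum_(0 <= l < 2 ^ m) (\sum_(0 <= l' < l.+1) smp_R L k m n l' <= u).
Definition smp_root (r : nat) : nat := 2 ^ (\sum_(0 <= j < r.+1) (4 ^ j <= r)).

Definition smp_Y (L n l x : nat) : nat := x + smp_ng L n (l * 2) - smp_ps L n (l * 2).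
Definition smp_den (L n l r x : nat) : nat :=
  r + x ^ 2 + 2 * x * smp_ng L n (l * 2) - 2 * x * smp_ps L n (l * 2).

(** Coordinate [j] is the real or imaginary part of entry [j %/ 2], according to parity. For
    [ch = 1] the difference of [smp_pos] and [smp_neg] over [smp_dd] is a coordinate of the
    reflected vector, where [r - x ^ 2] enters only the real part of the first entry; otherwise it
    is a coordinate of the basis vector. *)
Definition smp_pos (L m n l r x ch j : nat) : nat :=
  if ch == 1 then 2 * smp_Y L n l x * smp_ps L n ((j %/ 2 * 2 ^ m + l) * 2 + j %% 2)
     + (j == 0) * r
  else j == 0.
Definition smp_neg (L m n l r x ch j : nat) : nat :=
  if ch == 1 then 2 * smp_Y L n l x * smp_ng L n ((j %/ 2 * 2 ^ m + l) * 2 + j %% 2)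
     + (j == 0) * x ^ 2
  else 0.
Definition smp_dd (L n l r x ch : nat) : nat :=
  if ch == 1 then smp_den L n l r x else 1.
Definition smp_abs (L m n l r x ch j : nat) : nat :=
  smp_pos L m n l r x ch j - smp_neg L m n l r x ch j +
  (smp_neg L m n l r x ch j - smp_pos L m n l r x ch j).

Definition smp_sgn' (L m n l r x ch q : nat) : nat :=
  (q %% 2 == 0) && (smp_pos L m n l r x ch (q %/ 2) < smp_neg L m n l r x ch (q %/ 2)).
Definition smp_mag' (L m n l r x ch q : nat) : nat :=
  (if q %% 2 == 0 then smp_abs L m n l r x ch (q %/ 2) else smp_dd L n l r x ch)
   %/ gcdn (smp_abs L m n l r x ch (q %/ 2)) (smp_dd L n l r x ch).

(** The quantities [l], [r] and the root are passed to [f] as arguments, so that computability of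
    [f] can be checked with plain variables in their place. *)
Definition smp_call (f : nat -> nat -> nat -> nat -> nat -> nat -> nat -> nat -> nat)
    (e : seq nat) : nat :=
  let L := nth 0 e 1 in let k := nth 0 e 2 in let m := nth 0 e 3 in let n := nth 0 e 4 in
  let l := smp_sel L k m n (nth 0 e 5) in let r := smp_R L k m n l in
  f L m n l r (smp_root r) (nth 0 e 6) (nth 0 e 0).

Lemma computable_smp_R f1 f2 f3 f4 f5 :
  computable f1 -> computable f2 -> computable f3 -> computable f4 -> computable f5 ->
  computable (fun e => smp_R (f1 e) (f2 e) (f3 e) (f4 e) (f5 e)).
Proof.
move=> h1 h2 h3 h4 h5.
have h : computable (fun e => smp_R (nth 0 e 0) (nth 0 e 1) (nth 0 e 2) (nth 0 e 3) (nth 0 e 4)).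
  rewrite /smp_R /smp_mg /smp_D /smp_dn /lmag; by computability.
apply: computable_ext (computable_lets (fs := [:: f1; f2; f3; f4; f5]) h _) _; last by [].
by move=> f [<-|[<-|[<-|[<-|[<-|[]]]]]].
Qed.

Lemma computable_smp_bits :
  computable (fun e => smp_bits (nth 0 e 0) (nth 0 e 1) (nth 0 e 2) (nth 0 e 3)).
Proof.
rewrite /smp_bits /smp_T.
by do ?[exact: computable_smp_R | progress computability | apply: computable_smp_R].
Qed.

Lemma computable_smp_call f :
  computable (fun e => f (nth 0 e 0) (nth 0 e 1) (nth 0 e 2) (nth 0 e 3) (nth 0 e 4) (nth 0 e 5)
      (nth 0 e 6) (nth 0 e 7)) -> computable (smp_call f).
Proof.
move=> hf; rewrite /smp_call.
have hl : computable (fun e => smp_sel (nth 0 e 1) (nth 0 e 2) (nth 0 e 3) (nth 0 e 4) (nth 0 e 5)).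
  rewrite /smp_sel; by do ?[progress computability | apply: computable_smp_R].
have hr : computable (fun e => smp_R (nth 0 e 1) (nth 0 e 2) (nth 0 e 3) (nth 0 e 4)
    (smp_sel (nth 0 e 1) (nth 0 e 2) (nth 0 e 3) (nth 0 e 4) (nth 0 e 5))).
  by apply: computable_smp_R => //; computability.
have hx := computable_comp1 (F := smp_root) _ hr.
pose fs : seq (seq nat -> nat) := [:: (fun e => nth 0 e 1); (fun e => nth 0 e 3); (fun e => nth 0 e 4);
  (fun e => smp_sel (nth 0 e 1) (nth 0 e 2) (nth 0 e 3) (nth 0 e 4) (nth 0 e 5));
  (fun e => smp_R (nth 0 e 1) (nth 0 e 2) (nth 0 e 3) (nth 0 e 4)
    (smp_sel (nth 0 e 1) (nth 0 e 2) (nth 0 e 3) (nth 0 e 4) (nth 0 e 5)));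
  (fun e => smp_root (smp_R (nth 0 e 1) (nth 0 e 2) (nth 0 e 3) (nth 0 e 4)
    (smp_sel (nth 0 e 1) (nth 0 e 2) (nth 0 e 3) (nth 0 e 4) (nth 0 e 5))));
  (fun e => nth 0 e 6); (fun e => nth 0 e 0)].
apply: computable_ext (computable_lets (fs := fs) hf _) _; last by [].
have {}hx := hx ltac:(rewrite /smp_root; computability).
by move=> g [<-|[<-|[<-|[<-|[<-|[<-|[<-|[<-|[]]]]]]]]] //; computability.
Qed.

Lemma computable_smp_sgn : computable (smp_call smp_sgn').
Proof.
apply: computable_smp_call.
rewrite /smp_sgn' /smp_pos /smp_neg /smp_Y /smp_ng /smp_ps /smp_mg /smp_D /smp_dn /lmag /lsgn.
by computability.
Qed.

Lemma computable_smp_mag : computable (smp_call smp_mag').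
Proof.
apply: computable_smp_call.
rewrite /smp_mag' /smp_abs /smp_dd /smp_den /smp_pos /smp_neg /smp_Y /smp_ng /smp_ps /smp_mg /smp_D.
rewrite /smp_dn /lmag /lsgn.
by computability.
Qed.

End SampleFunctions.

Section SampleVector.
Variables (L k m n u ch : nat).
Let l := smp_sel L k m n u.
Let r := smp_R L k m n l.
Let x := smp_root r.

Definition smp_frac (j : nat) : rat :=
  ((smp_pos L m n l r x ch j)%:R - (smp_neg L m n l r x ch j)%:R) / (smp_dd L n l r x ch)%:R.

Definition smp_vec : 'cV[rat[i]]_(2 ^ k) :=
  \col_i (smp_frac (i * 2) +i* smp_frac (i * 2).+1).

Lemma smp_frac_sm j : smp_frac j = sfrac (smp_pos L m n l r x ch j < smp_neg L m n l r x ch j)%N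
  (smp_abs L m n l r x ch j) (smp_dd L n l r x ch).
Proof.
rewrite /smp_frac /sfrac /smp_abs; set p := smp_pos _ _ _ _ _ _ _ _; set q := smp_neg _ _ _ _ _ _ _ _.
rewrite mulrA; congr (_ / _); case: ltnP => [pq|qp].
  rewrite expr1 mulN1r (eqP (ltnW pq : (p - q)%N == 0%N)) add0n.
  by rewrite -[_%:~R]/((q - p)%N%:R) natrB 1?ltnW // opprB.
rewrite expr0 mul1r (eqP (qp : (q - p)%N == 0%N)) addn0.
by rewrite -[_%:~R]/((p - q)%N%:R) natrB.
Qed.

Lemma smp_vec_ints : (0 < smp_dd L n l r x ch)%N ->
  let e := [:: L; k; m; n; u; ch] in
  mxints smp_vec = [seq (smp_call smp_sgn' (q :: e) != 0%N, smp_call smp_mag' (q :: e))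
    | q <- iota 0 (2 ^ k * 1 * 4)].
Proof.
move=> d0 e; apply: eq_mxints => a b t t4.
have -> : b = ord0 by apply: val_inj; case: b => -[].
rewrite /smp_call /= -/l -/r -/x muln1 addn0 mxE /=.
set q := (_ + t)%N.
have q2 : (q %/ 2)%N = (a * 2 + t %/ 2)%N.
  by rewrite /q -[4%N]/(2 * 2)%N mulnA divnMDl.
have qm : (q %% 2)%N = (t %% 2)%N by rewrite /q -[4%N]/(2 * 2)%N mulnA modnMDl.
rewrite /smp_sgn' /smp_mag' q2 qm.
have key j : sm (numq (smp_frac j)) =
      ((smp_pos L m n l r x ch j < smp_neg L m n l r x ch j)%N, (smp_abs L m n l r x ch j %/
      gcdn (smp_abs L m n l r x ch j) (smp_dd L n l r x ch))%N) /\
    sm (denq (smp_frac j)) = (false, (smp_dd L n l r x ch %/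
      gcdn (smp_abs L m n l r x ch j) (smp_dd L n l r x ch))%N).
  rewrite smp_frac_sm; have [|s1 s2] := @sm_frac _ (smp_abs L m n l r x ch j) _ d0 _
    (leq_b1 (smp_pos L m n l r x ch j < smp_neg L m n l r x ch j)%N).
  - by rewrite /smp_abs => /eqP; rewrite addn_eq0 => /andP[_ h]; rewrite ltnNge -subn_eq0 h.
  - by rewrite s1 s2 eqb0 negbK.
have [k1 k2] := key (a * 2)%N; have [k3 k4] := key (a * 2).+1.
move: (q) q2 qm => {}q q2 qm; case: t t4 q2 qm => [|[|[|[|]]]] //= _ q2 qm;
  rewrite ?addn0 ?addn1 ?k1 ?k2 ?k3 ?k4 //.
all: by rewrite eqb0 negbK.
Qed.

End SampleVector.

Lemma sample_vec (U : machine) : universal U -> exists i, forall m n k p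
    (phi : 'cV[rat[i]]_(2 ^ n)) bits (b : bool),
  let L := foldl push 0%N (mxints phi) in let u := bits_val 0 bits in
  let l := smp_sel L k m n u in let r := smp_R L k m n l in
  computes U (enc_pair (enc_nat n) (zz m n)) p (enc_mx phi) ->
  size bits = smp_bits L k m n -> (0 < smp_dd L n l r (smp_root r) b)%N ->
  computes U (enc_pair (enc_nat k) (zz m n)) (i ++ p ++ bits ++ [:: b])
    (enc_mx (smp_vec L k m n u b)).
Proof.
move=> hU.
have c1 : computable (fun e => 2 ^ nth 0%N e 2 * 1 * 4)%N by computability.
have c2 : computable (fun e => 2 ^ nth 0%N e 0)%N by computability.
have c3 : computable (fun e => 2 ^ nth 0%N e 0 * 1 * 4)%N by computability.
have [i h] := sample_program hU c1 computable_smp_bits c2 (computable_cst 1) c3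
  computable_smp_sgn computable_smp_mag.
exists i => m n k p phi bits b L u l r cp sb d0.
rewrite enc_mxE smp_vec_ints //.
apply: (h k m n p (2 ^ n)%N 1%N (mxints phi) bits b) => //=.
- by rewrite -enc_mxE.
- by rewrite size_mxints.
Qed.

Section SampleCoordinates.
Variables (n : nat) (phi : 'cV[rat[i]]_(2 ^ n)).
Let L := foldl push 0%N (mxints phi).

Definition coord (a : 'I_(2 ^ n)) (c : bool) : rat :=
  if c then complex.Im (phi a 0) else complex.Re (phi a 0).

Lemma smp_read (a : 'I_(2 ^ n)) (c : bool) :
  [/\ lmag L (2 ^ n * 1 * 4) ((a * 2 + c) * 2) = `|numq (coord a c)|%N,
      lsgn L (2 ^ n * 1 * 4) ((a * 2 + c) * 2) = (numq (coord a c) < 0)%R &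
      smp_dn L n (a * 2 + c) = `|denq (coord a c)|%N].
Proof.
have lt (x : nat) : (x < 4)%N -> ((a * 1 + 0) * 4 + x < size (mxints phi))%N.
  by move=> x4; rewrite size_mxints; have := ltn_ord a; lia.
have rd x : (x < 4)%N -> lmag L (2 ^ n * 1 * 4) ((a * 1 + 0) * 4 + x) =
      (nth (false, 0%N) (crat_ints (phi a 0)) x).2 /\
    lsgn L (2 ^ n * 1 * 4) ((a * 1 + 0) * 4 + x) = (nth (false, 0%N) (crat_ints (phi a 0)) x).1.
  move=> x4; have := lget_foldl (lt x x4); rewrite (nth_mxints phi a ord0) //.
  by rewrite size_mxints.
have e c' x : ((a * 1 + 0) * 4 + (c' * 2 + x) = (a * 2 + c') * 2 + x)%N by lia.
rewrite /smp_dn; have -> : (((a * 2 + c) * 2).+1 = (a * 2 + c) * 2 + 1)%N by rewrite addn1.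
have := rd (c * 2 + 0)%N; have := rd (c * 2 + 1)%N; rewrite !e !addn0.
by case: (c) => /= /(_ isT)[-> _] /(_ isT)[-> ->]; rewrite /coord.
Qed.

Lemma smp_dn_gt0 j : (j < 2 ^ n * 2)%N -> (0 < smp_dn L n j)%N.
Proof.
move=> jn; have h : (j %/ 2 < 2 ^ n)%N by rewrite ltn_divLR.
have -> : j = (Ordinal h * 2 + odd j)%N by rewrite /= -modn2 -divn_eq.
by have [_ _ ->] := smp_read (Ordinal h) (odd j); rewrite absz_gt0 denq_eq0.
Qed.

Lemma smp_D_gt0 : (0 < smp_D L n)%N.
Proof.
by rewrite /smp_D big_mkord prodn_gt0 // => j; apply: smp_dn_gt0.
Qed.

Lemma smp_dn_dvd j : (j < 2 ^ n * 2)%N -> (smp_dn L n j %| smp_D L n)%N.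
Proof.
by move=> jn; rewrite /smp_D big_mkord (bigD1 (Ordinal jn)) //= dvdn_mulr.
Qed.

Lemma smp_coordE (R : realType) (a : 'I_(2 ^ n)) (c : bool) :
  (smp_ps L n (a * 2 + c))%:R - (smp_ng L n (a * 2 + c))%:R =
    (smp_D L n)%:R * ratr (coord a c) :> R.
Proof.
have jn : (a * 2 + c < 2 ^ n * 2)%N by have := ltn_ord a; case: c; lia.
have [e1 e2 e3] := smp_read a c.
suff h : (smp_ps L n (a * 2 + c))%:R - (smp_ng L n (a * 2 + c))%:R =
    (smp_D L n)%:R * coord a c :> rat.
  by have := congr1 (ratr : rat -> R) h; rewrite rmorphB /= !ratr_nat [ratr (_ * _)]rmorphM /= ratr_nat.
rewrite /smp_ps /smp_ng /smp_mg e1 e2; set q := (smp_D L n %/ _)%N.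
have -> : (smp_D L n)%:R = q%:R * (denq (coord a c))%:~R :> rat.
  by rewrite -absz_denq -e3 -[_%:~R]/(_%:R) -natrM divnK // smp_dn_dvd.
rewrite -mulrA [_%:~R * coord a c]mulrC -numqE.
have nE : (numq (coord a c))%:~R = (if (numq (coord a c) < 0)%R then - `|numq (coord a c)|%N%:R
    else `|numq (coord a c)|%N%:R) :> rat.
  by case: ltrP => h; rewrite -[( `|_|%N)%:R]/(( `|_|%N)%:~R) abszE;
    [rewrite ltr0_norm // rmorphN opprK | rewrite ger0_norm].
rewrite nE; case: (_ < 0)%R; rewrite ?subnn ?subn0 mul0n mul1n ?subr0 natrM.
  by rewrite sub0r mulrN mulrC.
by rewrite mulrC.
Qed.

Lemma smp_mgE (R : realType) (a : 'I_(2 ^ n)) (c : bool) :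
  (smp_mg L n (a * 2 + c))%:R ^+ 2 = ((smp_D L n)%:R * ratr (coord a c)) ^+ 2 :> R.
Proof.
rewrite -smp_coordE /smp_ps /smp_ng; have [_ -> _] := smp_read a c.
by case: (_ < 0); rewrite /= ?subnn ?subn0 mul0n mul1n ?subr0 // sub0r sqrrN.
Qed.

End SampleCoordinates.

(** * Squared norms and the rational reflection *)

Section Nsq.
Variable R : realType.
Implicit Types z : R[i].

Definition nsq z : R := complex.Re z ^+ 2 + complex.Im z ^+ 2.

Lemma nsq_ge0 z : 0 <= nsq z.
Proof. by rewrite addr_ge0 ?sqr_ge0. Qed.

Lemma mul_conj_nsq z : (z^*)%R * z = (nsq z)%:C.
Proof.
case: z => a b; rewrite /nsq /=; apply/eqP; rewrite eq_complex /=.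
by apply/andP; split; apply/eqP; ring.
Qed.

Lemma nsq_scale (a : R) z : nsq (a%:C * z) = a ^+ 2 * nsq z.
Proof. by case: z => x y; rewrite /nsq /=; ring. Qed.

Lemma nsq_comb (a b : R) z z' :
  nsq (a%:C * z + b%:C * z') <= 2 * a ^+ 2 * nsq z + 2 * b ^+ 2 * nsq z'.
Proof.
case: z z' => x y [x' y']; rewrite /nsq /= -subr_ge0.
have -> : 2 * a ^+ 2 * (x ^+ 2 + y ^+ 2) + 2 * b ^+ 2 * (x' ^+ 2 + y' ^+ 2) -
   ((a * x - 0 * y + (b * x' - 0 * y')) ^+ 2 + (a * y + 0 * x + (b * y' + 0 * x')) ^+ 2)
   = (a * x - b * x') ^+ 2 + (a * y - b * y') ^+ 2 by ring.
by rewrite addr_ge0 ?sqr_ge0.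
Qed.

Definition dotv d (v w : 'cV[R[i]]_d) : R[i] := \sum_i (v i 0)^* * w i 0.

Lemma dotvD d (v w w' : 'cV[R[i]]_d) : dotv v (w + w') = dotv v w + dotv v w'.
Proof. by rewrite -big_split; apply: eq_bigr => i _; rewrite mxE mulrDr. Qed.

Lemma dotvZ d (v w : 'cV[R[i]]_d) a : dotv v (a *: w) = a * dotv v w.
Proof. by rewrite mulr_sumr; apply: eq_bigr => i _; rewrite mxE mulrCA. Qed.

Lemma dotv_self d (w : 'cV[R[i]]_d) : dotv w w = (\sum_i nsq (w i 0))%:C.
Proof. by rewrite rmorph_sum; apply: eq_bigr => i _; rewrite mul_conj_nsq. Qed.

End Nsq.

(* With [s = sqrt r] and [s < x <= 2 s], the vector [2 (x - a) N + (r - x^2) b] is a multiple of a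
   unit vector [e], and [N] is a combination of [e] and [b] with coefficients [O(s)]. *)
Lemma reflect_coeff (R : realType) (a r x : R) : 0 < r -> a ^+ 2 <= r -> r < x ^+ 2 ->
  x ^+ 2 <= 4 * r -> 0 < x ->
  [/\ 0 < x - a, 0 < r + x ^+ 2 - 2 * x * a,
     ((r + x ^+ 2 - 2 * x * a) / (2 * (x - a))) ^+ 2 <= 49 / 4 * r
   & ((r - x ^+ 2) / (2 * (x - a))) ^+ 2 <= 9 / 4 * r].
Proof.
move=> r0 ar rx x4 x0; set s := Num.sqrt r.
have s0 : 0 < s by rewrite sqrtr_gt0.
have ss : s ^+ 2 = r by rewrite sqr_sqrtr // ltW.
have as_ : a <= s.
  by apply: le_trans (ler_norm a) _; rewrite -sqrtr_sqr; apply: ler_wsqrtr.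
have sx : s < x by rewrite -(@ltr_pXn2r _ 2) ?nnegrE ?ltW // ss.
have xs : x <= 2 * s.
  rewrite -(@ler_pXn2r _ 2) ?nnegrE //; [rewrite exprMn ss| |]; lra.
have xa : 0 < x - a by lra.
set t := (r - x ^+ 2) / (2 * (x - a)).
have tE : t * (2 * (x - a)) = r - x ^+ 2 by rewrite /t divfK //; lra.
have t0 : t <= 0.
  by rewrite /t mulr_le0_ge0 ?invr_ge0; lra.
(* This combines [x - s <= x - a], from [a <= s], with [x + s <= 3 * s], from [x <= 2 * s]. *)
have t1 : - (3 / 2 * s) <= t.
  rewrite -(@ler_pM2r _ (2 * (x - a))); last by lra.
  rewrite tE -ss.
  have : (x - s) * (x + s) <= (x - a) * (3 * s) by apply: ler_pM; lra.
  by nra.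
(* The first coefficient is [t + x], of absolute value at most [(3 / 2 + 2) * s]; [49 / 4] is the
   square of this crude bound. *)
have E : (r + x ^+ 2 - 2 * x * a) / (2 * (x - a)) = t + x.
  rewrite /t; field; lra.
split=> //.
- by nra.
- by rewrite E -ss; nra.
by rewrite -ss; nra.
Qed.

Local Open Scope sesquilinear_scope.

(** For a downward closed predicate the number of successes is the first failure, so a sum performs
    a bounded search. The root and the bit length are computed in this way. *)
Lemma count_lt_prop (P : nat -> bool) (N : nat) : (forall i j, (i <= j)%N -> P j -> P i) ->
  ~~ P N -> let c := (\sum_(0 <= j < N) P j)%N in
  ~~ P c /\ forall j, (j < c)%N -> P j.
Proof.
move=> hP nN; have [c [cN nc hc]] : exists c, [/\ (c <= N)%N, ~~ P c & forall j, (j < c)%N -> P j].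
  elim: N nN => [|N IH] nN; first by exists 0%N.
  have [PN|nPN] := boolP (P N); last first.
    by have [c [cN nc hc]] := IH nPN; exists c; split=> //; apply: leqW.
  by exists N.+1; split=> // j jN; apply: hP PN.
suff -> : (\sum_(0 <= j < N) P j)%N = c by [].
rewrite (big_cat_nat (leq0n c) cN) /= (eq_big_nat _ _ (F2 := fun=> 1%N)); last first.
  by move=> j /andP[_ /hc->].
rewrite sum_nat_const_nat subn0 muln1 big_nat_cond big1 ?addn0 // => j.
by case/andP=> /andP[cj _] _; rewrite (negPf (contra (hP _ _ cj) nc)).
Qed.

Lemma smp_rootP r : (0 < r)%N -> [/\ (r < smp_root r ^ 2)%N & (smp_root r ^ 2 <= 4 * r)%N].
Proof.
move=> r0; have [||] := @count_lt_prop (fun j => 4 ^ j <= r)%N r.+1.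
- by move=> i j ij; apply: leq_trans; rewrite leq_exp2l.
- by rewrite -ltnNge; apply: ltn_trans (ltn_expl _ (isT : (1 < 4)%N)).
have sq c : ((2 ^ c) ^ 2 = 4 ^ c)%N by rewrite -expnM mulnC expnM.
rewrite /smp_root sq -ltnNge; set c := (\sum_(_ <= _ < _) _)%N => rc hc; split=> //.
case: c rc hc => [|c] rc hc; first by move: rc; rewrite expn0 ltnS leqn0 (gtn_eqF r0).
by rewrite expnS leq_mul2l hc.
Qed.

Lemma smp_bitsP L k m n : let s := smp_bits L k m n in
  (smp_T L k m n <= 2 ^ s)%N /\ ((0 < smp_T L k m n)%N -> (2 ^ s <= 2 * smp_T L k m n)%N).
Proof.
rewrite /smp_bits; set T := smp_T L k m n.
have [||] := @count_lt_prop (fun j => 2 ^ j < T)%N T.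
- by move=> i j ij; apply: leq_ltn_trans; rewrite leq_exp2l.
- by rewrite -leqNgt ltnW // ltn_expl.
set c := (\sum_(_ <= _ < _) _)%N; rewrite -leqNgt => Tc hc; split=> //.
case: c Tc hc => [|c] Tc hc T0; first by rewrite expn0; lia.
by rewrite expnS leq_mul2l /= ltnW // hc.
Qed.

Section Selection.
Variables (V : zmodType) (r : nat -> nat) (g : nat -> V).
Let S M := (\sum_(0 <= l < M) r l)%N.

(** Each [l] is selected by an interval of [r l] consecutive values of [u], so a sum over samples is
    a sum over slices with multiplicities. *)
Lemma sum_selection M :
  \sum_(0 <= u < S M) g (\sum_(0 <= l < M) (S l.+1 <= u))%N = \sum_(0 <= l < M) g l *+ r l.
Proof.
have SS l : S l.+1 = (S l + r l)%N by rewrite /S big_nat_recr.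
have Smono i j : (i <= j)%N -> (S i <= S j)%N.
  by move=> ij; rewrite /S (big_cat_nat (leq0n i) ij) leq_addr.
elim: M => [|M IH]; first by rewrite /S !big_geq.
rewrite big_nat_recr //= -IH (big_cat_nat (leq0n (S M))) ?Smono //=; congr (_ + _).
  apply: eq_big_nat => u /andP[_ uM]; congr g.
  by rewrite big_nat_recr //= leqNgt (leq_trans uM) ?Smono ?addn0.
rewrite (eq_big_nat _ _ (F2 := fun=> g M)); last first.
  move=> u /andP[Mu uM]; congr g; rewrite big_nat_recr //= leqNgt uM addn0.
  rewrite (eq_big_nat _ _ (F2 := fun=> 1%N)) ?sum_nat_const_nat ?subn0 ?muln1 //.
  by move=> l /andP[_ lM]; rewrite (leq_trans _ Mu) ?Smono.
by rewrite sumr_const_nat SS addKn.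
Qed.

End Selection.

Lemma sel_pos L k m n u : (u < smp_T L k m n)%N -> (0 < smp_R L k m n (smp_sel L k m n u))%N.
Proof.
move=> uT; rewrite lt0n; apply/negP => /eqP R0.
(* With the indicator of multiplicity 0 in place of [g], the right side vanishes; hence no sample
   selects an index of multiplicity 0. *)
have := @sum_selection int (smp_R L k m n) (fun l => (smp_R L k m n l == 0%N)%:R) (2 ^ m).
rewrite [RHS]big1 => [|l _]; last first.
  by case: eqP => [->|_]; rewrite ?mulr0n ?mul0rn.
move=> /eqP; rewrite psumr_eq0 => [/allP/(_ u)|i _]; last by rewrite ler0n.
rewrite mem_index_iota => /(_ uT) /=.
by rewrite -[(\sum_(0 <= l < _) _)%N]/(smp_sel L k m n u) R0 eqxx.
Qed.

Lemma dotvE (R : realType) d (v w : 'cV[R[i]]_d) : (v^t* *m w) 0 0 = dotv v w.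
Proof. by rewrite mxE; apply: eq_bigr => i _; rewrite !mxE. Qed.

Lemma elementary_dotv (R : realType) k (phi : 'cV[rat[i]]_(2 ^ k)) :
  elementary_state R phi <-> \sum_i nsq (crat_mx R phi i 0) = 1.
Proof.
rewrite /elementary_state; split=> h.
  have := congr1 (fun M : 'M_1 => M 0 0) h; rewrite dotvE dotv_self mxE eqxx.
  by move/(congr1 (@complex.Re R)).
by apply/matrixP => i j; rewrite !ord1 dotvE dotv_self h mxE eqxx.
Qed.

Lemma double_le (R : realType) (p q : R) : p <= 2 * q -> 2 * p <= 4 * q.
Proof. by move=> ?; lra. Qed.

Lemma factor_100 (R : realType) (p q a : R) :
  25 * p * (4 * q) / a = q * (100 * (a^-1 * p)).
Proof. by ring. Qed.

(** The defining equation of [mirror] solved for the slice. *)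
Lemma combine_mirror (R : realType) d (D a y w : R) (s b : 'cV[R[i]]_d) : a != 0 -> y != 0 ->
  D%:C *: s = (a / (2 * y))%:C *: ((a^-1)%:C *: ((2 * y * D)%:C *: s + w%:C *: b)) +
    (- (w / (2 * y)))%:C *: b.
Proof.
move=> a0 y0; apply/matrixP => i j; rewrite ord1 !mxE; case: (s i 0) (b i 0) => p q [p' q'].
apply/eqP; rewrite eq_complex /=; apply/andP; split; apply/eqP; field; by rewrite a0 y0.
Qed.

(** * Slices of an elementary state *)

Section Slices.
Variables (R : realType) (m n : nat).
Hypothesis mn : (m < n)%N.
Local Notation k := (n - m)%N.
Variable phi : 'cV[rat[i]]_(2 ^ n).
Hypothesis phi1 : elementary_state R phi.
Let L := foldl push 0%N (mxints phi).
Let D : R := (smp_D L n)%:R.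
Let cphi := crat_mx R phi.

Definition idx (i : 'I_(2 ^ k)) (l : 'I_(2 ^ m)) : 'I_(2 ^ n) :=
  cast_ord (esym (pow_split mn)) (mxtens_index (i, l)).

Definition slice (l : nat) : 'cV[R[i]]_(2 ^ k) := (emb _ m n l)^T *m cphi.

Lemma slice_entry (l : 'I_(2 ^ m)) i : slice l i 0 = cphi (idx i l) 0.
Proof.
rewrite mxE; under eq_bigr => a _.
  rewrite mxE (_ : emb _ m n l a i = (true && (a == idx i l))%:R); last first.
    by rewrite mxE -val_eqE.
  over.
by rewrite sum_delta mul1r.
Qed.

Let D0 : 0 < D. Proof. by rewrite ltr0n smp_D_gt0. Qed.

Lemma slice_coord (l : 'I_(2 ^ m)) (i : 'I_(2 ^ k)) (c : bool) :
  (smp_ps L n ((i * 2 ^ m + l) * 2 + c))%:R - (smp_ng L n ((i * 2 ^ m + l) * 2 + c))%:R =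
    D * (if c then complex.Im (slice l i 0) else complex.Re (slice l i 0)) :> R.
Proof.
rewrite slice_entry mxE; have := smp_coordE phi R (idx i l) c; rewrite -/L -/D /= => ->.
by rewrite /coord; case: c.
Qed.

Lemma slice_R (l : 'I_(2 ^ m)) :
  (smp_R L k m n l)%:R = D ^+ 2 * \sum_i nsq (slice l i 0) :> R.
Proof.
rewrite /smp_R big_mkord natr_sum mulr_sumr; apply: eq_bigr => i _.
rewrite natrD !natrX slice_entry /nsq mxE /=.
have := smp_mgE phi R (idx i l) false; have := smp_mgE phi R (idx i l) true.
rewrite -/L -/D /= addn0 addn1 => -> ->.
by rewrite !exprMn mulrDr.
Qed.

Lemma sum_slices (V : zmodType) (F : 'I_(2 ^ n) -> V) :
  \sum_(l < 2 ^ m) \sum_(i < 2 ^ k) F (idx i l) = \sum_a F a.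
Proof.
rewrite exchange_big pair_big /=.
rewrite [RHS](reindex (fun p : 'I_(2 ^ k) * 'I_(2 ^ m) => idx p.1 p.2)) //=.
exists (fun a => mxtens_unindex (cast_ord (pow_split mn) a)) => [[i l] _|a _].
  by rewrite /idx cast_ordKV mxtens_indexK.
by rewrite /idx -surjective_pairing mxtens_unindexK cast_ordK.
Qed.

Lemma slice_T : (smp_T L k m n)%:R = D ^+ 2 :> R.
Proof.
rewrite /smp_T big_mkord natr_sum; under eq_bigr => l _ do rewrite slice_R.
rewrite -mulr_sumr; under eq_bigr => l _ do under eq_bigr => i _ do rewrite slice_entry.
rewrite (sum_slices (fun a => nsq (cphi a 0))).
by have /elementary_dotv -> := phi1; rewrite mulr1.
Qed.

Definition basis0 : 'cV[R[i]]_(2 ^ k) := \col_i ((i == 0 :> nat)%N)%:R.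

Section OneSlice.
Variable l : 'I_(2 ^ m).
Let r := smp_R L k m n l.
Let x := smp_root r.
Hypothesis r0 : (0 < r)%N.
Let i0 : 'I_(2 ^ k) := Ordinal (expn_gt0 2 k : (0 < 2 ^ k)%N).
Let a : R := D * complex.Re (slice l i0 0).

Lemma slice_a : a = (smp_ps L n (l * 2))%:R - (smp_ng L n (l * 2))%:R.
Proof. by have := slice_coord l i0 false; rewrite /= mul0n add0n addn0 => ->. Qed.

Lemma slice_a_le : a ^+ 2 <= r%:R.
Proof.
rewrite slice_R /a exprMn ler_pM2l ?exprn_gt0 // (bigD1 i0) //= /nsq.
by rewrite -addrA lerDl addr_ge0 ?sqr_ge0 // sumr_ge0 // => i _; apply: nsq_ge0.
Qed.

Lemma slice_coeffs : [/\ 0 < x%:R - a, 0 < r%:R + x%:R ^+ 2 - 2 * x%:R * a,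
     ((r%:R + x%:R ^+ 2 - 2 * x%:R * a) / (2 * (x%:R - a))) ^+ 2 <= 49 / 4 * r%:R
   & ((r%:R - x%:R ^+ 2) / (2 * (x%:R - a))) ^+ 2 <= 9 / 4 * r%:R].
Proof.
have [h1 h2] := smp_rootP r0; apply: reflect_coeff.
- by rewrite ltr0n.
- exact: slice_a_le.
- by rewrite -natrX ltr_nat.
- by rewrite -natrX -natrM ler_nat.
by rewrite ltr0n /x /smp_root expn_gt0.
Qed.

Lemma smp_Y_real : (smp_Y L n l x)%:R = x%:R - a :> R.
Proof.
have [h _ _ _] := slice_coeffs; rewrite slice_a in h *; rewrite /smp_Y; move: h.
move: (smp_ps L n (l * 2)) (smp_ng L n (l * 2)) (x) => p q y h.
rewrite natrB ?natrD; first by ring.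
by rewrite -(ler_nat R) natrD; lra.
Qed.

Lemma smp_den_real : (smp_den L n l r x)%:R = r%:R + x%:R ^+ 2 - 2 * x%:R * a :> R.
Proof.
have [_ h _ _] := slice_coeffs; rewrite slice_a in h *; rewrite /smp_den; move: h.
move: (smp_ps L n (l * 2)) (smp_ng L n (l * 2)) (x) (r) => p q y s h.
rewrite natrB; first by rewrite !natrD natrX !natrM; ring.
by rewrite -(ler_nat R) !natrD natrX !natrM; lra.
Qed.

End OneSlice.

Lemma sel_lt u : (u < smp_T L k m n)%N -> (smp_sel L k m n u < 2 ^ m)%N.
Proof.
rewrite /smp_T /smp_sel; case: (2 ^ m)%N (expn_gt0 2 m) => [//|M] _ uT.
rewrite big_nat_recr //= [X in (_ + nat_of_bool X)%N]leqNgt uT addn0 ltnS.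
apply: (@leq_trans (\sum_(0 <= l < M) 1)); last by rewrite sum_nat_const_nat subn0 muln1.
by apply: leq_sum => i _; apply: leq_b1.
Qed.

(** With [N] the slice times [D], this is the image of [basis0] under the real reflection that
    reverses [N - x basis0], a vector of squared norm [smp_den]. A reflection yields a unit vector
    without a square root; if [x] were equal to the norm of [N], the result would be the normalised
    slice itself. *)
Definition mirror (l : nat) : 'cV[R[i]]_(2 ^ k) :=
  let r := smp_R L k m n l in let x := smp_root r in
  ((smp_den L n l r x)%:R^-1)%:C *: ((2 * (smp_Y L n l x)%:R * D)%:C *: slice l
     + (r%:R - x%:R ^+ 2)%:C *: basis0).

Lemma ratr_smp_frac u ch j : let l := smp_sel L k m n u in
  let r := smp_R L k m n l in let x := smp_root r in
  ratr (smp_frac L k m n u ch j) = ((smp_pos L m n l r x ch j)%:R - (smp_neg L m n l r x ch j)%:R)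
     / (smp_dd L n l r x ch)%:R :> R.
Proof. by move=> l r x; rewrite /smp_frac rmorphM /= rmorphB /= fmorphV /= !ratr_nat. Qed.

Lemma vec_false u : crat_mx R (smp_vec L k m n u false) = basis0.
Proof.
apply/matrixP => i j; rewrite ord1 !mxE /= !ratr_smp_frac /smp_pos /smp_neg /smp_dd /= !subr0 divr1.
by case: (nat_of_ord i) => [|?]; rewrite ?mul0r.
Qed.

Lemma vec_true u : (u < smp_T L k m n)%N ->
  crat_mx R (smp_vec L k m n u true) = mirror (smp_sel L k m n u).
Proof.
move=> uT; have lt := sel_lt uT; apply/matrixP => i j; rewrite ord1 {j}.
have fr (c : bool) : ratr (smp_frac L k m n u true (i * 2 + c)) =
   let l := smp_sel L k m n u in let r := smp_R L k m n l in let x := smp_root r in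
   (2 * (smp_Y L n l x)%:R * D * (if c then complex.Im (slice l i 0) else complex.Re (slice l i 0))
      + ((i * 2 + c)%N == 0%N)%:R * (r%:R - x%:R ^+ 2)) / (smp_den L n l r x)%:R.
  rewrite ratr_smp_frac /smp_pos /smp_neg /smp_dd /=.
  have -> : ((i * 2 + c) %/ 2 = i)%N by rewrite divnMDl // divn_small ?addn0 //; case: (c).
  have -> : ((i * 2 + c) %% 2 = c)%N by rewrite modnMDl modn_small //; case: (c).
  congr (_ / _); have := slice_coord (Ordinal lt) i c => /= e.
  rewrite -[2 * _ * D * _]mulrA -e; move: (smp_ps _ _ _) (smp_ng _ _ _) (smp_Y _ _ _ _) => p q y.
  move: (smp_root _) => x; move: (smp_R _ _ _ _ _) (nat_of_bool (_ == 0%N)) => r b.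
  by rewrite !natrD !natrM ?natrX; ring.
have f0 := fr false; have f1 := fr true; rewrite /= addn0 in f0; rewrite /= addn1 mul0r addr0 in f1.
have -> : crat_mx R (smp_vec L k m n u true) i 0 =
    ratr (smp_frac L k m n u true (i * 2)) +i* ratr (smp_frac L k m n u true (i * 2).+1).
  by rewrite mxE mxE.
rewrite f0 f1 /mirror; move: (slice _) (smp_Y _ _ _ _) (smp_den _ _ _ _ _) => s y d.
move: (smp_root _) => x; move: (smp_R _ _ _ _ _) => r.
rewrite !mxE; have -> : ((i * 2 == 0) = (i == 0 :> nat))%N by rewrite muln_eq0 orbF.
case: (s i 0) => p q /=; case: (_ == _)%N => /=;
  by apply/eqP; rewrite eq_complex /=; apply/andP; split; apply/eqP; ring.
Qed.

Lemma nsq_basis0 : \sum_i nsq (basis0 i 0) = 1.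
Proof.
pose i0 : 'I_(2 ^ k) := Ordinal (expn_gt0 2 k : (0 < 2 ^ k)%N).
rewrite (bigD1 i0) //= big1 => [|i ii0]; rewrite mxE /nsq.
  by rewrite /= expr1n expr0n addr0 addr0.
have -> : (i == 0 :> nat)%N = false by apply: contraNF ii0 => /eqP i00; apply/eqP/val_inj.
by rewrite /= expr0n addr0.
Qed.

Lemma nsq_mirror (l : 'I_(2 ^ m)) : (0 < smp_R L k m n l)%N -> \sum_i nsq (mirror l i 0) = 1.
Proof.
move=> r0; have [h1 h2 _ _] := slice_coeffs r0; rewrite /mirror.
set r := smp_R _ _ _ _ _ in h1 h2 *; set x := smp_root _ in h1 h2 *.
rewrite smp_Y_real // smp_den_real // -/r -/x.
pose i0 : 'I_(2 ^ k) := Ordinal (expn_gt0 2 k : (0 < 2 ^ k)%N).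
set a := D * _ in h1 h2 *.
set d := r%:R + x%:R ^+ 2 - 2 * x%:R * a in h2 *.
set al := 2 * (x%:R - a) * D; set be := r%:R - x%:R ^+ 2.
under eq_bigr => i _ do rewrite mxE nsq_scale.
rewrite -mulr_sumr.
(* Adding a multiple of [basis0] affects the first entry alone, and since the coefficients are real
   only the real part of that entry occurs in the cross term. *)
have -> : \sum_i nsq ((al%:C *: slice l + be%:C *: basis0) i 0) =
    al ^+ 2 * (\sum_i nsq (slice l i 0)) + 2 * al * be * complex.Re (slice l i0 0) + be ^+ 2.
  move: (slice l) al be => s al be.
  rewrite (bigD1 i0) //= [in RHS](bigD1 i0) //= mulrDr mulr_sumr.
  rewrite (eq_bigr (fun i => al ^+ 2 * nsq (s i 0))); last first.
    move=> i ii0; rewrite !mxE.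
    have -> : (i == 0 :> nat)%N = false by apply: contraNF ii0 => /eqP i00; apply/eqP/val_inj.
    by rewrite mulr0 addr0 nsq_scale.
  have -> : nsq ((al%:C *: s + be%:C *: basis0) i0 0) =
     al ^+ 2 * nsq (s i0 0) + 2 * al * be * complex.Re (s i0 0) + be ^+ 2.
    by rewrite !mxE /nsq; case: (s i0 0) => p q /=; ring.
  by ring.
have rE : r%:R = D ^+ 2 * \sum_i nsq (slice l i 0) :> R by rewrite -slice_R.
have -> : al ^+ 2 * (\sum_i nsq (slice l i 0)) = 4 * (x%:R - a) ^+ 2 * r%:R.
  by rewrite rE /al; ring.
have -> : 2 * al * be * complex.Re (slice l i0 0) = 4 * (x%:R - a) * be * a.
  by rewrite /al /a; ring.
apply: (@mulfI _ (d ^+ 2)); first by rewrite expf_neq0 // gt_eqF.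
rewrite exprVn mulrA divff ?expf_neq0 ?gt_eqF // mul1r mulr1 /d /be; ring.
Qed.

(** The inequality [nsq_comb] doubles the bounds [49 / 4] and [9 / 4] of [slice_coeffs]; 25 exceeds
    both [49 / 2] and [9 / 2]. *)
Lemma slice_mirror (v : 'cV[R[i]]_(2 ^ k)) (l : 'I_(2 ^ m)) :
  D ^+ 2 * nsq (dotv v (slice l)) <=
    25 * ((nsq (dotv v (mirror l)) + nsq (dotv v basis0)) *+ smp_R L k m n l).
Proof.
(* A slice of norm 0 is never sampled and has no reflected vector to compare with; it vanishes, and
   both sides are 0. *)
have [r0|] := posnP (smp_R L k m n l).
  have s0 : slice l = 0.
    have : \sum_i nsq (slice l i 0) = 0.
      apply: (@mulfI _ (D ^+ 2)); first by rewrite expf_neq0 // gt_eqF.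
      by rewrite -slice_R r0 mulr0.
    move/eqP; rewrite psumr_eq0 => [/allP h|i _]; last exact: nsq_ge0.
    apply/matrixP => i j; rewrite ord1 [RHS]mxE; have := h i (mem_index_enum _) => /=.
    rewrite /nsq paddr_eq0 ?sqr_ge0 // !sqrf_eq0; case: (slice l i 0) => p q /= /andP[/eqP-> /eqP->].
    by [].
  rewrite r0 mulr0n mulr0 s0 /dotv big1 => [|i _]; last by rewrite mxE mulr0.
  by rewrite /nsq /= expr0n addr0 mulr0.
move=> r0; have [h1 h2 h3 h4] := slice_coeffs r0.
have Ds : D%:C *: slice l =
   (((smp_den L n l (smp_R L k m n l) (smp_root (smp_R L k m n l)))%:R)
      / (2 * (smp_Y L n l (smp_root (smp_R L k m n l)))%:R))%:C *: mirror l +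
   (- (((smp_R L k m n l)%:R - (smp_root (smp_R L k m n l))%:R ^+ 2)
      / (2 * (smp_Y L n l (smp_root (smp_R L k m n l)))%:R)))%:C *: basis0.
  rewrite /mirror smp_Y_real // smp_den_real //.
  by apply: combine_mirror; rewrite gt_eqF.
rewrite -nsq_scale -dotvZ Ds dotvD (dotvZ _ (mirror l)) (dotvZ _ basis0).
apply: le_trans (nsq_comb _ _ _ _) _; rewrite sqrrN smp_Y_real // smp_den_real //.
move: h3 h4; set A := (_ / _) ^+ 2; set B := (_ / _) ^+ 2 => h3 h4.
rewrite -[(nsq _ + _) *+ _]mulr_natr; move: (nsq_ge0 (dotv v (mirror l))) (nsq_ge0 (dotv v basis0)).
move: (nsq (dotv v (mirror l))) (nsq (dotv v basis0)) => y z y0 z0.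
have r0' : 0 <= (smp_R L k m n l)%:R :> R by rewrite ler0n.
move: h3 h4 r0'; move: ((smp_R L k m n l)%:R : R) => r h3 h4 r0'.
have e1 : A * y <= 49 / 4 * r * y by apply: ler_wpM2r.
have e2 : B * z <= 9 / 4 * r * z by apply: ler_wpM2r.
have e3 : 0 <= r * y by apply: mulr_ge0.
have e4 : 0 <= r * z by apply: mulr_ge0.
have -> : 2 * A * y = 2 * (A * y) by ring.
have -> : 2 * B * z = 2 * (B * z) by ring.
lra.
Qed.

Lemma vec_elementary u (b : bool) : (u < smp_T L k m n)%N ->
  elementary_state R (smp_vec L k m n u b).
Proof.
move=> uT; apply/elementary_dotv; case: b; last by rewrite vec_false nsq_basis0.
by rewrite vec_true // (@nsq_mirror (Ordinal (sel_lt uT))) // sel_pos.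
Qed.

Lemma dd_gt0 u (b : bool) : (u < smp_T L k m n)%N ->
  (0 < smp_dd L n (smp_sel L k m n u) (smp_R L k m n (smp_sel L k m n u))
     (smp_root (smp_R L k m n (smp_sel L k m n u))) b)%N.
Proof.
move=> uT; rewrite /smp_dd; case: b => //=; rewrite -(ltr0n R).
have r0 := sel_pos uT; have := slice_coeffs (l := Ordinal (sel_lt uT)) r0 => -[_ h _ _].
by have := smp_den_real (l := Ordinal (sel_lt uT)) r0 => /= ->.
Qed.

Lemma sum_half (V : zmodType) (F : nat -> bool -> V) T :
  \sum_(0 <= u < T.*2) F u./2 (odd u) = \sum_(0 <= u < T) (F u true + F u false).
Proof.
elim: T => [|T IH]; first by rewrite !big_geq.
rewrite doubleS !big_nat_recr //= IH -addrA; congr (_ + _).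
by rewrite uphalf_double odd_double doubleK addrC.
Qed.

(** The constant is 25 times 4: there are [D ^ 2] samples, and a sample with its choice bit has
    weight at least [1 / (4 * D ^ 2)], as rounding up the number of bits costs at most a factor 2.
    In the index, [u./2] is the sample and [odd u] the choice. *)
Lemma slices_le (v : 'cV[R[i]]_(2 ^ k)) :
  \sum_(l < 2 ^ m) nsq (dotv v (slice l)) <=
  100 * \sum_(0 <= u < (smp_T L k m n).*2)
     (2 ^- (smp_bits L k m n).+1) * nsq (dotv v (crat_mx R (smp_vec L k m n u./2 (odd u)))).
Proof.
set T := smp_T L k m n; set s := smp_bits L k m n.
rewrite (sum_half (fun u b => 2 ^- s.+1 * nsq (dotv v (crat_mx R (smp_vec L k m n u b))))).
pose h l := nsq (dotv v (mirror l)) + nsq (dotv v basis0).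
rewrite (eq_big_nat _ _ (F2 := fun u => 2 ^- s.+1 * h (smp_sel L k m n u))); last first.
  by move=> u /andP[_ uT]; rewrite vec_true // vec_false -mulrDr.
rewrite -mulr_sumr.
have -> : \sum_(0 <= u < T) h (smp_sel L k m n u) = \sum_(0 <= l < 2 ^ m) h l *+ smp_R L k m n l.
  exact: sum_selection.
rewrite big_mkord; set H := \sum_(l < _) _ *+ _.
have H0 : 0 <= H by apply: sumr_ge0 => l _; rewrite mulrn_wge0 // addr_ge0 ?nsq_ge0.
have D2 : 0 < D ^+ 2 by rewrite exprn_gt0.
rewrite -(ler_pM2l D2); apply: (@le_trans _ _ (25 * H)).
  by rewrite !mulr_sumr; apply: ler_sum => l _; apply: slice_mirror.
have [_ s2] := smp_bitsP L k m n; rewrite -/s -/T in s2.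
have T0 : (0 < T)%N by rewrite -(ltr0n R) slice_T.
have p0 : 0 < 2 ^+ s.+1 :> R by rewrite exprn_gt0.
have ps : 2 ^+ s.+1 <= 4 * D ^+ 2 :> R.
  have h2 : (2 ^ s)%:R <= (2 * T)%:R :> R by rewrite ler_nat s2.
  by rewrite exprS; apply: double_le; rewrite -slice_T -natrX -(natrM R 2 T) ler_nat s2.
have : 25 * H * 2 ^+ s.+1 <= 25 * H * (4 * D ^+ 2) by rewrite ler_wpM2l // mulr_ge0.
rewrite -ler_pdivlMr // => /le_trans; apply.
by rewrite factor_100.
Qed.

End Slices.

(** * Kraft inequality *)

Local Open Scope classical_set_scope.
Local Open Scope ring_scope.
Local Open Scope complex_scope.
Local Open Scope sesquilinear_scope.

Section EsumFacts.
Variable R : realType.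
Local Open Scope ereal_scope.

Lemma subset_esum (T : choiceType) (A B : set T) (g : T -> \bar R) :
  A `<=` B -> (forall t, B t -> 0 <= g t) -> \esum_(t in A) g t <= \esum_(t in B) g t.
Proof.
move=> AB g0; rewrite esum_mkcond [leRHS]esum_mkcond; apply: le_esum => t _.
case: ifPn => [|_]; first by rewrite inE => /AB At; rewrite mem_set.
by case: ifPn => // /[!inE]; apply: g0.
Qed.

(** Program transformations enter through this bound: an injective map that lengthens programs by a
    constant compares two probabilities up to a constant factor. *)
Lemma le_esum_inj (S T : choiceType) (A : set S) (B : set T) (f : S -> \bar R)
    (g : T -> \bar R) (e : S -> T) :
  (forall x y, A x -> A y -> e x = e y -> x = y) -> (forall x, A x -> B (e x)) ->
  (forall t, B t -> 0 <= g t) -> (forall x, A x -> f x <= g (e x)) ->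
  \esum_(x in A) f x <= \esum_(t in B) g t.
Proof.
move=> einj eB g0 fg; apply: (@le_trans _ _ (\esum_(x in A) g (e x))); first exact: le_esum.
rewrite -(esum_image _ _ g) => [|x y]; last by rewrite !inE; apply: einj.
by apply: subset_esum => // _ [x Ax <-]; apply: eB.
Qed.

Lemma esumZl (T : choiceType) (A : set T) (f : T -> \bar R) (c : R) : (0 <= c)%R ->
  (forall t, A t -> 0 <= f t) -> \esum_(t in A) (c%:E * f t) = c%:E * \esum_(t in A) f t.
Proof.
move=> c0 f0; rewrite le_eqVlt in c0; case/orP: c0 => [/eqP<-|c0].
  by rewrite mul0e esum1 // => t _; rewrite mul0e.
(* One inequality for all positive factors suffices; the converse is its case for the inverse
   factor. *)
have le (d : R) (h : T -> \bar R) : (0 < d)%R -> (forall t, A t -> 0 <= h t) ->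
    \esum_(t in A) (d%:E * h t) <= d%:E * \esum_(t in A) h t.
  move=> d0 h0; apply: ge_ereal_sup => _ [X [finX XA] <-].
  rewrite fsbig_finite //= big_seq -ge0_sume_distrr => [|t]; last first.
    by rewrite in_fset_set // inE => /XA/h0.
  rewrite -big_seq lee_pmul2l // ?lte_fin //.
  by apply: ereal_sup_ubound; exists X => //; rewrite fsbig_finite.
apply/eqP; rewrite eq_le le //=.
rewrite -lee_pdivlMl //; apply: le_trans (le _ _ _ _); rewrite ?invr_gt0 //.
  by apply: le_esum => t At; rewrite muleA -EFinM mulVf ?mul1e // gt_eqF.
by move=> t At; rewrite mule_ge0 ?lee_fin ?f0 // ltW.
Qed.

Lemma esum_ub (T : choiceType) (A : set T) (f : T -> \bar R) (M : \bar R) :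
  (forall s : seq T, uniq s -> (forall t, t \in s -> A t) -> \sum_(t <- s) f t <= M) ->
  \esum_(t in A) f t <= M.
Proof.
move=> h; apply: ge_ereal_sup => _ [X [finX XA] <-]; rewrite fsbig_finite //=.
by apply: h => // t; rewrite in_fset_set // inE => /XA.
Qed.

Lemma esum_ub_seq (T : choiceType) (A : set T) (f : T -> \bar R) (s : seq T) : uniq s ->
  (forall t, t \in s -> A t) -> (forall t, A t -> 0 <= f t) ->
  \sum_(t <- s) f t <= \esum_(t in A) f t.
Proof.
move=> us sA f0; apply: esum_ge; exists [set` s].
  by split; [exact: finite_seq | move=> t /=; apply: sA].
rewrite fsbig_finite //=.
rewrite (perm_big (fset_set [set` s])) //=; apply: uniq_perm => // t.
by rewrite in_fset_set //; apply/idP/idP; rewrite inE.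
Qed.

Lemma ge_esum1 (T : choiceType) (A : set T) (f : T -> \bar R) t : A t ->
  (forall t, A t -> 0 <= f t) -> f t <= \esum_(t in A) f t.
Proof.
move=> At f0; have := @esum_ub_seq T A f [:: t] isT _ f0.
by rewrite big_seq1; apply => x; rewrite inE => /eqP->.
Qed.

End EsumFacts.

Section Kraft.
Variable R : realType.

Definition prefix_free (S : seq bool -> Prop) : Prop :=
  forall p r, S p -> S (p ++ r) -> r = [::].

(** Induction on the maximal length: if the empty string occurs it is alone; otherwise the strings
    are split by their first bit, and removing that bit doubles all weights. *)
Lemma kraft_seq (s : seq (seq bool)) : uniq s -> prefix_free (fun p => p \in s) ->
  \sum_(p <- s) (2 ^- size p : R) <= 1.
Proof.
have [N] : exists N, all (fun p => size p <= N)%N s.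
  elim: s => [|p s [N IH]]; first by exists 0%N.
  exists (maxn (size p) N); rewrite /= leq_maxl; apply: sub_all IH => q qN.
  by rewrite leq_max qN orbT.
elim: N s => [|N IH] s sN us pf.
  have e p : p \in s -> p = [::] by move=> /(allP sN); rewrite leqn0 => /nilP.
  case: s us sN pf e => [|p [|q s]] us sN pf e; first by rewrite big_nil.
    by rewrite big_seq1 (e p) ?mem_head // expr0 invr1.
  have ep : p = [::] by apply: e; rewrite mem_head.
  have eq : q = [::] by apply: e; rewrite !inE eqxx orbT.
  by move: us; rewrite ep eq.
have [e|ne] := boolP ([::] \in s).
  have ep p : p \in s -> p = [::] by apply: (pf [::] p).
  case: s us {sN pf} e ep => [|p [|q s]] us // e ep.
    by rewrite big_seq1 (ep p) ?mem_head // expr0 invr1.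
  have e0 : p = [::] by apply: ep; rewrite mem_head.
  have e1 : q = [::] by apply: ep; rewrite !inE eqxx orbT.
  by move: us; rewrite e0 e1.
pose sub b := [seq behead p | p <- s & ohead p == Some b].
have subP b p : (p \in sub b) = (b :: p \in s).
  apply/mapP/idP => [[[|c q]]|bp]; rewrite ?mem_filter ?andbF //=.
    by case/andP => /eqP[->] qs ->.
  by exists (b :: p); rewrite ?mem_filter /= ?eqxx.
have hsub b : \sum_(p <- sub b) (2 ^- size p : R) <= 1.
  apply: IH.
  - by apply/allP => p; rewrite subP => /(allP sN).
  - rewrite map_inj_in_uniq ?filter_uniq // => p q; rewrite !mem_filter.
    by case: p q => [|c p] [|d q] //= /andP[/eqP[->] _] /andP[/eqP[->] _] ->.
  by move=> p r; rewrite !subP; apply: (pf (b :: p) r).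
have part b : 2^-1 * \sum_(p <- sub b) (2 ^- size p : R) =
    \sum_(p <- s | ohead p == Some b) 2 ^- size p.
  rewrite big_map big_filter mulr_sumr; apply: eq_bigr => -[|c p] //= _.
  by rewrite exprS invfM.
have -> : \sum_(p <- s) (2 ^- size p : R) =
    2^-1 * \sum_(p <- sub false) 2 ^- size p + 2^-1 * \sum_(p <- sub true) 2 ^- size p.
  rewrite !part (bigID (fun p => ohead p == Some false)) /=; congr (_ + _).
  rewrite big_seq_cond [RHS]big_seq_cond; apply: eq_bigl => -[|[] p] //=.
  by rewrite (negPf ne).
by have := hsub false; have := hsub true; lra.
Qed.

Lemma kraft (S : set (seq bool)) : prefix_free S ->
  (\esum_(p in S) (2 ^- size p : R)%:E <= 1)%E.
Proof.
move=> pf; apply: esum_ub => s us sS; rewrite sumEFin lee_fin; apply: kraft_seq => // p r ps prs.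
by apply: pf; apply: sS; [exact: ps | exact: prs].
Qed.

End Kraft.

(** * Universal probability *)

Section UnivProb.
Variables (R : realType) (U : machine) (z : seq bool).
Local Open Scope ereal_scope.

Definition wt (p : seq bool) : \bar R := (2 ^- size p)%:E.

Lemma wt_ge0 p : 0 <= wt p.
Proof. by rewrite lee_fin invr_ge0 exprn_ge0. Qed.

Lemma univ_prob_ge0 x y : 0 <= univ_prob R U z x y.
Proof. by apply: esum_ge0 => p _; apply: wt_ge0. Qed.

(** A program has at most one output, so distinct [f t] have disjoint sets of programs, and the
    union of these sets is prefix-free. *)
Lemma sum_univ_prob (T : choiceType) (X : set T) (f : T -> seq bool) y :
  (forall s t, X s -> X t -> f s = f t -> s = t) ->
  \esum_(t in X) univ_prob R U z (f t) y <= 1.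
Proof.
move=> finj; rewrite esum_esum => [|t p _ _]; last exact: wt_ge0.
pose S := [set p | exists x, computes U (enc_pair y z) p x].
apply: (@le_trans _ _ (\esum_(p in S) wt p)).
  apply: (@le_esum_inj _ _ _ _ _ _ _ (fun k => k.2)).
  - move=> [t p] [t' p'] /= [Xt c] [Xt' c'] e; rewrite -e in c' *; congr (_, _).
    by apply: finj => //; apply: computes_fun c c'.
  - by move=> [t p] /= [Xt c]; exists (f t).
  - by move=> p _; apply: wt_ge0.
  - by move=> [t p] _; rewrite lexx.
by apply: kraft => p r [x c] [x' c']; have [] := computes_prefix_free c c'.
Qed.

Lemma univ_prob_le1 x y : univ_prob R U z x y <= 1.
Proof.
have := @sum_univ_prob unit [set tt] (fun=> x) y.
rewrite esum_set1 ?univ_prob_ge0 //; apply=> -[] [] _ _ _ //.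
Qed.

Lemma univ_prob_fin x y : univ_prob R U z x y \is a fin_num.
Proof.
rewrite ge0_fin_numE ?univ_prob_ge0 //; apply: le_lt_trans (univ_prob_le1 x y) _.
exact: ltry.
Qed.

Lemma univ_prob_gt0 x y : universal U -> 0 < univ_prob R U z x y.
Proof.
move=> hU; have [p c] := const_program hU (enc_pair y z) x.
apply: (@lt_le_trans _ _ (wt p)); first by rewrite lte_fin invr_gt0 exprn_gt0.
by apply: (@ge_esum1 _ _ _ wt) => // q _; apply: wt_ge0.
Qed.

Lemma univ_prob_transfer x x' y y' i :
  (forall p, computes U (enc_pair y z) p x -> computes U (enc_pair y' z) (i ++ p) x') ->
  (2 ^- size i)%:E * univ_prob R U z x y <= univ_prob R U z x' y'.
Proof.
move=> h; rewrite -esumZl ?invr_ge0 ?exprn_ge0 //.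
apply: (@le_esum_inj _ _ _ _ _ _ _ (fun p => i ++ p)).
- by move=> p q _ _ /eqP; rewrite eqseq_cat // eqxx => /eqP.
- by move=> p /h.
- by move=> p _; apply: wt_ge0.
by move=> p _; rewrite -EFinM size_cat exprD invfM lexx.
Qed.

End UnivProb.

(** * Positive semidefinite matrices and their sums *)

Section ComplexConvergence.
Variable R : realType.

Lemma Re_le_norm (z : R[i]) (e : R) : `|z| < e%:C -> `|complex.Re z| < e /\ `|complex.Im z| < e.
Proof.
rewrite normc_def ltcR; case: z => x y /= h.
have le (u v : R) : `|u| <= Num.sqrt (u ^+ 2 + v ^+ 2).
  by rewrite -sqrtr_sqr ler_wsqrtr // lerDl sqr_ge0.
split; first exact: le_lt_trans (le x y) h.
by apply: le_lt_trans h; rewrite addrC; apply: le.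
Qed.

Lemma norm_lt_Re (z : R[i]) (e : R) : 0 < e -> `|complex.Re z| < e / 2 -> `|complex.Im z| < e / 2 ->
  `|z| < e%:C.
Proof.
move=> e0; rewrite normc_def ltcR; case: z => x y /= hx hy.
rewrite -(ltr_pXn2r (n := 2)) ?nnegrE ?sqrtr_ge0 ?ltW // sqr_sqrtr ?addr_ge0 ?sqr_ge0 //.
rewrite -(real_normK (num_real x)) -(real_normK (num_real y)).
have := normr_ge0 x; have := normr_ge0 y.
by move: `|x| `|y| hx hy => u v hx hy v0 u0; nra.
Qed.

(** Balls of [R[i]] have radii in [R[i]], which are real because they are positive; passing to real
    and imaginary parts brings convergence back to [R]. *)
Lemma cvg_mxP (T : Type) (F : set_system T) (FF : Filter F) p q (f : T -> 'M[R[i]]_(p, q))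
    (L : 'M[R[i]]_(p, q)) :
  f @ F --> L <-> forall i j,
    (fun t => complex.Re (f t i j)) @ F --> complex.Re (L i j) /\
    (fun t => complex.Im (f t i j)) @ F --> complex.Im (L i j).
Proof.
split=> [h i j|h].
  have key (e : R) : 0 < e -> \forall t \near F,
      `|complex.Re (L i j) - complex.Re (f t i j)| < e /\
      `|complex.Im (L i j) - complex.Im (f t i j)| < e.
    move=> e0; have e0' : 0 < e%:C :> R[i] by rewrite ltcR.
    have /cvg_ballP/(_ _ e0') := h; apply: filterS => t [_ /(_ i j)].
    rewrite -ball_normE /= => /Re_le_norm.
    by case: (L i j) (f t i j) => a b [a' b'].
  by split; apply/cvgrPdist_lt => e /key; apply: filterS => t [].
apply/cvg_ballP => e e0.
have eE : e = (complex.Re e)%:C by case: e e0 => a b; rewrite ltcE /= => /andP[/eqP-> _].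
have re0 : 0 < complex.Re e by move: e0; rewrite {1}eE ltcR.
have h2 : 0 < complex.Re e / 2 by rewrite divr_gt0.
have : \forall t \near F, forall ij : 'I_p * 'I_q,
   `|complex.Re (L ij.1 ij.2) - complex.Re (f t ij.1 ij.2)| < complex.Re e / 2 /\
   `|complex.Im (L ij.1 ij.2) - complex.Im (f t ij.1 ij.2)| < complex.Re e / 2.
  apply: filter_forall => -[i j] /=; have [/cvgrPdist_lt h3 /cvgrPdist_lt h4] := h i j.
  by apply: filterS2 (h3 _ h2) (h4 _ h2).
apply: filterS => t ht; split=> // i j; have [] := ht (i, j).
rewrite -ball_normE /= eE /= => hr hi; apply: norm_lt_Re => //;
  by move: hr hi; case: (L i j) (f t i j) => a b [a' b'].
Qed.

Lemma mxtrace_mulE d (M X : 'M[R[i]]_d) : \tr (M *m X) = \sum_i \sum_j M i j * X j i.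
Proof. by apply: eq_bigr => i _; rewrite mxE. Qed.

Lemma Re_sum (I : finType) (G : I -> R[i]) :
  complex.Re (\sum_i G i) = \sum_i complex.Re (G i).
Proof. by rewrite (raddf_sum (@complex.Re R)). Qed.

Lemma cvg_trace (T : Type) (F : set_system T) (FF : Filter F) d (f : T -> 'M[R[i]]_d)
    (L X : 'M[R[i]]_d) :
  f @ F --> L ->
  (fun t => complex.Re (\tr (f t *m X))) @ F --> complex.Re (\tr (L *m X)).
Proof.
move=> /cvg_mxP h.
have E M : complex.Re (\tr (M *m X)) =
    \sum_i \sum_j (complex.Re (M i j) * complex.Re (X j i) - complex.Im (M i j) * complex.Im (X j i)).
  rewrite mxtrace_mulE Re_sum; apply: eq_bigr => i _; rewrite Re_sum; apply: eq_bigr => j _.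
  by case: (M i j) (X j i) => a b [c d'].
rewrite E; under eq_cvg => t do rewrite E.
apply: cvg_big => [|i _]; first exact: add_continuous.
apply: cvg_big => [|j _]; first exact: add_continuous.
have [h1 h2] := h i j.
by apply: cvgB; apply: cvgMl.
Qed.

End ComplexConvergence.

Section Psd.
Variable R : realType.
Local Notation C := (R[i]).

Lemma ge0_ReIm (x : C) : (0 <= x) = (complex.Im x == 0) && (0 <= complex.Re x).
Proof. by rewrite lecE. Qed.

Lemma form_trace d (M : 'M[C]_d) (v : 'cV[C]_d) :
  (v^t* *m M *m v) 0 0 = \tr (M *m (v *m v^t*)).
Proof. by rewrite mulmxA mxtrace_mulC mulmxA trace_mx11. Qed.

Lemma psd_trace d (M : 'M[C]_d) :
  psd M <-> forall v : 'cV[C]_d, 0 <= \tr (M *m (v *m v^t*)).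
Proof. by split=> h v; [rewrite -form_trace | rewrite form_trace]; apply: h. Qed.

Lemma psd_cvg (T : Type) (F : set_system T) (FF : ProperFilter F) d (f : T -> 'M[C]_d)
    (L : 'M[C]_d) : (forall t, psd (f t)) -> f @ F --> L -> psd L.
Proof.
move=> pf h; apply/psd_trace => v; rewrite ge0_ReIm.
(* Multiplication by minus the imaginary unit turns imaginary parts into real parts, so that
   [cvg_trace] also shows that the limit form is real. *)
pose mi : C := 0 +i* (- 1).
have ImE (z : C) : complex.Im z = complex.Re (mi * z).
  by case: z => a b /=; ring.
apply/andP; split; last first.
  have h1 := @cvg_trace R T F (@filter_filter _ _ FF) d f L (v *m v^t*) h.
  apply: (cvgr_to_ge h1); apply: nearW => t.
  by have /psd_trace/(_ v) := pf t; rewrite ge0_ReIm => /andP[].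
have trE (M : 'M[C]_d) : complex.Im (\tr (M *m (v *m v^t*))) =
    complex.Re (\tr (M *m (mi *: (v *m v^t*)))).
  by rewrite -scalemxAr linearZ /= ImE.
rewrite trE.
have h1 := @cvg_trace R T F (@filter_filter _ _ FF) d f L (mi *: (v *m v^t*)) h.
apply/eqP; apply: (cvg_unique (@norm_hausdorff _ _) h1).
rewrite (_ : (fun t => _) = (fun=> 0)); first exact: cvg_cst.
apply/funext => t; rewrite -trE.
by have /psd_trace/(_ v) := pf t; rewrite ge0_ReIm => /andP[/eqP].
Qed.

Lemma psdD d (M N : 'M[C]_d) : psd M -> psd N -> psd (M + N).
Proof. by move=> hM hN v; rewrite mulmxDr mulmxDl mxE addr_ge0. Qed.

Lemma psd0 d : psd (0 : 'M[C]_d).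
Proof. by move=> v; rewrite mulmx0 mul0mx mxE. Qed.

Lemma psdZ d (M : 'M[C]_d) (a : R) : 0 <= a -> psd M -> psd (a%:C *: M).
Proof.
move=> a0 hM v; rewrite -scalemxAr -scalemxAl mxE mulr_ge0 //.
by rewrite lecR.
Qed.

Lemma psd_sum (I : Type) (r : seq I) (P : pred I) d (M : I -> 'M[C]_d) :
  (forall i, P i -> psd (M i)) -> psd (\sum_(i <- r | P i) M i).
Proof. by move=> h; elim/big_ind: _; [exact: psd0 | exact: psdD | exact: h]. Qed.

Lemma trmxC_mul p q r (A : 'M[C]_(p, q)) (B : 'M[C]_(q, r)) : (A *m B)^t* = B^t* *m A^t*.
Proof. by rewrite trmx_mul map_mxM. Qed.

Lemma psd_conj p q (M : 'M[C]_p) (J : 'M[C]_(q, p)) : psd M -> psd (J *m M *m J^t*).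
Proof. by move=> hM v; have := hM (J^t* *m v); rewrite trmxC_mul trmxCK !mulmxA. Qed.

Lemma form_rank1 d (v w : 'cV[C]_d) : (v^t* *m (w *m w^t*) *m v) 0 0 = (nsq (dotv v w))%:C.
Proof.
rewrite mulmxA -mulmxA mxE big_ord1 dotvE -mul_conj_nsq mulrC; congr (_ * _).
have -> : w^t* *m v = (v^t* *m w)^t* by rewrite trmxC_mul trmxCK.
by rewrite !mxE -dotvE mxE.
Qed.

Lemma psd_rank1 d (w : 'cV[C]_d) : psd (w *m w^t*).
Proof. by move=> v; rewrite form_rank1 lecR nsq_ge0. Qed.

Lemma form2 d (M : 'M[C]_d) (i j : 'I_d) (c : C) :
  let v : 'cV[C]_d := delta_mx i 0 + c *: delta_mx j 0 in
  (v^t* *m M *m v) 0 0 = M i i + c * M i j + (c^* * M j i + c^* * c * M j j).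
Proof.
move=> v; have -> : v^t* = delta_mx 0 i + c^* *: delta_mx 0 j.
  apply/matrixP => a b; rewrite !mxE rmorphD rmorphM /=.
  by rewrite ![(_ && (a == 0))]andbC; case: (_ && _); case: (_ && _); rewrite ?conjC0 ?conjC1.
have e a b : (delta_mx 0 a *m M *m delta_mx b 0 : 'M_1) 0 0 = M a b.
  by rewrite -rowE -colE !mxE.
have evD (A B : 'M[C]_1) : (A + B) 0 0 = A 0 0 + B 0 0 by rewrite mxE.
have evZ x (A : 'M[C]_1) : (x *: A) 0 0 = x * A 0 0 by rewrite mxE.
rewrite /v !(mulmxDl, mulmxDr) -!(scalemxAl, scalemxAr) !(evD, evZ) !e.
by ring.
Qed.

(** The form is real at [e_i + c e_j] for [c] equal to 0, 1 and the imaginary unit, which gives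
    linear equations between the two off-diagonal entries. *)
Lemma psd_herm d (M : 'M[C]_d) i j : psd M -> M j i = (M i j)^*.
Proof.
move=> hM.
have real c : complex.Im (M i i + c * M i j + (c^* * M j i + c^* * c * M j j)) = 0.
  by have := hM (delta_mx i 0 + c *: delta_mx j 0); rewrite form2 ge0_ReIm => /andP[/eqP].
have := real 0; have := real 1; have := real (0 +i* 1).
have rjj : complex.Im (M j j) = 0.
  have := hM (delta_mx j 0 + 0 *: delta_mx j 0).
  by rewrite form2 rmorph0 !mul0r !addr0 ge0_ReIm => /andP[/eqP].
move: (M i i) (M j j) (M i j) (M j i) rjj => [a a'] [b b'] [x x'] [y y'] /= -> h1 h2 h3.
by apply/eqP; rewrite eq_complex /=; apply/andP; split; apply/eqP; nra.
Qed.

Lemma deltaC d (i : 'I_d) : (delta_mx i 0 : 'cV[C]_d)^t* = delta_mx 0 i.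
Proof. by apply/matrixP => a b; rewrite !mxE andbC; rewrite rmorph_nat. Qed.

(** From the spectral theorem, with square roots of the eigenvalues absorbed in the vectors. It
    reduces trace pairings and tensor products to rank one matrices. *)
Lemma psd_decomp d (M : 'M[C]_d) : psd M -> exists w : 'I_d -> 'cV[C]_d,
  M = \sum_i w i *m (w i)^t*.
Proof.
move=> hM; have hh : M \is hermsymmx.
  by apply/is_hermitianmxP; rewrite expr0 scale1r; apply/matrixP=> i j; rewrite !mxE; apply: psd_herm.
have /orthomx_spectralP := hermitian_normalmx hh.
set P := spectralmx M; set D := spectral_diag M => ME.
have uP : P \is unitarymx by apply: spectral_unitarymx.
rewrite invmx_unitary // in ME.
have D0 i : 0 <= D 0 i.
  have /(_ (P^t* *m delta_mx i 0)) := hM; rewrite trmxC_mul trmxCK ME.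
  have PP : P *m P^t* = 1%:M by apply/unitarymxP.
  rewrite !mulmxA -[_ *m P *m P^t*]mulmxA PP mulmx1 -[_ *m P *m P^t*]mulmxA PP mulmx1.
  by rewrite deltaC -rowE -colE !mxE eqxx mulr1n.
exists (fun i => P^t* *m (sqrtC (D 0 i) *: delta_mx i 0)).
rewrite {1}ME diag_mx_sum_delta mulmx_sumr mulmx_suml; apply: eq_bigr => i _.
have -> : (P^t* *m (sqrtC (D 0 i) *: delta_mx i 0))^t* =
    (sqrtC (D 0 i))^* *: (delta_mx 0 i *m P) :> 'M_(1, d).
  rewrite trmxC_mul trmxCK scalemxAl -deltaC; congr (_ *m _).
  by apply/matrixP => a b; rewrite !mxE rmorphM.
rewrite -!scalemxAr -!scalemxAl scalerA -!mulmxA; congr (_ *: _).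
  by rewrite mulrC -normCK ger0_norm ?sqrtC_ge0 ?D0 // sqrtCK.
by rewrite [in RHS](mulmxA (delta_mx i 0)) mul_delta_mx.
Qed.

End Psd.

Section PsdTensor.
Variable R : realType.
Local Notation C := (R[i]).

Lemma psd_tr_ge0 d (M X : 'M[C]_d) : psd M -> psd X -> 0 <= \tr (M *m X).
Proof.
move=> /psd_trace hM /psd_decomp[w ->]; rewrite mulmx_sumr raddf_sum sumr_ge0 // => i _.
exact: hM.
Qed.

Lemma psd_tens a b (X : 'M[C]_a) (Y : 'M[C]_b) : psd X -> psd Y -> psd (X *t Y).
Proof.
move=> /psd_decomp[w ->] /psd_decomp[w' ->]; rewrite tensmx_suml; apply: psd_sum => i _.
rewrite tensmx_sumr; apply: psd_sum => j _; rewrite -tensmx_mul.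
have -> : (w i)^t* *t (w' j)^t* = (w i *t w' j)^t* by rewrite trmx_tens map_mxT.
exact: (@psd_rank1 R (a * b)).
Qed.

(** The difference of the tensor squares telescopes into two products of positive factors. A
    domination by [2 ^ S] thus costs [2 ^ (S + S)] for tests. *)
Lemma tens_mono d (nu : 'M[C]_(d * d)) (X Y : 'M[C]_d) : psd nu -> psd X -> psd Y ->
  psd (Y - X) -> \tr (nu *m (X *t X)) <= \tr (nu *m (Y *t Y)).
Proof.
move=> hnu hX hY hYX.
have -> : Y *t Y = X *t X + ((Y - X) *t Y + X *t (Y - X)).
  by apply/matrixP => i j; rewrite !mxE; ring.
rewrite mulmxDr mxtraceD lerDl; apply: psd_tr_ge0 => //.
by apply: psdD; apply: psd_tens.
Qed.

Lemma le_Re (x y : C) : x <= y -> complex.Re x <= complex.Re y.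
Proof. by rewrite lecE => /andP[]. Qed.

End PsdTensor.

#[local] Existing Instance totally_filter.

(** * Unconditional sums of positive semidefinite matrices *)

Section Summation.
Variables (R : realType) (I : choiceType).
Local Notation C := (R[i]).

Lemma partial_sumE (V : zmodType) (f : I -> V) (A : {fset I}) :
  partial_sum f A = \sum_(i <- A) f i.
Proof. by rewrite /partial_sum big_seq_fsetE. Qed.

Lemma partial_sum_sub (g : I -> R) (A B : {fset I}) : (forall i, 0 <= g i) ->
  (A `<=` B)%fset -> partial_sum g A <= partial_sum g B.
Proof.
move=> g0 AB; rewrite !partial_sumE.
have -> : \sum_(i <- A) g i = \sum_(i <- B | i \in A) g i.
  rewrite -[RHS]big_filter; apply/perm_big/uniq_perm; rewrite ?filter_uniq // => i.
  by rewrite mem_filter; case iA: (i \in A) => //=; rewrite (fsubsetP AB) ?iA.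
by rewrite [leRHS](bigID (fun i => i \in A)) /= lerDl sumr_ge0.
Qed.

Lemma total_cvg (g : I -> R) (B : R) : (forall i, 0 <= g i) ->
  (forall A, partial_sum g A <= B) -> exists l : R,
  partial_sum g @ totally --> l /\ (\esum_(i in [set: I]) (g i)%:E = l%:E)%E.
Proof.
move=> g0 gB; set S := (\esum_(i in _) _)%E.
have ub (s : seq I) (M : R) : uniq s -> partial_sum g [fset x in s]%fset <= M ->
    (\sum_(i <- s) (g i)%:E <= M%:E)%E.
  move=> us; rewrite partial_sumE sumEFin lee_fin; apply: le_trans; rewrite le_eqVlt.
  apply/orP; left; apply/eqP/perm_big/uniq_perm => // i; by rewrite !inE.
have SB : (S <= B%:E)%E by apply: esum_ub => s us _; apply: ub.
have S0 : (0 <= S)%E by apply: esum_ge0 => i _; rewrite lee_fin.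
have Sfin : S \is a fin_num by rewrite ge0_fin_numE //; apply: le_lt_trans SB (ltry _).
have le_S A : partial_sum g A <= fine S.
  rewrite -lee_fin fineK // partial_sumE -sumEFin; apply: esum_ub_seq => // i _.
  by rewrite lee_fin.
exists (fine S); split; last by rewrite fineK.
apply/cvgrPdist_lt => e e0.
have [A hA] : exists A, fine S - e < partial_sum g A.
  apply: contrapT => h.
  have : (S <= (fine S - e)%:E)%E.
    apply: esum_ub => s us _; apply: ub => //; rewrite leNgt; apply/negP => hs.
    by apply: h; eexists; exact: hs.
  by rewrite -(fineK Sfin) lee_fin lerBrDr gerDl leNgt e0.
exists A => // A' /= /(partial_sum_sub g0) hA'.
rewrite ger0_norm ?subr_ge0 ?le_S // ltrBlDr -ltrBlDl; exact: lt_le_trans hA hA'.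
Qed.

Lemma total_cvg_esum (g : I -> R) (l : R) : (forall i, 0 <= g i) ->
  partial_sum g @ totally --> l -> (\esum_(i in [set: I]) (g i)%:E = l%:E)%E.
Proof.
move=> g0 gl.
have gB A : partial_sum g A <= l.
  by apply: (cvgr_to_ge gl); exists A => // A'; apply: partial_sum_sub.
have [l' [gl' ->]] := total_cvg g0 gB.
by congr (_%:E); apply: (cvg_unique (@norm_hausdorff _ _) gl' gl).
Qed.

Section PsdSum.
Variables (d : nat) (f : I -> 'M[C]_d).
Hypothesis psdf : forall i, psd (f i).

Lemma Re_tr_partial_sum X A :
  complex.Re (\tr (partial_sum f A *m X)) = partial_sum (fun i => complex.Re (\tr (f i *m X))) A.
Proof. by rewrite /partial_sum mulmx_suml (raddf_sum (@mxtrace _ _)) Re_sum. Qed.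

Lemma psd_partial_sum A : psd (partial_sum f A).
Proof. by apply: psd_sum => i _. Qed.

(** Polarisation: pairing with [pol c a b] evaluates the form at [e_a + c e_b], and the values for
    [c] equal to 1 and the imaginary unit determine all entries of a positive semidefinite
    matrix. *)
Let pol (c : C) (a b : 'I_d) : 'M[C]_d :=
  (delta_mx a 0 + c *: delta_mx b 0) *m (delta_mx a 0 + c *: delta_mx b 0 : 'cV_d)^t*.
Let q c a b (M : 'M[C]_d) : R := complex.Re (\tr (M *m pol c a b)).

Let qE c a b M : q c a b M =
  complex.Re (M a a + c * M a b + (c^* * M b a + c^* * c * M b b)).
Proof. by rewrite /q -form_trace form2. Qed.

Let q_ge0 c a b (M : 'M[C]_d) : psd M -> 0 <= q c a b M.
Proof. by move=> hM; apply: (le_Re (x := 0)); apply: psd_tr_ge0 => //; exact: psd_rank1. Qed.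

Let q1E a M : q 1 a a M = 4 * complex.Re (M a a).
Proof. by rewrite qE rmorph1 !mul1r; case: (M a a) => x y /=; ring. Qed.

Let diag_le a (M : 'M[C]_d) : psd M -> complex.Re (M a a) <= complex.Re (\tr M).
Proof.
move=> hM; rewrite /mxtrace (bigD1 a) //= raddfD /= lerDl (raddf_sum (@complex.Re R)).
by apply: sumr_ge0 => b _; have := q_ge0 1 b b hM; rewrite q1E; nra.
Qed.

(** By the parallelogram identity the values for [c] and [- c] add up to twice the sum of two
    diagonal entries, and both values are nonnegative. *)
Let q_le c a b (M : 'M[C]_d) : psd M -> c^* * c = 1 -> q c a b M <= 4 * complex.Re (\tr M).
Proof.
move=> hM c1; have h : q c a b M + q (- c) a b M = 2 * (complex.Re (M a a) + complex.Re (M b b)).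
  rewrite !qE rmorphN mulrNN c1 !mul1r !mulNr.
  move: (M a a) (c * M a b) => [x1 x2] [y1 y2].
  move: (c^* * M b a) (M b b) => [z1 z2] [t1 t2] /=; ring.
have := q_ge0 (- c) a b hM; have := diag_le a hM; have := diag_le b hM; move: h.
move: (q c a b M) (q _ a b M) (complex.Re (M a a)) (complex.Re (M b b)) (complex.Re (\tr M)).
by move=> x y u v t h hv hu y0; lra.
Qed.

(** Entries of the partial sums need not be monotone, but the polarised forms are sums of
    nonnegative terms bounded by four times the trace. Their limits are recombined into the matrix
    [L]. *)
Lemma psd_sum_cvg (B : R) : (forall A, complex.Re (\tr (partial_sum f A)) <= B) ->
  partial_sum f @ totally --> sum f.
Proof.
move=> trB.
have qlim c a b : c^* * c = 1 -> exists l : R, (fun A => q c a b (partial_sum f A)) @ totally --> l.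
  move=> c1; have [||l [hl _]] := @total_cvg (fun i => q c a b (f i)) (4 * B).
  - by move=> i; apply: q_ge0.
  - move=> A; rewrite -Re_tr_partial_sum; apply: le_trans (q_le _ _ _ c1) _.
      exact: psd_partial_sum.
    by have := trB A; lra.
  exists l; rewrite (_ : (fun A => _) = partial_sum (fun i => q c a b (f i))) //.
  by apply/funext => A; apply: Re_tr_partial_sum.
have c1 : (1 : C)^* * 1 = 1 by rewrite rmorph1 mulr1.
have ci : (0 +i* 1 : C)^* * (0 +i* 1) = 1.
  by apply/eqP; rewrite eq_complex /=; apply/andP; split; apply/eqP; ring.
have /choice[l1 hl1] : forall ab, exists l : R,
    (fun A => q 1 ab.1 ab.2 (partial_sum f A)) @ totally --> l by move=> ab; apply: qlim.
have /choice[li hli] : forall ab, exists l : R,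
    (fun A => q (0 +i* 1) ab.1 ab.2 (partial_sum f A)) @ totally --> l by move=> ab; apply: qlim.
pose L : 'M[C]_d := \matrix_(a, b)
   (2^-1 * (l1 (a, b) - 4^-1 * l1 (a, a) - 4^-1 * l1 (b, b)) +i*
    (2^-1 * (4^-1 * l1 (a, a) + 4^-1 * l1 (b, b) - li (a, b)))).
have ReE a b (M : 'M[C]_d) : psd M -> complex.Re (M a b) =
    2^-1 * (q 1 a b M - 4^-1 * q 1 a a M - 4^-1 * q 1 b b M).
  move=> hM; rewrite !q1E qE rmorph1 !mul1r (psd_herm a b hM).
  by case: (M a a) (M a b) (M b b) => [x1 x2] [y1 y2] [z1 z2] /=; field.
have ImE a b (M : 'M[C]_d) : psd M -> complex.Im (M a b) =
    2^-1 * (4^-1 * q 1 a a M + 4^-1 * q 1 b b M - q (0 +i* 1) a b M).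
  move=> hM; rewrite !q1E qE ci !mul1r (psd_herm a b hM).
  by case: (M a a) (M a b) (M b b) => [x1 x2] [y1 y2] [z1 z2] /=; field.
suff hL : partial_sum f @ totally --> L by rewrite /sum (cvg_lim (@norm_hausdorff _ _) hL).
apply/cvg_mxP => a b; rewrite mxE /=; split.
  under eq_cvg => A do rewrite (ReE _ _ _ (psd_partial_sum A)).
  by apply: cvgMr; apply: cvgB; [apply: cvgB|]; [exact: (hl1 (a, b)) | |]; apply: cvgMr;
    [exact: (hl1 (a, a)) | exact: (hl1 (b, b))].
under eq_cvg => A do rewrite (ImE _ _ _ (psd_partial_sum A)).
by apply: cvgMr; apply: cvgB; [apply: cvgD|]; [| | exact: (hli (a, b))]; apply: cvgMr;
  [exact: (hl1 (a, a)) | exact: (hl1 (b, b))].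
Qed.

Lemma psd_sum_psd B : (forall A, complex.Re (\tr (partial_sum f A)) <= B) -> psd (sum f).
Proof. by move=> /psd_sum_cvg h; apply: (@psd_cvg R _ _ totally_filter _ _ _ psd_partial_sum h). Qed.

Lemma psd_sum_tr B X : (forall A, complex.Re (\tr (partial_sum f A)) <= B) ->
  (forall i, 0 <= complex.Re (\tr (f i *m X))) ->
  ((complex.Re (\tr (sum f *m X)))%:E = \esum_(i in [set: I]) (complex.Re (\tr (f i *m X)))%:E)%E.
Proof.
move=> /psd_sum_cvg h X0; apply/esym/total_cvg_esum => //.
have := @cvg_trace R _ _ (@filter_filter _ _ totally_filter) d _ _ X h.
by under eq_cvg => A do rewrite Re_tr_partial_sum.
Qed.

End PsdSum.
End Summation.

(** * The universal semi-density matrix *)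

Fixpoint bits_of (s u : nat) : seq bool :=
  if s is s'.+1 then rcons (bits_of s' u./2) (odd u) else [::].

Lemma size_bits_of s u : size (bits_of s u) = s.
Proof. by elim: s u => //= s IH u; rewrite size_rcons IH. Qed.

Lemma bits_ofK s u : (u < 2 ^ s)%N -> bits_val 0 (bits_of s u) = u.
Proof.
elim: s u => [|s IH] u; first by rewrite ltnS leqn0 => /eqP->.
rewrite expnS mul2n => us.
by rewrite /bits_val /= foldl_rcons -/(bits_val 0 _) IH ?ltn_half_double //; lia.
Qed.

Section QuadraticForm.
Variable R : realType.
Local Notation C := (R[i]).

Definition qform d (M : 'M[C]_d) (v : 'cV[C]_d) : R := complex.Re (\tr (M *m (v *m v^t*))).

Lemma qform_rank1 d (v w : 'cV[C]_d) : qform (w *m w^t*) v = nsq (dotv v w).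
Proof. by rewrite /qform -form_trace form_rank1. Qed.

Lemma qformZ d (a : R) (M : 'M[C]_d) v : qform (a%:C *: M) v = a * qform M v.
Proof. by rewrite /qform -scalemxAl mxtraceZ; case: (\tr _) => x y /=; ring. Qed.

Lemma qform_ge0 d (M : 'M[C]_d) v : psd M -> 0 <= qform M v.
Proof. by move=> hM; apply: (le_Re (x := 0)); apply: psd_tr_ge0 => //; exact: psd_rank1. Qed.

Lemma psd_sub_qform d (X Y : 'M[C]_d) : psd X -> psd Y ->
  (forall v, qform X v <= qform Y v) -> psd (Y - X).
Proof.
move=> /psd_trace hX /psd_trace hY le; apply/psd_trace => v.
rewrite mulmxBl raddfB /= subr_ge0.
have := hX v; have := hY v; have := le v; rewrite /qform.
case: (\tr (X *m _)) (\tr (Y *m _)) => x x' [y y']; rewrite !lecE /= => ->.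
by move=> /andP[/eqP-> _] /andP[/eqP-> _]; rewrite eqxx.
Qed.

Lemma emb_conj m n l : (emb C m n l)^t* = (emb C m n l)^T.
Proof. by apply/matrixP => i j; rewrite !mxE rmorph_nat. Qed.

Lemma psd_reduce m n (M : 'M[C]_(2 ^ n)) : psd M -> psd (reduce m M).
Proof.
move=> hM; apply: psd_sum => l _.
by have := psd_conj ((emb C m n l)^t*) hM; rewrite trmxCK emb_conj.
Qed.

Lemma qform_reduce m n (M : 'M[C]_(2 ^ n)) v :
  qform (reduce m M) v = \sum_(l < 2 ^ m) qform M (emb C m n l *m v).
Proof.
rewrite /qform /reduce mulmx_suml (raddf_sum (@mxtrace _ _)) Re_sum; apply: eq_bigr => l _.
congr (complex.Re _).
by rewrite trmxC_mul emb_conj /= -!mulmxA mxtrace_mulC -!mulmxA.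
Qed.

Lemma dotv_emb m n l (v : 'cV[C]_(2 ^ (n - m))) w :
  dotv (emb C m n l *m v) w = dotv v ((emb C m n l)^T *m w).
Proof. by rewrite -!dotvE trmxC_mul emb_conj mulmxA. Qed.

End QuadraticForm.

Section Mu.
Variables (R : realType) (U : machine) (z : seq bool) (k : nat).
Local Notation C := (R[i]).
Local Notation mu := (univ_semi_density R U z k).
Local Notation El := [set phi : 'cV[rat[i]]_(2 ^ k) | elementary_state R phi].
Local Notation pr phi := (univ_prob R U z (enc_mx phi) (enc_nat k)).

Let w (phi : 'cV[rat[i]]_(2 ^ k)) : R := if `[< elementary_state R phi >] then fine (pr phi) else 0.

Let in_El phi : (phi \in El) = `[< elementary_state R phi >]. Proof. by []. Qed.

Let w_ge0 phi : 0 <= w phi.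
Proof. by rewrite /w; case: asboolP => // _; rewrite fine_ge0 // univ_prob_ge0. Qed.

Let psd_term phi : psd ((w phi)%:C *: (crat_mx R phi *m (crat_mx R phi)^t*)).
Proof. by apply: psdZ => //; apply: psd_rank1. Qed.

Lemma sum_mu_weights : (\esum_(phi in El) pr phi <= 1)%E.
Proof. by apply: sum_univ_prob => s t _ _; apply: enc_mx_inj. Qed.

Let trB A : complex.Re (\tr (partial_sum
  (fun phi => (w phi)%:C *: (crat_mx R phi *m (crat_mx R phi)^t*)) A)) <= 1.
Proof.
rewrite -[partial_sum _ A]mulmx1 Re_tr_partial_sum partial_sumE.
have e phi : complex.Re (\tr ((w phi)%:C *: (crat_mx R phi *m (crat_mx R phi)^t*) *m 1%:M)) = w phi.
  rewrite mulmx1 mxtraceZ mxtrace_mulC /w; case: asboolP => [->|_]; last by rewrite mul0r.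
  by rewrite mxtrace1 mulr1.
under eq_bigr => phi _ do rewrite e.
rewrite -lee_fin -sumEFin; apply: le_trans sum_mu_weights; rewrite esum_mkcond.
apply: le_trans (@esum_ub_seq _ _ _ _ (A : seq _) _ _ _) => //.
  apply: lee_sum => phi _; rewrite /w in_El; case: asboolP => // _.
  by rewrite fineK ?univ_prob_fin.
by move=> phi _; case: ifP => // _; apply: univ_prob_ge0.
Qed.

Lemma psd_mu : psd mu.
Proof. exact: (psd_sum_psd psd_term trB). Qed.

Lemma qform_mu v :
  ((qform mu v)%:E = \esum_(phi in El) (pr phi * (nsq (dotv v (crat_mx R phi)))%:E))%E.
Proof.
rewrite /qform (psd_sum_tr psd_term trB) => [|phi]; last exact: qform_ge0.
rewrite [RHS]esum_mkcond; apply: eq_esum => phi _; rewrite -/(qform _ v) qformZ qform_rank1.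
rewrite /w in_El; case: asboolP => _; last by rewrite mul0r.
by rewrite EFinM fineK ?univ_prob_fin.
Qed.

End Mu.

(** [2 ^ 7] is the first power of 2 above the constant 100 of [slices_le]; [i], [p] and [s] will be
    the lengths of the three pieces of the sampling program. *)
Lemma factor_128 (R : realType) (i p s : nat) (N : R) : 0 <= N ->
  100 * (2 ^- s * N) * 2 ^- p <= 2 ^+ (7 + i) * N * 2 ^- (i + (p + s)).
Proof.
move=> N0; have -> : 2 ^+ (7 + i) * N * 2 ^- (i + (p + s)) = 128 * (2 ^- s * N) * 2 ^- p.
  have two j : 2 ^+ j != 0 :> R by rewrite expf_neq0.
  rewrite !exprD; have := (two i, two p, two s).
  move: (2 ^+ i : R) (2 ^+ p : R) (2 ^+ s : R) => x y t [[x0 y0] t0].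
  by field; apply/and3P.
rewrite ler_wpM2r ?invr_ge0 ?exprn_ge0 // ler_wpM2r ?ler_nat //.
by rewrite mulr_ge0 ?invr_ge0 ?exprn_ge0.
Qed.

(** Of two halting programs that begin the same string, the shorter is a prefix of the longer and
    hence equal to it, so the string can be cut in only one place. *)
Lemma eq_cat_computes M y p p' r r' x x' : computes M y p x -> computes M y p' x' ->
  p ++ r = p' ++ r' -> [/\ p = p', x = x' & r = r'].
Proof.
have key q q' s s' t t' : (size q <= size q')%N -> computes M y q t -> computes M y q' t' ->
    q ++ s = q' ++ s' -> [/\ q = q', t = t' & s = s'].
  move=> sz c c' e; have pq : q' = q ++ drop (size q) q'.
    have := congr1 (take (size q)) e; rewrite take_size_cat // take_cat.
    case: ltnP => [_ eq|sz' ]; first by rewrite {1}eq cat_take_drop.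
    have -> : size q = size q' by apply/eqP; rewrite eqn_leq sz.
    by rewrite subnn take0 cats0 drop_size cats0.
  rewrite pq in c'; have [d0 tt'] := computes_prefix_free c c'.
  by move: e; rewrite pq d0 cats0 => /eqP; rewrite eqseq_cat // eqxx => /eqP ->.
move=> c c' e; case/orP: (leq_total (size p) (size p')) => sz; first exact: key sz c c' e.
by have [-> -> ->] := key _ _ _ _ _ _ sz c' c (esym e).
Qed.

(** * Domination of the reduced universal matrix *)

Section ReduceMu.
Variables (R : realType) (U : machine).
Local Notation C := (R[i]).
Local Notation El k := [set phi : 'cV[rat[i]]_(2 ^ k) | elementary_state R phi].
Local Notation prog k z := (fun phi => [set p | computes U (enc_pair (enc_nat k) z) p (enc_mx phi)]).

(** Splitting each state into its programs turns both sides of the comparison into sums over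
    programs, which an injection can compare. *)
Lemma qform_mu_prog z k (v : 'cV[C]_(2 ^ k)) (a : R) : 0 <= a ->
  ((a * qform (univ_semi_density R U z k) v)%:E =
   \esum_(x in El k `*`` prog k z) (a * nsq (dotv v (crat_mx R x.1)) * 2 ^- size x.2)%:E)%E.
Proof.
move=> a0; have N0 phi : 0 <= nsq (dotv v (crat_mx R phi)) by apply: nsq_ge0.
rewrite EFinM qform_mu -esumZl //; last first.
  by move=> phi _; rewrite mule_ge0 ?univ_prob_ge0 ?lee_fin.
transitivity (\esum_(phi in El k) \esum_(p in prog k z phi)
    (a * nsq (dotv v (crat_mx R phi)) * 2 ^- size p)%:E)%E.
  apply: eq_esum => phi _; by rewrite muleA muleAC -EFinM -esumZl ?mulr_ge0.
by apply: esum_esum => phi p _ _; rewrite lee_fin !mulr_ge0 ?invr_ge0 ?exprn_ge0.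
Qed.

Lemma le_sum_esum (N : nat) (g : nat -> R) : (forall u, 0 <= g u) ->
  ((\sum_(0 <= u < N) g u)%:E <= \esum_(u in [set u | (u < N)%N]) (g u)%:E)%E.
Proof.
move=> g0; rewrite -sumEFin; apply: esum_ub_seq; rewrite ?iota_uniq // => u.
  by rewrite mem_index_iota.
by rewrite lee_fin.
Qed.

Lemma reduce_mu_le : universal U -> exists S : nat, forall m n (mn : (m < n)%N) v,
  qform (reduce m (univ_semi_density R U (zz m n) n)) v <=
  2 ^+ S * qform (univ_semi_density R U (zz m n) (n - m)) v.
Proof.
move=> hU; have [i hi] := sample_vec hU.
exists (7 + size i)%N => m n mn v; set z := zz m n; set k := (n - m)%N.
pose cd (phi : 'cV[rat[i]]_(2 ^ n)) := foldl push 0%N (mxints phi).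
pose s phi := smp_bits (cd phi) k m n; pose T phi := smp_T (cd phi) k m n.
pose vec phi u := smp_vec (cd phi) k m n u./2 (odd u).
pose g phi u : R := 2 ^- (s phi).+1 * nsq (dotv v (crat_mx R (vec phi u))).
have g0 phi u : 0 <= g phi u by rewrite mulr_ge0 ?nsq_ge0 ?invr_ge0 ?exprn_ge0.
rewrite -lee_fin qform_mu_prog ?exprn_ge0 //.
have -> : ((qform (reduce m (univ_semi_density R U z n)) v)%:E = \esum_(x in El n `*`` prog n z)
    (\sum_(l < 2 ^ m) nsq (dotv v (@slice R m n x.1 l)) * 2 ^- size x.2)%:E)%E.
  rewrite qform_reduce -sumEFin.
  under eq_bigr => l _ do rewrite -[qform _ _]mul1r qform_mu_prog //.
  rewrite -esum_sum => [|x l _ _]; last by rewrite lee_fin mul1r mulr_ge0 ?nsq_ge0 ?invr_ge0 ?exprn_ge0.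
  apply: eq_esum => x _; rewrite -sumEFin; apply: eq_bigr => l _.
  by rewrite mul1r dotv_emb.
have t0 phi u (p : seq bool) : 0 <= 100 * g phi u * 2 ^- size p :> R.
  by apply: mulr_ge0; [apply: mulr_ge0 | rewrite invr_ge0 exprn_ge0].
(* Each state trades its slices for its samples, at the price of the factor 100. *)
apply: (@le_trans _ _ (\esum_(x in El n `*`` prog n z) \esum_(u in [set u | (u < (T x.1).*2)%N])
    (100 * g x.1 u * 2 ^- size x.2)%:E)%E).
  apply: le_esum => -[phi p] [/= phi1 cp]; apply: le_trans (le_sum_esum _ (t0 phi ^~ p)).
  rewrite lee_fin -mulr_suml -[leRHS]mulr_suml -mulr_sumr ler_wpM2r ?invr_ge0 ?exprn_ge0 //.
  exact: slices_le.
rewrite esum_esum => [|x u _ _]; last by rewrite lee_fin.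
have bK phi u : (u < (T phi).*2)%N -> bits_val 0 (bits_of (s phi) u./2) = u./2.
  by move=> uT; apply: bits_ofK; apply: leq_trans (smp_bitsP (cd phi) k m n).1; rewrite ltn_half_double.
(* A state, a program of it and a sample are sent to the sampled state and the program that prints
   it. *)
apply: (@le_esum_inj _ _ _ _ _ _ _ (fun xu : _ * nat =>
    (vec xu.1.1 xu.2, i ++ xu.1.2 ++ bits_of (s xu.1.1) xu.2./2 ++ [:: odd xu.2]))).
- move=> [[phi p] u] [[phi' p'] u'] /= [/= [/= e1 c] uT] [/= [/= e1' c'] uT'] [_ /eqP].
  (* The program is decoded from left to right: [p] by prefix-freeness, then [phi] as its output,
     then the bits, whose number depends on [phi]. *)
  rewrite eqseq_cat // eqxx /= => /eqP /(eq_cat_computes c c')[-> /enc_mx_inj e] .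
  rewrite -e in uT' *; move=> /eqP; rewrite eqseq_cat ?size_bits_of // => /andP[/eqP eb /eqP[eo]].
  have h : u./2 = u'./2 by rewrite -(bK _ _ uT) eb (bK _ _ uT').
  by congr (_, _, _); rewrite -[u]odd_double_half -[u']odd_double_half eo h.
- move=> [[phi p] u] [/= [/= e1 c] uT] /=; split=> /=.
    by apply: vec_elementary; rewrite // ltn_half_double.
  have uT2 : (u./2 < T phi)%N by rewrite ltn_half_double.
  have := hi m n k p phi (bits_of (s phi) u./2) (odd u); rewrite /= bK //; apply=> //.
    exact: size_bits_of.
  exact: (dd_gt0 R mn _ uT2).
- move=> x _; rewrite lee_fin; apply: mulr_ge0; last by rewrite invr_ge0 exprn_ge0.
  by apply: mulr_ge0; rewrite ?nsq_ge0 ?exprn_ge0.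
move=> [[phi p] u] /= _; rewrite lee_fin !size_cat size_bits_of addn1.
exact: factor_128 (nsq_ge0 _).
Qed.

End ReduceMu.

(** * Sums of tests *)

Section MuBound.
Variables (R : realType) (U : machine) (z : seq bool) (k : nat).
Hypothesis hU : universal U.
Local Notation C := (R[i]).
Local Notation mu := (univ_semi_density R U z k).

Lemma crat_delta (i : 'I_(2 ^ k)) : crat_mx R (delta_mx i 0 : 'cV_(2 ^ k)) = delta_mx i 0.
Proof.
apply/matrixP => a b; rewrite !mxE; case: (_ && _); rewrite /= ?rmorph0 ?rmorph1 //.
Qed.

(** Every basis vector is elementary and has positive probability, so [mu] is positive definite. [K]
    may depend on [k]: it serves the convergence of the sum of tests and does not enter the final
    constant. *)
Lemma one_le_mu : exists2 K : R, 0 <= K & psd (K%:C *: mu - 1%:M).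
Proof.
pose e i : 'cV[rat[i]]_(2 ^ k) := delta_mx i 0.
pose l i : R := fine (univ_prob R U z (enc_mx (e i)) (enc_nat k)).
have l0 i : 0 < l i by rewrite fine_gt0 // univ_prob_gt0 //= ltey_eq univ_prob_fin.
have li (v : 'cV[C]_(2 ^ k)) i : l i * nsq (v i 0) <= qform mu v.
  have dv : dotv v (crat_mx R (e i)) = (v i 0)^*.
    rewrite crat_delta /dotv (bigD1 i) //= big1 => [|j ji]; rewrite !mxE.
      by rewrite !eqxx mulr1 addr0.
    by rewrite (negPf ji) mulr0.
  have nv : nsq (v i 0)^* = nsq (v i 0) by case: (v i 0) => x y; rewrite /nsq /= sqrrN.
  rewrite -lee_fin qform_mu -nv -dv EFinM fineK ?univ_prob_fin //.
  pose F phi := (univ_prob R U z (enc_mx phi) (enc_nat k) * (nsq (dotv v (crat_mx R phi)))%:E)%E.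
  apply: (@ge_esum1 _ _ _ F (e i)) => [|phi _] /=; last first.
    by rewrite mule_ge0 ?univ_prob_ge0 // lee_fin nsq_ge0.
  rewrite /elementary_state crat_delta deltaC mul_delta_mx; apply/matrixP => a b.
  by rewrite !ord1 !mxE eqxx.
exists (\sum_i (l i)^-1); first by apply: sumr_ge0 => i _; rewrite invr_ge0 ltW.
apply: psd_sub_qform.
- move=> v; rewrite mulmx1 dotvE dotv_self lecR sumr_ge0 // => i _; exact: nsq_ge0.
- apply: psdZ; last exact: psd_mu.
  by apply: sumr_ge0 => i _; rewrite invr_ge0 ltW.
move=> v; rewrite qformZ mulr_suml /qform -form_trace mulmx1 dotvE dotv_self /=.
by apply: ler_sum => i _; rewrite ler_pdivlMl.
Qed.

End MuBound.

(** * Programs that lower compute a matrix *)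

Lemma stream_eq r c (u u' : nat -> 'M[rat[i]]_(r, c)) a n n' :
  prefix (flatten [seq enc_mx (u j) | j <- iota a n])
         (flatten [seq enc_mx (u' j) | j <- iota a n']) ->
  forall j, (a <= j < a + n)%N -> u j = u' j.
Proof.
elim: n n' a => [|n IH] n' a; first by move=> _ j; rewrite addn0; case: ltngtP.
case: n' => [|n'] /prefixP[s] /=.
  by have := enc_mx_neq0 (u a); case: (enc_mx (u a)).
rewrite -catA => /esym/enc_mx_cat[ua e] j.
rewrite leq_eqVlt => /andP[/orP[/eqP<-|aj] jn] //.
by apply: (IH n' a.+1); [rewrite -e prefix_prefix | rewrite aj addSnnS].
Qed.

Section LowerComputes.
Variables (R : realType) (U : machine) (z : seq bool).

Lemma psd_lower_computes d q (nu : 'M[R[i]]_d) : lower_computes U z q nu -> psd nu.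
Proof. by move=> [u [_ pu _ lim]]; apply: (@psd_cvg R _ _ eventually_filter _ _ _ pu lim). Qed.

(** Matrix codes of a given shape are self-delimiting, so the output stream determines the
    approximations and with them the limit. Weights of different matrices therefore come from
    disjoint sets of programs. *)
Lemma lower_computes_fun d q (nu nu' : 'M[R[i]]_d) :
  lower_computes U z q nu -> lower_computes U z q nu' -> nu = nu'.
Proof.
move=> [u [hu _ _ lim]] [u' [hu' _ _ lim']].
have uu : u = u'.
  apply/funext => j; pose N := j.+1.
  have /hu/hu'[N' h] : exists N, prefix (flatten [seq enc_mx (u j) | j <- iota 0 j.+1])
    (flatten [seq enc_mx (u j) | j <- iota 0 N]) by exists N; apply: prefix_refl.
  by apply: (stream_eq h); rewrite add0n ltnSn.
rewrite -uu in lim'; exact: (cvg_unique (@norm_hausdorff _ _) lim lim').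
Qed.

Lemma mx_prob_ge0 d (nu : 'M[R[i]]_d) x : (0 <= mx_prob U z nu x)%E.
Proof. by apply: esum_ge0 => q _; apply: univ_prob_ge0. Qed.

Lemma sum_mx_prob d (X : set 'M[R[i]]_d) x : (\esum_(nu in X) mx_prob U z nu x <= 1)%E.
Proof.
rewrite esum_esum => [|nu q _ _]; last exact: univ_prob_ge0.
apply: le_trans (@sum_univ_prob R U z _ setT id x _) => //.
apply: (@le_esum_inj _ _ _ _ _ _ _ (fun p => p.2)) => //.
- by move=> [nu q] [nu' q'] /= [_ h] [_ h'] e; rewrite -e in h' *; rewrite (lower_computes_fun h h').
- by move=> q _; apply: univ_prob_ge0.
Qed.

Lemma mx_prob_fin d (nu : 'M[R[i]]_d) x : mx_prob U z nu x \is a fin_num.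
Proof.
rewrite ge0_fin_numE ?mx_prob_ge0 //; apply: le_lt_trans (ltry 1).
by have := sum_mx_prob [set nu] x; rewrite esum_set1 ?mx_prob_ge0.
Qed.

End LowerComputes.

Lemma tens1 (F : comNzRingType) a b : (1%:M : 'M[F]_a) *t (1%:M : 'M[F]_b) = 1%:M.
Proof.
apply/matrixP => i j; case: (mxtens_indexP i) => i0 i1; case: (mxtens_indexP j) => j0 j1.
rewrite tensmxE !mxE -natrM mulnb (inj_eq (can_inj (@mxtens_indexK _ _))) xpair_eqE.
by [].
Qed.

Section TestSum.
Variables (R : realType) (U : machine) (z : seq bool) (d : nat).
Local Notation C := (R[i]).
Variables (mu : 'M[C]_d) (K : R).
Hypotheses (K0 : 0 <= K) (psd_mu : psd mu) (mu1 : psd (K%:C *: mu - 1%:M)).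
Local Notation tests := (tensor_tests U z mu mu).

Let w nu : R := if `[< tests nu >] then fine (mx_prob U z nu [::]) else 0.

Let in_tests nu : (nu \in tests) = `[< tests nu >]. Proof. by []. Qed.

Let w_ge0 nu : 0 <= w nu.
Proof. by rewrite /w; case: asboolP => // _; rewrite fine_ge0 // mx_prob_ge0. Qed.

Let psd_term nu : psd ((w nu)%:C *: nu).
Proof.
rewrite /w; case: asboolP => [[[q hq] _ _]|_]; last by rewrite scale0r; apply: psd0.
by apply: psdZ; [rewrite fine_ge0 ?mx_prob_ge0 | apply: psd_lower_computes hq].
Qed.

(** The trace is the pairing with the identity, and the domination of [1%:M] by [K%:C *: mu] in both
    factors bounds it by [K ^ 2] times the pairing with [mu *t mu]. *)
Lemma test_trace nu : tests nu -> complex.Re (\tr nu) <= K ^+ 2.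
Proof.
move=> [[q /psd_lower_computes hnu] _ tr1].
have psd1 : psd (1%:M : 'M[C]_d).
  by move=> v; rewrite mulmx1 dotvE dotv_self lecR sumr_ge0 // => i _; apply: nsq_ge0.
have := tens_mono hnu psd1 (psdZ K0 psd_mu) mu1.
rewrite tens1 mulmx1.
have -> : (K%:C *: mu) *t (K%:C *: mu) = (K ^+ 2)%:C *: (mu *t mu).
  by apply/matrixP => i j; rewrite !mxE rmorphXn /=; ring.
rewrite -scalemxAr mxtraceZ => /le_trans/(_ (ler_wpM2l _ tr1)).
rewrite mulr1 => /(_ _)/le_Re; apply; by rewrite lecR sqr_ge0.
Qed.

Let trB A : complex.Re (\tr (partial_sum (fun nu => (w nu)%:C *: nu) A)) <= K ^+ 2.
Proof.
have wK nu : complex.Re (\tr ((w nu)%:C *: nu *m 1%:M)) <= w nu * K ^+ 2.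
  rewrite mulmx1 mxtraceZ (_ : complex.Re _ = w nu * complex.Re (\tr nu)); last first.
    by case: (\tr nu) => x y /=; ring.
  rewrite /w; case: asboolP => h; last by rewrite !mul0r.
  by rewrite ler_wpM2l ?test_trace // fine_ge0 // mx_prob_ge0.
rewrite -[partial_sum _ A]mulmx1 Re_tr_partial_sum partial_sumE.
apply: le_trans (ler_sum _ (fun nu _ => wK nu)) _; rewrite -mulr_suml ler_piMl ?sqr_ge0 //.
rewrite -lee_fin -sumEFin; apply: le_trans (sum_mx_prob U z tests [::]); rewrite esum_mkcond.
apply: le_trans (@esum_ub_seq _ _ _ _ (A : seq _) _ _ _) => //.
  apply: lee_sum => nu _; rewrite /w in_tests; case: asboolP => // _.
  by rewrite fineK ?mx_prob_fin.
by move=> nu _; case: ifP => // _; apply: mx_prob_ge0.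
Qed.

Lemma tr_test_sum X : (forall nu, tests nu -> 0 <= complex.Re (\tr (nu *m X))) ->
  ((complex.Re (\tr (tensor_test_sum U z mu mu *m X)))%:E =
   \esum_(nu in tests) (mx_prob U z nu [::] * (complex.Re (\tr (nu *m X)))%:E))%E.
Proof.
move=> X0.
have e nu : complex.Re (\tr ((w nu)%:C *: nu *m X)) = w nu * complex.Re (\tr (nu *m X)).
  by rewrite -scalemxAl mxtraceZ; case: (\tr _) => x y /=; ring.
rewrite (psd_sum_tr psd_term trB) => [|nu]; last first.
  rewrite e /w; case: asboolP => h; last by rewrite mul0r.
  by rewrite mulr_ge0 ?X0 // fine_ge0 // mx_prob_ge0.
rewrite [RHS]esum_mkcond; apply: eq_esum => nu _; rewrite e.
rewrite /w in_tests; case: asboolP => _; last by rewrite mul0r.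
by rewrite EFinM fineK ?mx_prob_fin.
Qed.

End TestSum.

Lemma log2_le (R : realType) (N : nat) (x y : R) : x <= 2 ^+ N * y ->
  (log2 x <= log2 y + N%:R%:E)%E.
Proof.
have l2 : 0 < (ln 2)^-1 :> R by rewrite invr_gt0 ln_gt0 // ltr1n.
(* A nonpositive [x] has logarithm [-oo], so nothing is asked of [y] in that case. *)
move=> xy; rewrite /log2; have [x0|x0] := leP x 0.
  by rewrite le0_lneNy ?lee_fin // gt0_mulNye ?lte_fin // leNye.
have y0 : 0 < y by rewrite -(pmulr_rgt0 _ (exprn_gt0 N (ltr0Sn R 1))); apply: lt_le_trans xy.
rewrite !lne_EFin // -!EFinM -EFinD lee_fin.
have -> : ln y / ln 2 + N%:R = (ln y + ln 2 *+ N) / ln 2.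
  by rewrite mulrDl -[ln 2 *+ N]mulr_natr mulrAC mulfV ?mul1r // gt_eqF // -invr_gt0.
rewrite ler_pM2r // -lnXn ?ltr0n // -lnM ?posrE ?exprn_gt0 ?ltr0n // ler_ln ?posrE //.
  by rewrite mulrC.
by rewrite mulr_gt0 ?exprn_gt0 ?ltr0n.
Qed.

(** * Lifting of lower computable matrices *)

Section LiftTests.
Variables (R : realType) (m n : nat).
Hypothesis mn : (m < n)%N.
Local Notation C := (R[i]).
Local Notation k := (n - m)%N.

Lemma emb2_conj (l l' : nat) : (emb2 C m n l l')^t* = (emb2 C m n l l')^T.
Proof. by apply/matrixP => i j; rewrite !mxE rmorphM !rmorph_nat. Qed.

Lemma psd_ext (nu : 'M[C]_(2 ^ k * 2 ^ k)) : psd nu -> psd (ext nu).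
Proof.
move=> h; apply: psd_sum => l _; apply: psd_sum => l' _.
by rewrite -emb2_conj; apply: psd_conj.
Qed.

Lemma ext_sub (A B : 'M[C]_(2 ^ k * 2 ^ k)) : ext A - ext B = ext (A - B).
Proof. by apply/matrixP => i j; rewrite !mxE !(ext_entry mn) !mxE mulrBr. Qed.

Lemma cvg_ext (T : Type) (F : set_system T) (FF : Filter F) (a : R)
    (f : T -> 'M[C]_(2 ^ k * 2 ^ k)) (nu : 'M[C]_(2 ^ k * 2 ^ k)) :
  f @ F --> nu -> (fun t => a%:C *: ext (f t)) @ F --> a%:C *: ext nu.
Proof.
move=> /cvg_mxP h; apply/cvg_mxP => i j.
have e M : (a%:C *: ext M) i j =
    (a * ((lo1 m i == lo1 m j) && (lo2 m i == lo2 m j))%:R)%:C * M (src mn i) (src mn j).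
  by rewrite mxE (ext_entry mn) mulrA rmorphM /= rmorph_nat.
have [h1 h2] := h (src mn i) (src mn j).
have Re_mul (c : R) (x : C) : complex.Re (c%:C * x) = c * complex.Re x by case: x => ? ? /=; ring.
have Im_mul (c : R) (x : C) : complex.Im (c%:C * x) = c * complex.Im x by case: x => ? ? /=; ring.
split; [rewrite e Re_mul; under eq_cvg => t do rewrite e Re_mul
       |rewrite e Im_mul; under eq_cvg => t do rewrite e Im_mul]; exact: cvgMr.
Qed.

(** The extension is additive, positive and continuous, so it carries increasing approximations of
    [nu] to increasing approximations of the lifted matrix. *)
Lemma lift_lower_computes (U : machine) (S : nat) (i q : seq bool) (nu : 'M[C]_(2 ^ k * 2 ^ k)) :
  (forall u : nat -> 'M[rat[i]]_(2 ^ k * 2 ^ k),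
     let y := enc_pair [::] (zz m n) in
     (forall s, emits U y q s <-> exists N, prefix s (flatten [seq enc_mx (u j) | j <- iota 0 N])) ->
     (forall s, emits U y (i ++ q) s <->
        exists N, prefix s (flatten [seq enc_mx (lift_rat S mn (u j)) | j <- iota 0 N]))) ->
  lower_computes U (zz m n) q nu ->
  lower_computes U (zz m n) (i ++ q) (((2 ^+ S)^-1)%:C *: ext nu).
Proof.
move=> h [u [hu pu du lim]].
have S0 : 0 <= (2 ^+ S)^-1 :> R by rewrite invr_ge0 exprn_ge0.
exists (fun j => lift_rat S mn (u j)); split; first exact: h.
- by move=> j; rewrite crat_lift_rat; apply: psdZ => //; apply: psd_ext.
- by move=> j; rewrite !crat_lift_rat -scalerBr ext_sub; apply: psdZ => //; apply: psd_ext.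
have -> : (fun j => crat_mx R (lift_rat S mn (u j))) =
    (fun j => ((2 ^+ S)^-1)%:C *: ext (crat_mx R (u j))).
  by apply/funext => j; rewrite crat_lift_rat.
exact: cvg_ext.
Qed.

End LiftTests.

(** Two transformations are nested: [i] acts on the program [q] that lower computes the matrix, and
    [j] on the programs that print [q]. Only the length of [j] is lost, because the weight of
    [i ++ q] is the probability of printing it. *)
Lemma mx_prob_transfer (R : realType) (U : machine) z d d' (nu : 'M[R[i]]_d) (nu' : 'M[R[i]]_d')
    (i j : seq bool) :
  (forall q, lower_computes U z q nu -> lower_computes U z (i ++ q) nu') ->
  (forall p q, computes U (enc_pair [::] z) p q -> computes U (enc_pair [::] z) (j ++ p) (i ++ q)) ->
  (mx_prob U z nu [::] <= (2 ^+ size j)%:E * mx_prob U z nu' [::])%E.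
Proof.
move=> hi hj; rewrite -lee_pdivrMl ?exprn_gt0 // /mx_prob -esumZl ?invr_ge0 ?exprn_ge0 //.
- apply: (@le_esum_inj _ _ _ _ _ _ _ (fun q => i ++ q)).
  + by move=> p q _ _ /eqP; rewrite eqseq_cat // eqxx => /eqP.
  + exact: hi.
  + by move=> q _; apply: univ_prob_ge0.
  + by move=> q _; apply: univ_prob_transfer => p; apply: hj.
- by move=> q _; apply: univ_prob_ge0.
Qed.

Theorem theorem10 (R : realType) (U : machine) (hU : universal U) :
  exists c : R, forall (m n : nat) (mn : (m < n)%N) (sigma rho : 'M[R[i]]_(2 ^ n)),
    semi_density sigma -> semi_density rho ->
    let z := enc_nat m ++ enc_nat n in
    (mutual_info U z (ptrace mn sigma) (ptrace mn rho)
       <= mutual_info U z sigma rho + c%:E)%E.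
Proof.
have [S hS] := @reduce_mu_le R U hU.
have [i hi] := lift_program (S + S) hU.
have [j hj] := prefix_program hU i.
(* [S + S] undoes the scaling of the lifted tests; [size j] pays for printing [i ++ q] instead of
   [q]. *)
exists (S + S + size j)%:R => m n mn sigma rho [psig _] [prho _] /=.
rewrite -/(zz m n) /mutual_info !ptraceE; apply: log2_le.
set k := (n - m)%N; set z := zz m n.
set mun := univ_semi_density R U z n; set muk := univ_semi_density R U z k.
have hmun : psd mun by apply: psd_mu.
have hmuk : psd muk by apply: psd_mu.
have [Kn Kn0 hKn] := one_le_mu R z n hU.
have [Kk Kk0 hKk] := one_le_mu R z k hU.
have psr : psd (sigma *t rho) by apply: psd_tens.
have psr' : psd (reduce m sigma *t reduce m rho) by apply: psd_tens; apply: psd_reduce.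
have test_psd d (mu : 'M[R[i]]_d) nu : tensor_tests U z mu mu nu -> psd nu.
  by move=> [[q hq] _ _]; apply: psd_lower_computes hq.
have tr0 d (M X : 'M[R[i]]_d) : psd M -> psd X -> 0 <= complex.Re (\tr (M *m X)).
  by move=> hM hX; apply: (le_Re (x := 0)); apply: psd_tr_ge0.
pose lift nu := ((2 ^+ (S + S))^-1)%:C *: @ext _ m n nu : 'M[R[i]]_(2 ^ n * 2 ^ n).
have lift_test nu : tensor_tests U z muk muk nu -> tensor_tests U z mun mun (lift nu).
  move=> ht; have hnu := test_psd _ _ _ ht; case: ht => [[q hq] [A [B AB]] tr1]; split.
  - by exists (i ++ q); apply: lift_lower_computes hq => u; apply: hi.
  - have [A' [B' e]] := ext_tens (m := m) (n := n) A B.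
    exists (((2 ^+ (S + S))^-1)%:C *: A'), B'; rewrite /lift AB e.
    by apply/matrixP => a b; rewrite !mxE mulrA.
  (* Adjointness moves the test condition to [nu] paired with reduced matrices, which are dominated
     by [2 ^ S] times [muk] in each factor; the scaling in [lift] cancels exactly this loss. *)
  rewrite /lift -scalemxAl mxtraceZ tr_ext.
  have hle : psd ((2 ^+ S)%:C *: muk - reduce m mun).
    apply: psd_sub_qform; [exact: psd_reduce | exact: psdZ (exprn_ge0 _ _) _ |] => v.
    by rewrite qformZ; apply: hS.
  have := tens_mono hnu (@psd_reduce R m n mun hmun) (psdZ (exprn_ge0 S (ler0n R 2)) hmuk) hle.
  have -> : ((2 ^+ S)%:C *: muk) *t ((2 ^+ S)%:C *: muk) = (2 ^+ (S + S))%:C *: (muk *t muk).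
    by apply/matrixP => a b; rewrite !mxE exprD rmorphM /=; ring.
  rewrite -scalemxAr mxtraceZ => h; rewrite -[leRHS](mulVf (x := (2 ^+ (S + S))%:C)); last first.
    by rewrite gt_eqF // ltcR exprn_gt0.
  rewrite fmorphV ler_wpM2l ?invr_ge0 ?lecR ?exprn_ge0 //.
  by apply: le_trans h _; rewrite ler_piMr // lecR exprn_ge0.
(* Both traces become sums of nonnegative terms over tests, so that [lift] can be used as an
   injection of index sets. *)
rewrite -lee_fin (tr_test_sum Kk0 hmuk hKk) => [|nu /test_psd]; last by move=> ?; apply: tr0.
rewrite EFinM (tr_test_sum Kn0 hmun hKn) => [|nu /test_psd]; last by move=> ?; apply: tr0.
rewrite -esumZl ?exprn_ge0 // => [|nu /test_psd hnu]; last first.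
  by rewrite mule_ge0 ?mx_prob_ge0 // lee_fin tr0.
apply: (@le_esum_inj _ _ _ _ _ _ _ lift).
- move=> nu nu' _ _ /matrixP e; apply: (ext_inj mn); apply/matrixP => a b.
  have := e a b; rewrite !mxE => /mulfI; apply.
  by rewrite gt_eqF // ltcR invr_gt0 exprn_gt0.
- exact: lift_test.
- move=> nu /test_psd hnu; rewrite mule_ge0 ?lee_fin ?exprn_ge0 //.
  by rewrite mule_ge0 ?mx_prob_ge0 // lee_fin tr0.
move=> nu hnu.
have -> : \tr (nu *m (reduce m sigma *t reduce m rho)) =
   (2 ^+ (S + S))%:C * \tr (lift nu *m (sigma *t rho)).
  by rewrite -tr_ext /lift -scalemxAl mxtraceZ mulrA -rmorphM /= mulfV ?mul1r.
have h := mx_prob_transfer (fun q => @lift_lower_computes R m n mn U (S + S) i q nu (hi m n mn q)) (hj m n).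
rewrite (_ : complex.Re _ = 2 ^+ (S + S) * complex.Re (\tr (lift nu *m (sigma *t rho)))); last first.
  by case: (\tr _) => a b /=; ring.
apply: le_trans (lee_wpmul2r _ h) _.
  rewrite lee_fin; apply: mulr_ge0; first exact: exprn_ge0.
  exact: tr0 (test_psd _ _ _ (lift_test _ hnu)) psr.
by rewrite [(2 ^+ (_ + size j))]exprD !EFinM /lift; rewrite muleCA !muleA lexx.
Qed.
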